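(* The equation $$\frac{2^{\sigma+1}}{4^\sigma-1}\log 2=-\frac{\zeta'(\sigma)}{\zeta(\sigma)},\qquad \sigma>1,$$ has a unique solution, denoted $E$. Then $\zeta'(s)\neq 0$ for all $s$ with $\mathrm{Re}\, s>E$, while $\zeta'(s)$ has a sequence of zeros $(s_k)$ with $\lim_k \mathrm{Re}(s_k)=E$. Numerically, $E=2.81301\,40202\,52898\,36752\,72554\,01216\,68696\,38461\,40560\dots$
   Context: $\zeta$ denotes the Riemann zeta function and $\zeta'$ its derivative. *)

(* Defs.v *)
From Stdlib Require Import Reals.
From Coquelicot Require Import Coquelicot.
Open Scope R_scope.

Definition Cexp (z : C) : C :=
  (exp (Re z) * cos (Im z), exp (Re z) * sin (Im z)).

(* The complex power [x ^ s = exp (s * log x)] with the real logarithm; only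
   meaningful for [x > 0]. *)
Definition RpowC (x : R) (s : C) : C := Cexp (s * RtoC (ln x))%C.

Definition zeta_term (s : C) (n : nat) : C := RpowC (INR (S n)) (- s)%C.

(* The Riemann zeta function on the half-plane [Re s > 1], as the Dirichlet
   series [1 + 2^(-s) + 3^(-s) + ...]. Coquelicot's [Series] is real-valued, so
   the real and imaginary parts are summed separately. Outside that half-plane
   this is a junk value, not the analytic continuation. *)
Definition zeta (s : C) : C :=
  (Series (fun n => Re (zeta_term s n)), Series (fun n => Im (zeta_term s n))).

(* [C_derive f z] is computed as a limit along the horizontal line through [z];
   it is the complex derivative wherever [f] is complex differentiable
   ([C_derive_correct]), in particular for [zeta] when [Re s > 1]. *)
Definition zeta' (s : C) : C := C_derive zeta s.

Definition E_equation (sigma : R) : Prop :=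
  RtoC (Rpower 2 (sigma + 1) / (Rpower 4 sigma - 1) * ln 2)
  = (- (zeta' (RtoC sigma) / zeta (RtoC sigma)))%C.

(* Main.v *)
(** Let [x = 2^(-s)], [q = 2^(-Re s)] and let [Q(s)] be the sum of [Lambda(m) m^(-s)] over odd [m].
    Then [- zeta'/zeta (s) = Q(s) + ln 2 x / (1 - x)]. For real [s] the equation defining [E] reads
    [Q = ln 2 q / (1 + q)], that is [(2^s + 1) Q(s) = ln 2], and the left-hand side is strictly
    decreasing because each of its terms is. If [Re s > E] then
    [|Q(s)| <= Q(Re s) < ln 2 q / (1 + q) <= |ln 2 x / (1 - x)|], so [zeta'] does not vanish.

    For the zeros, let [chi] be the completely multiplicative function with [chi(2) = -1] and
    [chi(p) = 1] for odd primes. The series [sum chi(n) ln n n^(-s)] has a simple zero at [E], and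
    some vertical translate of [zeta'] is as close as we like to it, because [n^(-it)] can be made
    close to [chi(n)] for all [n <= N] simultaneously. A Newton contraction then gives a zero of
    [zeta'] near the line [Re s = E].

    The decimals of [E] come from the signs at two points of a combination of the alternating
    series of [n^(-s)] and [ln n n^(-s)], evaluated by Euler's transformation in
    fixed-point ball arithmetic over [Z]. *)
Require Import Defs.
From Stdlib Require Import Reals Lra Lia Psatz Classical ClassicalChoice Ranalysis5.
From Stdlib Require Import List ZArith NArith.
From Coquelicot Require Import Coquelicot.
From mathcomp Require ssreflect ssrfun ssrbool eqtype ssrnat seq div prime.
Open Scope R_scope.
Set Bullet Behavior "Strict Subproofs".

(** * Absolutely convergent complex series *)

(** The left side of the equation is [ln 2 q / (1 - q) + ln 2 q / (1 + q)]: the first summand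
    cancels the Euler factor at 2, the second is the least modulus that factor can contribute on the
    line. The character [chi] realises this extremal phase, turning [x] into [- x] while the odd
    primes keep phase 1.

    The approximation of [chi] avoids linear independence of logarithms: a Fejer-type weight, the
    squared modulus of a Dirichlet polynomial over a set nearly stable under multiplication by small
    integers, only needs different integers to have different logarithms. The translate is compared
    with the twisted series in value and in Lipschitz constant, so that a contraction replaces
    Rouche's theorem; this is why the zero must be simple.

    The numerical bracket is more than a postscript: it yields the existence of [E], and [E > 5/2]
    makes a crude proof that [zeta] has no zeros, and bounds by series at abscissa 2, sufficient. *)

Definition CSeries (u : nat -> C) : C :=
  (Series (fun n => Re (u n)), Series (fun n => Im (u n))).

Definition abs_summable (u : nat -> C) : Prop := ex_series (fun n => Cmod (u n)).

Lemma im_le_Cmod (z : C) : Rabs (Im z) <= Cmod z.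
Proof.
  eapply Rle_trans; [|apply Rmax_Cmod]. apply Rmax_r.
Qed.

Lemma ex_series_bound (a b : nat -> R) :
  (forall n, Rabs (a n) <= b n) -> ex_series b -> ex_series a.
Proof. intros H. exact (ex_series_le a b H). Qed.

Lemma ex_series_Rmult_l (c : R) (a : nat -> R) :
  ex_series a -> ex_series (fun n => c * a n).
Proof. exact (ex_series_scal_l c a). Qed.

Lemma ex_series_Rplus (a b : nat -> R) :
  ex_series a -> ex_series b -> ex_series (fun n => a n + b n).
Proof. exact (ex_series_plus a b). Qed.

Lemma Series_zero (a : nat -> R) : (forall n, a n = 0) -> Series a = 0.
Proof.
  intros H. rewrite (Series_ext a (fun n => 0 * 0)) by (intros n; rewrite H; ring).
  rewrite Series_scal_l. ring.
Qed.

Lemma abs_summable_bound (u : nat -> C) (b : nat -> R) :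
  (forall n, Cmod (u n) <= b n) -> ex_series b -> abs_summable u.
Proof.
  intros H. apply ex_series_bound. intros n. rewrite Rabs_pos_eq; auto using Cmod_ge_0.
Qed.

Lemma abs_summable_Re (u : nat -> C) : abs_summable u -> ex_series (fun n => Re (u n)).
Proof. apply ex_series_bound. intros n. apply re_le_Cmod. Qed.

Lemma abs_summable_Im (u : nat -> C) : abs_summable u -> ex_series (fun n => Im (u n)).
Proof. apply ex_series_bound. intros n. apply im_le_Cmod. Qed.

Lemma CSeries_ext (u v : nat -> C) : (forall n, u n = v n) -> CSeries u = CSeries v.
Proof.
  intros H. unfold CSeries. f_equal; apply Series_ext; intros n; now rewrite H.
Qed.

Lemma abs_summable_ext (u v : nat -> C) :
  (forall n, u n = v n) -> abs_summable u -> abs_summable v.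
Proof. intros H. apply ex_series_ext. intros n. now rewrite H. Qed.

Lemma abs_summable_plus (u v : nat -> C) :
  abs_summable u -> abs_summable v -> abs_summable (fun n => u n + v n)%C.
Proof.
  intros Hu Hv. apply abs_summable_bound with (fun n => Cmod (u n) + Cmod (v n)).
  - intros n. apply Cmod_triangle.
  - now apply (ex_series_plus (fun n => Cmod (u n)) (fun n => Cmod (v n))).
Qed.

Lemma abs_summable_scal (c : C) (u : nat -> C) :
  abs_summable u -> abs_summable (fun n => c * u n)%C.
Proof.
  intros Hu. apply abs_summable_bound with (fun n => Cmod c * Cmod (u n)).
  - intros n. rewrite Cmod_mult. lra.
  - now apply (ex_series_scal_l (Cmod c) (fun n => Cmod (u n))).
Qed.

Lemma CSeries_plus (u v : nat -> C) :
  abs_summable u -> abs_summable v ->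
  CSeries (fun n => u n + v n)%C = (CSeries u + CSeries v)%C.
Proof.
  intros Hu Hv. unfold CSeries, Cplus. simpl. f_equal.
  - apply (Series_plus (fun n => Re (u n)) (fun n => Re (v n))); now apply abs_summable_Re.
  - apply (Series_plus (fun n => Im (u n)) (fun n => Im (v n))); now apply abs_summable_Im.
Qed.

Lemma CSeries_scal (c : C) (u : nat -> C) :
  abs_summable u -> CSeries (fun n => c * u n)%C = (c * CSeries u)%C.
Proof.
  intros Hu. pose proof (abs_summable_Re _ Hu). pose proof (abs_summable_Im _ Hu).
  unfold CSeries, Cmult. simpl. rewrite <- !Series_scal_l. f_equal.
  - rewrite <- Series_minus; [reflexivity| |];
      apply ex_series_Rmult_l; assumption.
  - rewrite <- Series_plus; [reflexivity| |];
      apply ex_series_Rmult_l; assumption.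
Qed.

Lemma CSeries_minus (u v : nat -> C) :
  abs_summable u -> abs_summable v ->
  CSeries (fun n => u n - v n)%C = (CSeries u - CSeries v)%C.
Proof.
  intros Hu Hv.
  transitivity (CSeries (fun n => u n + (- (1)) * v n)%C).
  { apply CSeries_ext. intros n. ring. }
  rewrite CSeries_plus, CSeries_scal; auto using abs_summable_scal. ring.
Qed.

Lemma CSeries_RtoC (a : nat -> R) : CSeries (fun n => RtoC (a n)) = RtoC (Series a).
Proof.
  unfold CSeries, RtoC. simpl. f_equal. now apply Series_zero.
Qed.

(* The modulus of [z] is recovered from the real-linear form
   [w |-> Re (conj z * w)], so a real-valued series bound suffices. *)
Lemma Cmod_le_of_dual (z : C) (B : R) :
  0 <= B -> Re (Cconj z * z)%C <= Cmod z * B -> Cmod z <= B.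
Proof.
  intros HB H.
  assert (E : Re (Cconj z * z)%C = Cmod z * Cmod z).
  { transitivity (Cmod z ^ 2); [|ring]. rewrite Cmod2_alt. destruct z; simpl; ring. }
  rewrite E in H. pose proof (Cmod_ge_0 z).
  destruct (Rle_lt_dec (Cmod z) B); auto. nra.
Qed.

Lemma Cmod_CSeries_le (u : nat -> C) (b : nat -> R) :
  (forall n, Cmod (u n) <= b n) -> ex_series b -> Cmod (CSeries u) <= Series b.
Proof.
  intros H Hb. pose proof (abs_summable_bound _ _ H Hb) as Hu.
  assert (H0 : forall n, 0 <= b n) by (intros n; eapply Rle_trans; [apply Cmod_ge_0|apply H]).
  apply Cmod_le_of_dual.
  - rewrite <- (Series_zero (fun _ => 0)) by auto. apply Series_le; auto. intros n; split; auto; lra.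
  - rewrite <- CSeries_scal by auto. unfold CSeries at 1. simpl Re at 1.
    rewrite <- Series_scal_l.
    assert (H1 : forall n, Rabs (Re (Cconj (CSeries u) * u n)%C) <= Cmod (CSeries u) * b n).
    { intros n. eapply Rle_trans; [apply re_le_Cmod|]. rewrite Cmod_mult, Cmod_conj.
      apply Rmult_le_compat_l; auto using Cmod_ge_0. }
    assert (E1 : ex_series (fun n => Cmod (CSeries u) * b n))
      by now apply (ex_series_scal_l (Cmod (CSeries u)) b).
    eapply Rle_trans; [apply Rle_abs|]. eapply Rle_trans.
    + apply Series_Rabs. apply ex_series_bound with (2 := E1).
      intros n. rewrite Rabs_Rabsolu. apply H1.
    + apply Series_le; auto. intros n; split; [apply Rabs_pos|apply H1].
Qed.

(** * The complex exponential *)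

Lemma exp_le_compat (x y : R) : x <= y -> exp x <= exp y.
Proof.
  intros [H| ->]; [left; now apply exp_increasing|right; reflexivity].
Qed.

Lemma Cexp_plus (u v : C) : Cexp (u + v)%C = (Cexp u * Cexp v)%C.
Proof.
  destruct u as [a b], v as [c d]. unfold Cexp, Cplus, Cmult; simpl.
  rewrite exp_plus, cos_plus, sin_plus. f_equal; ring.
Qed.

Lemma Cexp_0 : Cexp (RtoC 0) = RtoC 1.
Proof. unfold Cexp, RtoC; simpl. rewrite exp_0, cos_0, sin_0. f_equal; ring. Qed.

Lemma Cexp_RtoC (x : R) : Cexp (RtoC x) = RtoC (exp x).
Proof. unfold Cexp, RtoC; simpl. rewrite cos_0, sin_0. f_equal; ring. Qed.

Lemma Cmod_Cexp (z : C) : Cmod (Cexp z) = exp (Re z).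
Proof.
  unfold Cmod, Cexp; simpl.
  replace (_ + _) with (exp (Re z) * exp (Re z) * (Rsqr (sin (Im z)) + Rsqr (cos (Im z))))
    by (unfold Rsqr; ring).
  rewrite sin2_cos2, Rmult_1_r. apply sqrt_square. left; apply exp_pos.
Qed.

Lemma Cexp_neq_0 (z : C) : Cexp z <> RtoC 0.
Proof. apply Cmod_gt_0. rewrite Cmod_Cexp. apply exp_pos. Qed.

(* The scalar mean value theorem is applied to the projection of the path on
   the direction of its increment. *)
Lemma Cmod_increment_le (f f' : R -> C) (B : R) :
  (forall t, is_derive (fun x => Re (f x)) t (Re (f' t))) ->
  (forall t, is_derive (fun x => Im (f x)) t (Im (f' t))) ->
  (forall t, 0 <= t <= 1 -> Cmod (f' t) <= B) ->
  Cmod (f 1 - f 0)%C <= B.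
Proof.
  intros Hr Hi HB.
  assert (B0 : 0 <= B) by (eapply Rle_trans; [apply Cmod_ge_0|apply (HB 0); lra]).
  apply Cmod_le_of_dual; auto.
  set (z := (f 1 - f 0)%C).
  destruct (MVT_gen (fun x => Re z * Re (f x) + Im z * Im (f x)) 0 1
      (fun x => Re z * Re (f' x) + Im z * Im (f' x))) as (c & Hc & E).
  - intros x _. apply (is_derive_plus (fun x => Re z * Re (f x)) (fun x => Im z * Im (f x))).
    + apply is_derive_scal; auto.
    + apply is_derive_scal; auto.
  - intros x _. apply continuity_pt_plus; apply continuity_pt_scal; 
    apply derivable_continuous_pt; eexists; apply is_derive_Reals; auto.
  - rewrite Rmin_left, Rmax_right in Hc by lra.
    replace (Re (Cconj z * z)%C) with (Re (Cconj z * f' c)%C).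
    + eapply Rle_trans; [apply Rle_abs|]. eapply Rle_trans; [apply re_le_Cmod|].
      rewrite Cmod_mult, Cmod_conj. apply Rmult_le_compat_l; auto using Cmod_ge_0.
    + rewrite Rminus_0_r, Rmult_1_r in E. unfold z in *. destruct (f 1), (f 0), (f' c). simpl in *.
      lra.
Qed.

Lemma Cexp_path_derive (u v : C) (t : R) :
  is_derive (fun x => Re (Cexp (v + RtoC x * (u - v))%C)) t
    (Re ((u - v) * Cexp (v + RtoC t * (u - v)))%C) /\
  is_derive (fun x => Im (Cexp (v + RtoC x * (u - v))%C)) t
    (Im ((u - v) * Cexp (v + RtoC t * (u - v)))%C).
Proof.
  destruct u as [a b], v as [c d]. unfold Cexp; simpl.
  split; auto_derive; auto; unfold Rminus; ring.
Qed.

Lemma Re_segment_le (u v : C) (M t : R) :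
  Re u <= M -> Re v <= M -> 0 <= t <= 1 -> Re (v + RtoC t * (u - v))%C <= M.
Proof. intros Hu Hv Ht. destruct u, v; simpl in *. nra. Qed.

Lemma Cmod_segment_le (u v w : C) (r t : R) :
  Cmod (u - w)%C <= r -> Cmod (v - w)%C <= r -> 0 <= t <= 1 ->
  Cmod (v + RtoC t * (u - v) - w)%C <= r.
Proof.
  intros Hu Hv Ht.
  replace (v + RtoC t * (u - v) - w)%C
    with (RtoC (1 - t) * (v - w) + RtoC t * (u - w))%C by (rewrite RtoC_minus; ring).
  eapply Rle_trans; [apply Cmod_triangle|]. rewrite !Cmod_mult, !Cmod_R, !Rabs_pos_eq by lra. nra.
Qed.

Lemma Cexp_lipschitz (u v : C) (M : R) :
  Re u <= M -> Re v <= M -> Cmod (Cexp u - Cexp v)%C <= Cmod (u - v)%C * exp M.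
Proof.
  intros Hu Hv.
  pose proof (Cmod_increment_le (fun x => Cexp (v + RtoC x * (u - v))%C)
    (fun t => (u - v) * Cexp (v + RtoC t * (u - v)))%C (Cmod (u - v)%C * exp M)) as K.
  replace u with (v + RtoC 1 * (u - v))%C at 1 by ring.
  replace v with (v + RtoC 0 * (u - v))%C at 3 by ring.
  apply K; try (intros; apply Cexp_path_derive).
  intros t Ht. rewrite Cmod_mult, Cmod_Cexp.
  apply Rmult_le_compat_l; auto using Cmod_ge_0. apply exp_le_compat. now apply Re_segment_le.
Qed.

(** Subtracting the linear path with slope [(u - v) * Cexp w] leaves a derivative that
    [Cexp_lipschitz] bounds. The base point [w] is independent of [u] and [v], because the Newton
    step freezes the derivative at the centre of a disc. *)
Lemma Cexp_taylor1 (u v w : C) (M r : R) :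
  Re u <= M -> Re v <= M -> Re w <= M -> Cmod (u - w)%C <= r -> Cmod (v - w)%C <= r ->
  Cmod (Cexp u - Cexp v - (u - v) * Cexp w)%C <= Cmod (u - v)%C * (r * exp M).
Proof.
  intros Hu Hv Hw Ru Rv.
  pose proof (Cmod_increment_le
    (fun x => Cexp (v + RtoC x * (u - v)) - RtoC x * ((u - v) * Cexp w))%C
    (fun t => (u - v) * Cexp (v + RtoC t * (u - v)) - (u - v) * Cexp w)%C
    (Cmod (u - v)%C * (r * exp M))) as K.
  replace (Cexp u - Cexp v - (u - v) * Cexp w)%C with
    ((Cexp (v + RtoC 1 * (u - v)) - RtoC 1 * ((u - v) * Cexp w)) -
     (Cexp (v + RtoC 0 * (u - v)) - RtoC 0 * ((u - v) * Cexp w)))%C.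
  2:{ replace (v + RtoC 1 * (u - v))%C with u by ring.
      replace (v + RtoC 0 * (u - v))%C with v by ring. ring. }
  apply K.
  - intros t. pose proof (proj1 (Cexp_path_derive u v t)) as H.
    apply (is_derive_minus (fun x => Re (Cexp (v + RtoC x * (u - v))%C))
      (fun x => Re (RtoC x * ((u - v) * Cexp w))%C) t _ _ H).
    generalize ((u - v) * Cexp w)%C; intros [a b]. simpl. auto_derive; auto; ring.
  - intros t. pose proof (proj2 (Cexp_path_derive u v t)) as H.
    apply (is_derive_minus (fun x => Im (Cexp (v + RtoC x * (u - v))%C))
      (fun x => Im (RtoC x * ((u - v) * Cexp w))%C) t _ _ H).
    generalize ((u - v) * Cexp w)%C; intros [a b]. simpl. auto_derive; auto; ring.
  - intros t Ht.
    replace ((u - v) * Cexp (v + RtoC t * (u - v)) - (u - v) * Cexp w)%C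
      with ((u - v) * (Cexp (v + RtoC t * (u - v)) - Cexp w))%C by ring.
    rewrite Cmod_mult. apply Rmult_le_compat_l; auto using Cmod_ge_0.
    eapply Rle_trans; [apply Cexp_lipschitz with (M := M); auto using Re_segment_le|].
    apply Rmult_le_compat_r; [left; apply exp_pos|]. now apply Cmod_segment_le.
Qed.

(** * Dirichlet series *)

Lemma nonneg_series_bounded (a : nat -> R) (B : R) :
  (forall n, 0 <= a n) -> (forall N, sum_n a N <= B) -> ex_series a /\ Series a <= B.
Proof.
  intros H0 HB.
  destruct (ex_finite_lim_seq_incr (sum_n a) B) as [l Hl]; auto.
  { intros n. rewrite sum_Sn. unfold plus; simpl. specialize (H0 (S n)). lra. }
  assert (Hs : is_series a l) by exact Hl.
  split; [now exists l|]. rewrite (is_series_unique _ _ Hs).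
  apply (is_lim_seq_le (sum_n a) (fun _ => B) l B HB Hl (is_lim_seq_const B)).
Qed.

Lemma sum_n_le_Series (a : nat -> R) (N : nat) :
  (forall n, 0 <= a n) -> ex_series a -> sum_n a N <= Series a.
Proof.
  intros H0 Ha. rewrite (Series_incr_n a (S N)) by (auto; lia). simpl Init.Nat.pred.
  rewrite <- sum_n_Reals.
  enough (0 <= Series (fun k => a (S N + k)%nat)) by lra.
  rewrite <- (Series_zero (fun _ => 0)) by auto. apply Series_le.
  - intros n. split; [lra|auto].
  - now apply (ex_series_incr_n a).
Qed.

Definition lnS (n : nat) : R := ln (INR (S n)).

Lemma INR_S_pos (n : nat) : 0 < INR (S n).
Proof. apply lt_0_INR; lia. Qed.

Lemma exp_lnS (n : nat) : exp (lnS n) = INR (S n).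
Proof. apply exp_ln, INR_S_pos. Qed.

Lemma lnS_ge_0 (n : nat) : 0 <= lnS n.
Proof.
  unfold lnS. rewrite <- ln_1. apply ln_le; [lra|]. rewrite S_INR. pose proof (pos_INR n). lra.
Qed.

Lemma lnS_0 : lnS 0 = 0.
Proof. unfold lnS. simpl. apply ln_1. Qed.

(** A discrete form of integrating [x^(-1-d)], obtained from [1 + x <= exp x] alone. Summation
    telescopes and gives the explicit bound [1 / (s - 1)] for the zeta series without its first
    term. *)
Lemma npow_telescope (d : R) (n : nat) : 0 < d ->
  d * exp (- (1 + d) * lnS (S n)) <= exp (- d * lnS n) - exp (- d * lnS (S n)).
Proof.
  intros Hd. set (x := lnS n). set (y := lnS (S n)).
  assert (Hxy : exp (- y) <= y - x).
  { assert (exp (x - y) = 1 - exp (- y)).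
    { unfold Rminus. rewrite exp_plus.
      replace (exp x) with (exp y - 1)
        by (unfold x, y; rewrite !exp_lnS, (S_INR (S n)); ring).
      rewrite exp_Ropp. field. apply Rgt_not_eq, exp_pos. }
    pose proof (exp_ineq1_le (x - y)). lra. }
  replace (- (1 + d) * y) with (- d * y + - y) by ring.
  replace (- d * x) with (- d * y + d * (y - x)) by ring.
  rewrite !exp_plus.
  pose proof (exp_pos (- d * y)). pose proof (exp_ineq1_le (d * (y - x))).
  apply Rle_trans with (exp (- d * y) * (d * (y - x))); [|nra].
  rewrite <- Rmult_assoc, (Rmult_comm d), Rmult_assoc.
  apply Rmult_le_compat_l; [lra|]. apply Rmult_le_compat_l; lra.
Qed.

Lemma ex_series_npow_tail (s : R) : 1 < s ->
  ex_series (fun n => exp (- s * lnS (S n))) /\ Series (fun n => exp (- s * lnS (S n))) <= / (s - 1).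
Proof.
  intros Hs. apply nonneg_series_bounded; [intros; left; apply exp_pos|].
  assert (K : forall N, (s - 1) * sum_n (fun n => exp (- s * lnS (S n))) N
                        <= 1 - exp (- (s - 1) * lnS (S N))).
  { induction N as [|N IH].
    - rewrite sum_O. pose proof (npow_telescope (s - 1) 0 ltac:(lra)) as T.
      replace (1 + (s - 1)) with s in T by ring. rewrite lnS_0, Rmult_0_r, exp_0 in T. lra.
    - rewrite sum_Sn. unfold plus; simpl.
      pose proof (npow_telescope (s - 1) (S N) ltac:(lra)) as T.
      replace (1 + (s - 1)) with s in T by ring. lra. }
  intros N. specialize (K N). pose proof (exp_pos (- (s - 1) * lnS (S N))).
  apply Rmult_le_reg_l with (s - 1); [lra|]. rewrite Rinv_r by lra. lra.
Qed.

Lemma ex_series_npow (s : R) : 1 < s -> ex_series (fun n => exp (- s * lnS n)).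
Proof.
  intros Hs. apply ex_series_incr_1. now apply ex_series_npow_tail.
Qed.

(** Half of the exponent absorbs one factor [1 + x], the other half is left for the induction. The
    rate [d] is therefore quantified inside the induction. *)
Lemma pow_le_exp (j : nat) : forall d : R, 0 < d ->
  exists K, 0 < K /\ forall x, 0 <= x -> (1 + x) ^ j <= K * exp (d * x).
Proof.
  induction j as [|j IH]; intros d Hd.
  - exists 1. split; [lra|]. intros x Hx. simpl. pose proof (exp_ineq1_le (d * x)). nra.
  - destruct (IH (d / 2) ltac:(lra)) as (K & HK & H).
    exists (K * (1 + 2 / d)). assert (0 < 2 / d) by (apply Rdiv_lt_0_compat; lra).
    split; [apply Rmult_lt_0_compat; lra|].
    intros x Hx. simpl.
    replace (d * x) with (d / 2 * x + d / 2 * x) by field. rewrite exp_plus.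
    specialize (H x Hx). pose proof (exp_ineq1_le (d / 2 * x)).
    assert (1 + x <= (1 + 2 / d) * exp (d / 2 * x)).
    { apply Rle_trans with ((1 + 2 / d) * (1 + d / 2 * x)); [|apply Rmult_le_compat_l; lra].
      replace ((1 + 2 / d) * (1 + d / 2 * x)) with (1 + 2 / d + x + d / 2 * x) by (field; lra).
      assert (0 <= d / 2 * x) by nra. lra. }
    replace (K * (1 + 2 / d) * (exp (d / 2 * x) * exp (d / 2 * x)))
      with (((1 + 2 / d) * exp (d / 2 * x)) * (K * exp (d / 2 * x))) by ring.
    apply Rmult_le_compat; auto; try lra. apply pow_le; lra.
Qed.

Lemma ex_series_log_npow (j : nat) (s : R) : 1 < s ->
  ex_series (fun n => (1 + lnS n) ^ j * exp (- s * lnS n)).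
Proof.
  intros Hs. destruct (pow_le_exp j ((s - 1) / 2) ltac:(lra)) as (K & HK & H).
  apply ex_series_bound with (fun n => K * exp (- ((s + 1) / 2) * lnS n)).
  - intros n. pose proof (lnS_ge_0 n). rewrite Rabs_pos_eq.
    2:{ apply Rmult_le_pos; [apply pow_le; lra|left; apply exp_pos]. }
    replace (- ((s + 1) / 2) * lnS n) with ((s - 1) / 2 * lnS n + - s * lnS n) by field.
    rewrite exp_plus, <- Rmult_assoc. apply Rmult_le_compat_r; [left; apply exp_pos|auto].
  - apply ex_series_Rmult_l, ex_series_npow. lra.
Qed.

(** This class is closed under multiplication by [clog], that is under termwise differentiation, and
    every series in it converges absolutely for [Re s > 1]. *)
Definition log_bounded (c : nat -> C) : Prop :=
  exists (K : R) (j : nat), forall n, Cmod (c (S n)) <= K * (1 + lnS n) ^ j.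

Lemma log_bounded_of_bounded (c : nat -> C) (K : R) :
  (forall n, Cmod (c n) <= K) -> log_bounded c.
Proof. intros H. exists K, 0%nat. intros n. rewrite Rmult_1_r. auto. Qed.

Lemma log_bounded_mult (c d : nat -> C) :
  log_bounded c -> log_bounded d -> log_bounded (fun n => c n * d n)%C.
Proof.
  intros (K & j & H) (K' & j' & H'). exists (K * K'), (j + j')%nat. intros n.
  rewrite Cmod_mult, pow_add.
  replace (K * K' * ((1 + lnS n) ^ j * (1 + lnS n) ^ j'))
    with ((K * (1 + lnS n) ^ j) * (K' * (1 + lnS n) ^ j')) by ring.
  apply Rmult_le_compat; auto using Cmod_ge_0.
Qed.

Definition clog (n : nat) : C := RtoC (ln (INR n)).

Lemma Cmod_clog (n : nat) : Cmod (clog (S n)) = lnS n.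
Proof. unfold clog. rewrite Cmod_R. apply Rabs_pos_eq, lnS_ge_0. Qed.

Lemma log_bounded_clog : log_bounded clog.
Proof. exists 1, 1%nat. intros n. rewrite Cmod_clog. lra. Qed.

(* Coefficients are indexed by the integer [n >= 1]; the value [c 0] is irrelevant. *)
Definition dterm (c : nat -> C) (s : C) (n : nat) : C := (c (S n) * zeta_term s n)%C.

Definition Dseries (c : nat -> C) (s : C) : C := CSeries (dterm c s).

Lemma zeta_term_exp (s : C) (n : nat) : zeta_term s n = Cexp (- s * RtoC (lnS n))%C.
Proof. reflexivity. Qed.

Lemma Cmod_zeta_term (s : C) (n : nat) : Cmod (zeta_term s n) = exp (- Re s * lnS n).
Proof.
  rewrite zeta_term_exp, Cmod_Cexp. f_equal. destruct s; simpl. ring.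
Qed.

Lemma Cmod_dterm (c : nat -> C) (s : C) (n : nat) :
  Cmod (dterm c s n) = Cmod (c (S n)) * exp (- Re s * lnS n).
Proof. unfold dterm. now rewrite Cmod_mult, Cmod_zeta_term. Qed.

Lemma log_bounded_ex_series (c : nat -> C) (s : R) : log_bounded c -> 1 < s ->
  ex_series (fun n => Cmod (c (S n)) * exp (- s * lnS n)).
Proof.
  intros (K & j & H) Hs.
  apply ex_series_bound with (fun n => K * ((1 + lnS n) ^ j * exp (- s * lnS n))).
  - intros n. rewrite Rabs_pos_eq.
    + rewrite <- Rmult_assoc. apply Rmult_le_compat_r; [left; apply exp_pos|auto].
    + apply Rmult_le_pos; [apply Cmod_ge_0|left; apply exp_pos].
  - now apply ex_series_Rmult_l, ex_series_log_npow.
Qed.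

Lemma dterm_summable (c : nat -> C) (s : C) :
  log_bounded c -> 1 < Re s -> abs_summable (dterm c s).
Proof.
  intros Hc Hs. apply ex_series_ext with (fun n => Cmod (c (S n)) * exp (- Re s * lnS n)).
  - intros n. symmetry. apply Cmod_dterm.
  - now apply log_bounded_ex_series.
Qed.

Lemma Cmod_Dseries_le (c : nat -> C) (b : nat -> R) (s : C) (s0 : R) :
  (forall n, Cmod (c (S n)) <= b n) -> s0 <= Re s ->
  ex_series (fun n => b n * exp (- s0 * lnS n)) ->
  Cmod (Dseries c s) <= Series (fun n => b n * exp (- s0 * lnS n)).
Proof.
  intros H Hs Hb. apply Cmod_CSeries_le; auto. intros n. rewrite Cmod_dterm.
  apply Rmult_le_compat; auto using Cmod_ge_0.
  - left; apply exp_pos.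
  - apply exp_le_compat. pose proof (lnS_ge_0 n). nra.
Qed.

Lemma Dseries_plus (c d : nat -> C) (s : C) : log_bounded c -> log_bounded d -> 1 < Re s ->
  Dseries (fun n => c n + d n)%C s = (Dseries c s + Dseries d s)%C.
Proof.
  intros Hc Hd Hs. unfold Dseries. rewrite <- CSeries_plus by now apply dterm_summable.
  apply CSeries_ext. intros n. unfold dterm. ring.
Qed.

Lemma Dseries_scal (a : C) (c : nat -> C) (s : C) : log_bounded c -> 1 < Re s ->
  Dseries (fun n => a * c n)%C s = (a * Dseries c s)%C.
Proof.
  intros Hc Hs. unfold Dseries. rewrite <- CSeries_scal by now apply dterm_summable.
  apply CSeries_ext. intros n. unfold dterm. ring.
Qed.

Lemma Dseries_ext (c d : nat -> C) (s : C) :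
  (forall n, c (S n) = d (S n)) -> Dseries c s = Dseries d s.
Proof. intros H. apply CSeries_ext. intros n. unfold dterm. now rewrite H. Qed.

Lemma Dseries_lipschitz (c : nat -> C) (z w : C) (s0 : R) :
  log_bounded c -> 1 < s0 -> s0 <= Re z -> s0 <= Re w ->
  Cmod (Dseries c z - Dseries c w)%C <=
  Cmod (z - w)%C * Series (fun n => Cmod (clog (S n) * c (S n))%C * exp (- s0 * lnS n)).
Proof.
  intros Hc H0 Hz Hw. unfold Dseries.
  rewrite <- CSeries_minus by (apply dterm_summable; auto; lra).
  rewrite <- Series_scal_l. apply Cmod_CSeries_le.
  - intros n. unfold dterm. rewrite !zeta_term_exp.
    pose proof (lnS_ge_0 n) as Hl.
    replace (c (S n) * Cexp (- z * RtoC (lnS n)) - c (S n) * Cexp (- w * RtoC (lnS n)))%C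
      with (c (S n) * (Cexp (- z * RtoC (lnS n)) - Cexp (- w * RtoC (lnS n))))%C by ring.
    rewrite !Cmod_mult, Cmod_clog.
    pose proof (Cexp_lipschitz (- z * RtoC (lnS n)) (- w * RtoC (lnS n)) (- s0 * lnS n)) as K.
    assert (K1 : forall x : C, s0 <= Re x -> Re (- x * RtoC (lnS n))%C <= - s0 * lnS n)
      by (intros [x y] Hx; simpl in *; nra).
    specialize (K (K1 z Hz) (K1 w Hw)).
    replace (- z * RtoC (lnS n) - - w * RtoC (lnS n))%C
      with (- (z - w) * RtoC (lnS n))%C in K by ring.
    rewrite Cmod_mult, Cmod_opp, Cmod_R, Rabs_pos_eq in K by auto.
    apply Rle_trans with (Cmod (c (S n)) * (Cmod (z - w) * lnS n * exp (- s0 * lnS n))); [|lra].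
    apply Rmult_le_compat_l; auto using Cmod_ge_0.
  - apply ex_series_Rmult_l.
    now apply (log_bounded_ex_series (fun n => clog n * c n)%C); auto using log_bounded_mult, log_bounded_clog.
Qed.

(** The derivative of [n^(-s)] is [- ln n n^(-s)], whence the plus sign. The second-order series at
    [s0] controls how far the derivative varies on the disc of radius [r] around [w0]. *)
Lemma Dseries_taylor1 (c : nat -> C) (z w w0 : C) (s0 r : R) :
  log_bounded c -> 1 < s0 -> s0 <= Re z -> s0 <= Re w -> s0 <= Re w0 ->
  Cmod (z - w0)%C <= r -> Cmod (w - w0)%C <= r ->
  Cmod (Dseries c z - Dseries c w + (z - w) * Dseries (fun n => clog n * c n) w0)%C <=
  Cmod (z - w)%C *
  (r * Series (fun n => Cmod (clog (S n) * (clog (S n) * c (S n)))%C * exp (- s0 * lnS n))).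
Proof.
  intros Hc H0 Hz Hw Hw0 Rz Rw. unfold Dseries.
  assert (Hlc : log_bounded (fun n => clog n * c n)%C)
    by auto using log_bounded_mult, log_bounded_clog.
  rewrite <- CSeries_minus by (apply dterm_summable; auto; lra).
  rewrite <- CSeries_scal by (apply dterm_summable; auto; lra).
  rewrite <- CSeries_plus.
  2:{ apply abs_summable_ext with (fun n => dterm c z n + (- (1)) * dterm c w n)%C;
      [intros; ring|]. apply abs_summable_plus; [|apply abs_summable_scal];
      apply dterm_summable; auto; lra. }
  2:{ apply abs_summable_scal, dterm_summable; auto; lra. }
  rewrite <- !Series_scal_l. apply Cmod_CSeries_le.
  - intros n. unfold dterm. rewrite !zeta_term_exp.
    pose proof (lnS_ge_0 n) as Hl. unfold clog at 1. change (ln (INR (S n))) with (lnS n).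
    pose proof (Cexp_taylor1 (- z * RtoC (lnS n)) (- w * RtoC (lnS n)) (- w0 * RtoC (lnS n))
      (- s0 * lnS n) (r * lnS n)) as K.
    assert (K1 : forall x : C, s0 <= Re x -> Re (- x * RtoC (lnS n))%C <= - s0 * lnS n)
      by (intros [x y] Hx; simpl in *; nra).
    assert (K2 : forall x : C, Cmod (x - w0)%C <= r ->
       Cmod (- x * RtoC (lnS n) - - w0 * RtoC (lnS n))%C <= r * lnS n).
    { intros x Hx. replace (- x * RtoC (lnS n) - - w0 * RtoC (lnS n))%C
        with (- (x - w0) * RtoC (lnS n))%C by ring.
      rewrite Cmod_mult, Cmod_opp, Cmod_R, Rabs_pos_eq by auto.
      apply Rmult_le_compat_r; auto. }
    specialize (K (K1 z Hz) (K1 w Hw) (K1 w0 Hw0) (K2 z Rz) (K2 w Rw)).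
    replace (- z * RtoC (lnS n) - - w * RtoC (lnS n))%C
      with (- (z - w) * RtoC (lnS n))%C in K by ring.
    rewrite Cmod_mult, Cmod_opp, Cmod_R, Rabs_pos_eq in K by auto.
    match goal with |- Cmod ?X <= _ =>
      replace X with (c (S n) * (Cexp (- z * RtoC (lnS n)) - Cexp (- w * RtoC (lnS n))
        - - (z - w) * RtoC (lnS n) * Cexp (- w0 * RtoC (lnS n))))%C by ring end.
    rewrite !Cmod_mult, Cmod_clog.
    apply Rle_trans with
      (Cmod (c (S n)) * (Cmod (z - w) * lnS n * (r * lnS n * exp (- s0 * lnS n)))); [|lra].
    apply Rmult_le_compat_l; auto using Cmod_ge_0.
  - do 2 apply ex_series_Rmult_l.
    apply (log_bounded_ex_series (fun n => clog n * (clog n * c n))%C);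
      auto using log_bounded_mult, log_bounded_clog.
Qed.

(** * Zeta and its derivative as Dirichlet series *)

Lemma zeta_Dseries (s : C) : zeta s = Dseries (fun _ => RtoC 1) s.
Proof.
  change (CSeries (zeta_term s) = Dseries (fun _ => RtoC 1) s).
  apply CSeries_ext. intros n. unfold dterm. ring.
Qed.

Lemma log_bounded_1 : log_bounded (fun _ => RtoC 1).
Proof. apply log_bounded_of_bounded with 1. intros n. rewrite Cmod_1. lra. Qed.

Lemma is_lim_of_Lipschitz (f : R -> R) (x l K d : R) : 0 < d ->
  (forall y, Rabs (y - x) < d -> y <> x -> Rabs (f y - l) <= Rabs (y - x) * K) ->
  is_lim f x l.
Proof.
  intros Hd H. apply is_lim_spec. intros eps.
  assert (HK : 0 < Rabs K + 1) by (pose proof (Rabs_pos K); lra).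
  assert (He : 0 < Rmin d (eps / (Rabs K + 1))).
  { apply Rmin_pos; auto. apply Rdiv_lt_0_compat; auto. apply cond_pos. }
  exists (mkposreal _ He). intros y Hy Hyx. change (Rabs (y - x) < Rmin d (eps / (Rabs K + 1))) in Hy.
  assert (H1 : Rabs (y - x) < d) by (eapply Rlt_le_trans; [apply Hy|apply Rmin_l]).
  assert (H2 : Rabs (y - x) < eps / (Rabs K + 1)) by (eapply Rlt_le_trans; [apply Hy|apply Rmin_r]).
  eapply Rle_lt_trans; [apply H; auto|].
  apply Rle_lt_trans with (Rabs (y - x) * (Rabs K + 1)).
  - apply Rmult_le_compat_l; [apply Rabs_pos|]. pose proof (Rle_abs K); lra.
  - apply Rlt_le_trans with (eps / (Rabs K + 1) * (Rabs K + 1)).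
    + apply Rmult_lt_compat_r; auto.
    + right. field. lra.
Qed.

(** [C_derive] takes the two coordinates of a difference quotient along a horizontal line. The
    Taylor estimate with centre [s] and radius [Rabs (y - Re s)] shows that the quotient converges
    at linear rate, so both real limits exist. *)
Lemma zeta'_Dseries (s : C) : 1 < Re s -> zeta' s = (- Dseries clog s)%C.
Proof.
  intros Hs. set (s0 := (1 + Re s) / 2).
  set (K := Series (fun n => Cmod (clog (S n) * (clog (S n) * 1))%C * exp (- s0 * lnS n))).
  assert (Hq : forall y, Rabs (y - Re s) < (Re s - 1) / 2 -> y <> Re s ->
    Cmod ((zeta (y, Im s) - zeta s) / ((y, Im s) - s) - - Dseries clog s)%C
      <= Rabs (y - Re s) * K).
  { intros y Hy Hne.
    assert (Es : ((y, Im s) - s)%C = RtoC (y - Re s))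
      by (destruct s; unfold RtoC, Cminus, Cplus, Copp; simpl; f_equal; ring).
    pose proof (Dseries_taylor1 (fun _ => RtoC 1) (y, Im s) s s s0 (Rabs (y - Re s))
      log_bounded_1) as T.
    apply Rabs_def2 in Hy. unfold s0 in *.
    specialize (T ltac:(lra) ltac:(simpl; lra) ltac:(lra) ltac:(lra)).
    rewrite Es, Cmod_R in T. specialize (T ltac:(lra)).
    replace (s - s)%C with (RtoC 0) in T by ring. rewrite Cmod_0 in T.
    specialize (T (Rabs_pos _)). fold K in T.
    rewrite <- !zeta_Dseries in T.
    rewrite (Dseries_ext (fun n => clog n * 1)%C clog) in T by (intros; ring).
    assert (Hp : 0 < Rabs (y - Re s)) by (apply Rabs_pos_lt; lra).
    assert (Hn : RtoC (y - Re s) <> RtoC 0) by (intros E; apply RtoC_inj in E; lra).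
    rewrite Es.
    replace ((zeta (y, Im s) - zeta s) / RtoC (y - Re s) - - Dseries clog s)%C with
      ((zeta (y, Im s) - zeta s + RtoC (y - Re s) * Dseries clog s) / RtoC (y - Re s))%C
      by (field; auto).
    rewrite Cmod_div, Cmod_R by auto.
    apply Rmult_le_reg_r with (Rabs (y - Re s)); auto. unfold Rdiv at 1.
    rewrite Rmult_assoc, Rinv_l by lra. lra. }
  unfold zeta', C_derive, C_lim.
  set (l := (- Dseries clog s)%C) in *. rewrite (surjective_pairing l). f_equal.
  - assert (L : is_lim (fun x : R => fst ((zeta (x, snd s) - zeta s) / ((x, snd s) - s))%C)
      (fst s) (Re l)).
    { apply is_lim_of_Lipschitz with K ((Re s - 1) / 2); [lra|]. intros y Hy Hne.
      eapply Rle_trans; [|apply Hq; auto].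
      eapply Rle_trans; [|apply re_le_Cmod]. right. reflexivity. }
    rewrite (is_lim_unique _ _ _ L). reflexivity.
  - assert (L : is_lim (fun x : R => snd ((zeta (x, snd s) - zeta s) / ((x, snd s) - s))%C)
      (fst s) (Im l)).
    { apply is_lim_of_Lipschitz with K ((Re s - 1) / 2); [lra|]. intros y Hy Hne.
      eapply Rle_trans; [|apply Hq; auto].
      eapply Rle_trans; [|apply im_le_Cmod]. right. reflexivity. }
    rewrite (is_lim_unique _ _ _ L). reflexivity.
Qed.

(** * The von Mangoldt function *)

Fixpoint rsum (f : nat -> R) (N : nat) : R :=
  match N with O => 0 | S k => rsum f k + f (S k) end.

Lemma rsum_ext (f g : nat -> R) (N : nat) :
  (forall n, (1 <= n <= N)%nat -> f n = g n) -> rsum f N = rsum g N.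
Proof.
  induction N as [|N IH]; intros H; simpl; auto. rewrite IH, H; auto; try lia.
  intros n Hn. apply H. lia.
Qed.

Lemma rsum_plus (f g : nat -> R) (N : nat) :
  rsum (fun n => f n + g n) N = rsum f N + rsum g N.
Proof. induction N as [|N IH]; simpl; [ring|]. rewrite IH. ring. Qed.

Lemma rsum_delta (k : nat) (x : R) (N : nat) : (1 <= k)%nat ->
  rsum (fun n => if Nat.eqb n k then x else 0) N = if Nat.leb k N then x else 0.
Proof.
  intros Hk. induction N as [|N IH].
  - simpl. destruct k; [lia|reflexivity].
  - change (rsum (fun n => if Nat.eqb n k then x else 0) N + (if Nat.eqb (S N) k then x else 0)
      = if Nat.leb k (S N) then x else 0). rewrite IH.
    destruct (Nat.eqb_spec (S N) k), (Nat.leb_spec k N), (Nat.leb_spec k (S N)); try lia; lra.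
Qed.

Module Mangoldt.
Import ssreflect ssrfun ssrbool eqtype ssrnat seq div prime.

(** Prime powers are recognised by comparing [n] with the full power of its least prime factor
    [pdiv n]. *)
Definition vonMangoldt (n : nat) : R :=
  if (1 < n)%N && (n == pdiv n ^ logn (pdiv n) n)%N then ln (INR (pdiv n)) else 0.

Lemma INR_ge_1 (p : nat) : (0 < p)%N -> 1 <= INR p.
Proof. by move=> /leP Hp; apply: (le_INR 1). Qed.

Lemma vonMangoldt_ge_0 n : 0 <= vonMangoldt n.
Proof.
rewrite /vonMangoldt; case: ifP => _; last by apply: Rle_refl.
rewrite -ln_1; apply: ln_le; [lra | exact: INR_ge_1 (pdiv_gt0 n)].
Qed.

Lemma vonMangoldt_1 : vonMangoldt 1 = 0.
Proof. by []. Qed.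

Lemma vonMangoldt_pfactor p k : prime p -> vonMangoldt (p ^ k.+1)%N = ln (INR p).
Proof.
move=> pr_p; rewrite /vonMangoldt pdiv_pfactor // pfactorK // eqxx andbT.
by rewrite -{1}(expn0 p) ltn_exp2l // prime_gt1.
Qed.

(** Multiplying [m] by a prime [p] creates exactly one new prime power divisor, [p ^ (v + 1)] with
    [v] the exponent of [p] in [m]. If [d] is not a prime power both sides vanish. *)
Lemma vonMangoldt_step p m d : prime p -> (0 < m)%N -> (0 < d)%N ->
  (if d %| (m * p)%N then vonMangoldt d else 0) =
  (if d %| m then vonMangoldt d else 0) +
  (if Nat.eqb d (p ^ (logn p m).+1)%N then ln (INR p) else 0).
Proof.
move=> pr_p m0 d0.
have eqE a b : Nat.eqb a b = (a == b) by apply/idP/eqP => [/PeanoNat.Nat.eqb_eq | /PeanoNat.Nat.eqb_eq].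
rewrite eqE.
have [pp|npp] := boolP ((1 < d)%N && (d == pdiv d ^ logn (pdiv d) d)%N); last first.
  have L0 : vonMangoldt d = 0 by rewrite /vonMangoldt (negbTE npp).
  rewrite L0; case: eqP => [E|_].
    by case/negP: npp; rewrite E pdiv_pfactor // pfactorK // eqxx andbT
      -{1}(expn0 p) ltn_exp2l // prime_gt1.
  by case: ifP => _; case: ifP => _; lra.
have [r [k [pr_r ->]]] : exists r k, prime r /\ d = (r ^ k.+1)%N.
  case/andP: pp => d1 /eqP Ed; case Ek : (logn (pdiv d) d) => [|k].
    by move: d1; rewrite Ed Ek expn0.
  by exists (pdiv d), k; rewrite -Ek; split; [apply: pdiv_prime|].
rewrite vonMangoldt_pfactor //.
have [Erp|nrp] := eqVneq r p.
  have p0 := prime_gt0 pr_p; rewrite Erp !pfactor_dvdn ?muln_gt0 ?m0 ?p0 // lognM ?m0 ?p0 //.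
  rewrite (pfactorK 1) // addn1 eqn_exp2l ?prime_gt1 // eqSS !ltnS.
  case: (ltngtP k (logn p m)) => _; lra.
have -> : (r ^ k.+1 == p ^ (logn p m).+1)%N = false.
  apply/eqP => E; move/eqP: nrp; apply.
  by rewrite -(pdiv_pfactor k pr_r) E pdiv_pfactor.
rewrite Gauss_dvdl; last first.
  by rewrite coprimeXl // prime_coprime // dvdn_prime2.
by case: ifP => _; lra.
Qed.

(** Strong induction removes the least prime factor, each removal accounting for one [ln p]. The
    range [N] may exceed [n], so that one common range can serve all [n <= N] when double sums are
    exchanged. *)
Lemma rsum_vonMangoldt n : forall N, (0 < n)%N -> (n <= N)%N ->
  rsum (fun d => if d %| n then vonMangoldt d else 0) N = ln (INR n).
Proof.
elim/ltn_ind: n => n IH N n0 nN.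
have [n1|n1] := leqP n 1.
  have -> : n = 1%N by apply/eqP; rewrite eqn_leq n1 n0.
  rewrite ln_1; elim: N {nN} => [|N IHN] //=.
  rewrite IHN dvdn1; case: eqP => [->|_]; rewrite ?vonMangoldt_1; lra.
have pr_p : prime (pdiv n) by apply: pdiv_prime.
set p := pdiv n in pr_p *.
have En : n = (n %/ p * p)%N by rewrite divnK // pdiv_dvd.
set m := (n %/ p)%N in En.
have m0 : (0 < m)%N by move: n0; rewrite En; case: (m).
have mn : (m < n)%N by rewrite [X in (_ < X)%N]En -{1}(muln1 m) ltn_pmul2l // prime_gt1.
rewrite En -(rsum_ext (fun d => (if d %| m then vonMangoldt d else 0) +
  (if Nat.eqb d (p ^ (logn p m).+1)%N then ln (INR p) else 0))); last first.
  by move=> d [/leP d0 _]; rewrite vonMangoldt_step.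
have pd : (p ^ (logn p m).+1 %| n)%N.
  by rewrite En expnSr dvdn_mul // pfactor_dvdnn.
rewrite rsum_plus IH //; last by apply: leq_trans nN; apply: ltnW.
rewrite rsum_delta; last by apply/leP; rewrite expn_gt0 prime_gt0.
have -> : Nat.leb (p ^ (logn p m).+1)%N N = true.
  by apply/PeanoNat.Nat.leb_le/leP; apply: leq_trans nN; apply: dvdn_leq.
rewrite -ln_mult; first by rewrite -mult_INR.
- by apply: lt_0_INR; apply/ltP.
- by apply: lt_0_INR; apply/ltP; apply: prime_gt0.
Qed.
End Mangoldt.

Notation vonMangoldt := Mangoldt.vonMangoldt.

Lemma vonMangoldt_divisor_sum (n N : nat) : (1 <= n <= N)%nat ->
  rsum (fun d => if Nat.eqb (Nat.modulo n d) 0 then vonMangoldt d else 0) N = ln (INR n).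
Proof.
  intros [H1 H2].
  rewrite <- (Mangoldt.rsum_vonMangoldt n N).
  - apply rsum_ext. intros d Hd.
    replace (Nat.eqb (Nat.modulo n d) 0) with (div.dvdn d n); auto.
    destruct (Nat.eqb_spec (Nat.modulo n d) 0) as [E|E].
    + apply (ssrbool.introT div.dvdnP). exists (Nat.div n d).
      rewrite (Nat.div_mod_eq n d) at 1. rewrite E. change ssrnat.muln with Nat.mul. lia.
    + destruct (div.dvdn d n) eqn:D; auto.
      destruct (ssrbool.elimT div.dvdnP D) as [k ->]. exfalso. apply E.
      apply Nat.Div0.mod_mul.
  - apply (ssrbool.introT ssrnat.ltP). lia.
  - apply (ssrbool.introT ssrnat.leP). lia.
Qed.

(** * Parity splitting and the logarithmic Euler identity *)

Fixpoint csum (f : nat -> C) (N : nat) : C :=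
  match N with O => RtoC 0 | S k => (csum f k + f (S k))%C end.

Lemma csum_ext (f g : nat -> C) (N : nat) :
  (forall n, (1 <= n <= N)%nat -> f n = g n) -> csum f N = csum g N.
Proof.
  induction N as [|N IH]; intros H; simpl; auto. rewrite IH, H; auto; try lia.
  intros n Hn. apply H. lia.
Qed.

Lemma csum_plus (f g : nat -> C) (N : nat) :
  csum (fun n => f n + g n)%C N = (csum f N + csum g N)%C.
Proof. induction N as [|N IH]; simpl; [ring|]. rewrite IH. ring. Qed.

Lemma csum_scal (c : C) (f : nat -> C) (N : nat) :
  csum (fun n => c * f n)%C N = (c * csum f N)%C.
Proof. induction N as [|N IH]; simpl; [ring|]. rewrite IH. ring. Qed.

Lemma csum_swap (f : nat -> nat -> C) (N M : nat) :
  csum (fun n => csum (fun m => f n m) M) N = csum (fun m => csum (fun n => f n m) N) M.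
Proof.
  induction N as [|N IH]; simpl.
  - induction M as [|M IHM]; simpl; [auto|]. rewrite <- IHM. ring.
  - rewrite IH, csum_plus. reflexivity.
Qed.

Lemma csum_RtoC (f : nat -> R) (N : nat) : csum (fun n => RtoC (f n)) N = RtoC (rsum f N).
Proof. induction N as [|N IH]; simpl; auto. now rewrite IH, RtoC_plus. Qed.

Lemma Cmod_csum_le (f : nat -> C) (b : nat -> R) (N : nat) :
  (forall n, (1 <= n <= N)%nat -> Cmod (f n) <= b n) -> Cmod (csum f N) <= rsum b N.
Proof.
  induction N as [|N IH]; intros H; simpl.
  - rewrite Cmod_0; lra.
  - eapply Rle_trans; [apply Cmod_triangle|]. apply Rplus_le_compat.
    + apply IH. intros n Hn. apply H. lia.
    + apply H. lia.
Qed.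

Lemma rsum_scal (c : R) (f : nat -> R) (N : nat) : rsum (fun n => c * f n) N = c * rsum f N.
Proof. induction N as [|N IH]; simpl; [ring|]. rewrite IH. ring. Qed.

Lemma rsum_sum_n (f : nat -> R) (N : nat) : rsum f (S N) = sum_n (fun n => f (S n)) N.
Proof.
  induction N as [|N IH].
  - rewrite sum_O. simpl. ring.
  - rewrite sum_Sn, <- IH. reflexivity.
Qed.

Lemma Series_rsum_tail (f : nat -> R) (N : nat) : ex_series (fun n => f (S n)) ->
  Series (fun n => f (S n)) = rsum f N + Series (fun n => f (S (N + n))).
Proof.
  intros H. destruct N as [|N]; [simpl; lra|].
  rewrite (Series_incr_n _ (S N)) by (auto; lia). simpl Init.Nat.pred.
  rewrite <- sum_n_Reals, rsum_sum_n. reflexivity.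
Qed.

Lemma ex_series_tail (f : nat -> R) (N : nat) :
  ex_series (fun n => f (S n)) -> ex_series (fun n => f (S (N + n))).
Proof. intros H. apply (ex_series_incr_n (fun n => f (S n)) N). exact H. Qed.

Lemma rsum_le_Series (f : nat -> R) (N : nat) : (forall n, 0 <= f n) ->
  ex_series (fun n => f (S n)) -> rsum f N <= Series (fun n => f (S n)).
Proof.
  intros H0 H. rewrite (Series_rsum_tail f N H).
  enough (0 <= Series (fun n => f (S (N + n)))) by lra.
  rewrite <- (Series_zero (fun _ => 0)) by auto. apply Series_le.
  - intros n. split; [lra|auto].
  - now apply ex_series_tail.
Qed.

Lemma is_lim_rsum (f : nat -> R) : ex_series (fun n => f (S n)) ->
  is_lim_seq (rsum f) (Series (fun n => f (S n))).
Proof.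
  intros H. apply is_lim_seq_incr_1.
  apply is_lim_seq_ext with (sum_n (fun n => f (S n))).
  - intros n. now rewrite rsum_sum_n.
  - exact (Series_correct _ H).
Qed.

Lemma rsum_close (f : nat -> R) (eps : R) : ex_series (fun n => f (S n)) -> 0 < eps ->
  exists N0, forall N, (N0 <= N)%nat -> Rabs (Series (fun n => f (S n)) - rsum f N) < eps.
Proof.
  intros H He. apply is_lim_rsum, is_lim_seq_spec in H. destruct (H (mkposreal _ He)) as [N0 K].
  exists N0. intros N HN. rewrite Rabs_minus_sym. exact (K N HN).
Qed.

Lemma CSeries_csum_tail (f : nat -> C) (N : nat) : abs_summable (fun n => f (S n)) ->
  (CSeries (fun n => f (S n)) - csum f N)%C = CSeries (fun n => f (S (N + n))).
Proof.
  intros H.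
  assert (E : csum f N = (rsum (fun n => Re (f n)) N, rsum (fun n => Im (f n)) N)).
  { induction N as [|N IH]; [reflexivity|]. simpl. rewrite IH. unfold Cplus; simpl. reflexivity. }
  rewrite E. unfold CSeries, Cminus, Cplus, Copp; simpl.
  rewrite (Series_rsum_tail (fun n => Re (f n)) N) by now apply (abs_summable_Re (fun n => f (S n))).
  rewrite (Series_rsum_tail (fun n => Im (f n)) N) by now apply (abs_summable_Im (fun n => f (S n))).
  f_equal; ring.
Qed.

Lemma Cmod_csum_tail_le (f : nat -> C) (N : nat) : abs_summable (fun n => f (S n)) ->
  Cmod (CSeries (fun n => f (S n)) - csum f N)%C <=
  Series (fun n => Cmod (f (S n))) - rsum (fun n => Cmod (f n)) N.
Proof.
  intros H. rewrite CSeries_csum_tail by auto.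
  rewrite (Series_rsum_tail (fun n => Cmod (f n)) N H).
  replace (_ + _ - _) with (Series (fun n => Cmod (f (S (N + n))))) by ring.
  apply Cmod_CSeries_le; [intros; lra|]. now apply (ex_series_tail (fun n => Cmod (f n))).
Qed.

Lemma csum_close (f : nat -> C) (eps : R) : abs_summable (fun n => f (S n)) -> 0 < eps ->
  exists N0, forall N, (N0 <= N)%nat ->
    Cmod (CSeries (fun n => f (S n)) - csum f N)%C < eps.
Proof.
  intros H He. destruct (rsum_close (fun n => Cmod (f n)) eps H He) as [N0 K].
  exists N0. intros N HN. eapply Rle_lt_trans; [now apply Cmod_csum_tail_le|].
  eapply Rle_lt_trans; [apply Rle_abs|]. now apply K.
Qed.

(** Absolute convergence makes each half converge on its own: its partial sums of absolute values
    are bounded by the whole series. The identity is then read off the partial sums of even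
    length. *)
Lemma Series_even_odd (a : nat -> R) : ex_series (fun n => Rabs (a n)) ->
  Series a = Series (fun m => a (2 * m)%nat) + Series (fun m => a (S (2 * m))).
Proof.
  intros H.
  assert (P : forall g : nat -> R, forall N,
    sum_n g (S (2 * N)) = sum_n (fun m => g (2 * m)%nat) N + sum_n (fun m => g (S (2 * m))) N).
  { intros g. induction N as [|N IH].
    - rewrite sum_Sn, !sum_O. reflexivity.
    - replace (S (2 * S N)) with (S (S (S (2 * N)))) by lia.
      rewrite (sum_Sn g (S (S (2 * N)))), (sum_Sn g (S (2 * N))), IH, !(sum_Sn _ N).
      replace (2 * S N)%nat with (S (S (2 * N))) by lia. unfold plus; simpl. ring. }
  assert (S0 : forall (phi : nat -> nat) N, 0 <= sum_n (fun m => Rabs (a (phi m))) N).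
  { intros phi. induction N as [|N IH]; [rewrite sum_O; apply Rabs_pos|].
    rewrite sum_Sn. unfold plus; simpl. pose proof (Rabs_pos (a (phi (S N)))). lra. }
  assert (E0 : ex_series (fun m => a (2 * m)%nat)).
  { apply ex_series_Rabs. apply (nonneg_series_bounded _ (Series (fun n => Rabs (a n)))).
    - intros; apply Rabs_pos.
    - intros N. eapply Rle_trans; [|apply (sum_n_le_Series _ (S (2 * N)) (fun n => Rabs_pos _) H)].
      rewrite P. pose proof (S0 (fun m => S (2 * m)) N). lra. }
  assert (E1 : ex_series (fun m => a (S (2 * m)))).
  { apply ex_series_Rabs. apply (nonneg_series_bounded _ (Series (fun n => Rabs (a n)))).
    - intros; apply Rabs_pos.
    - intros N. eapply Rle_trans; [|apply (sum_n_le_Series _ (S (2 * N)) (fun n => Rabs_pos _) H)].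
      rewrite P. pose proof (S0 (fun m => 2 * m)%nat N). lra. }
  pose proof (Series_correct _ (ex_series_Rabs _ H)) as L.
  pose proof (Series_correct _ E0) as L0. pose proof (Series_correct _ E1) as L1.
  assert (La : is_lim_seq (fun N => sum_n a (S (2 * N))) (Series a)).
  { apply (is_lim_seq_subseq (sum_n a)); [|exact L].
    apply eventually_subseq. intros n. lia. }
  assert (Lb : is_lim_seq (fun N => sum_n a (S (2 * N)))
      (Series (fun m => a (2 * m)%nat) + Series (fun m => a (S (2 * m))))).
  { apply is_lim_seq_ext with
      (fun N => sum_n (fun m => a (2 * m)%nat) N + sum_n (fun m => a (S (2 * m))) N).
    - intros N. now rewrite P.
    - apply is_lim_seq_plus'; assumption. }
  apply is_lim_seq_unique in La. apply is_lim_seq_unique in Lb. rewrite La in Lb. congruence.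
Qed.

Lemma CSeries_even_odd (u : nat -> C) : abs_summable u ->
  CSeries u = (CSeries (fun m => u (2 * m)%nat) + CSeries (fun m => u (S (2 * m))))%C.
Proof.
  intros H. unfold CSeries, Cplus; simpl. f_equal.
  - apply (Series_even_odd (fun n => Re (u n))). apply ex_series_bound with (fun n => Cmod (u n)); auto.
    intros n. rewrite Rabs_Rabsolu. apply re_le_Cmod.
  - apply (Series_even_odd (fun n => Im (u n))). apply ex_series_bound with (fun n => Cmod (u n)); auto.
    intros n. rewrite Rabs_Rabsolu. apply im_le_Cmod.
Qed.

Definition oddc (n : nat) : C := if Nat.odd n then RtoC 1 else RtoC 0.

Lemma oddc_even (n : nat) : oddc (2 * n) = RtoC 0.
Proof. unfold oddc. now rewrite Nat.odd_mul. Qed.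

Lemma oddc_odd (n : nat) : oddc (S (2 * n)) = RtoC 1.
Proof.
  unfold oddc. rewrite Nat.odd_succ. rewrite Nat.even_mul. reflexivity.
Qed.

Lemma oddc_mult (m n : nat) : oddc (m * n) = (oddc m * oddc n)%C.
Proof. unfold oddc. rewrite Nat.odd_mul. destruct (Nat.odd m), (Nat.odd n); simpl; ring. Qed.

Lemma Cmod_oddc_le (n : nat) : Cmod (oddc n) <= 1.
Proof. unfold oddc. destruct (Nat.odd n); rewrite ?Cmod_1, ?Cmod_0; lra. Qed.

Lemma log_bounded_oddc : log_bounded oddc.
Proof. apply log_bounded_of_bounded with 1. apply Cmod_oddc_le. Qed.

Definition two_pow_neg (s : C) : C := Cexp (- s * RtoC (ln 2))%C.

Lemma zeta_term_double (s : C) (m : nat) :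
  zeta_term s (S (2 * m)) = (two_pow_neg s * zeta_term s m)%C.
Proof.
  rewrite !zeta_term_exp. unfold two_pow_neg. rewrite <- Cexp_plus. f_equal.
  replace (lnS (S (2 * m))) with (ln 2 + lnS m).
  - rewrite RtoC_plus. ring.
  - unfold lnS. rewrite <- ln_mult by (auto using INR_S_pos; lra). f_equal.
    rewrite !S_INR, mult_INR. simpl. ring.
Qed.

(** The identities below about the prime 2 come from this splitting: when [c (2 * n)] is expressed
    through [c n], it becomes a linear equation between Dirichlet series. *)
Lemma Dseries_even_odd (c : nat -> C) (s : C) : log_bounded c -> 1 < Re s ->
  Dseries c s =
  (Dseries (fun n => oddc n * c n) s + two_pow_neg s * Dseries (fun n => c (2 * n)%nat) s)%C.
Proof.
  intros Hc Hs.
  assert (Ho : log_bounded (fun n => oddc n * c n)%C)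
    by (apply log_bounded_mult; auto using log_bounded_oddc).
  unfold Dseries at 1. rewrite CSeries_even_odd by now apply dterm_summable. f_equal.
  - unfold Dseries. rewrite (CSeries_even_odd (dterm (fun n => oddc n * c n)%C s))
      by now apply dterm_summable.
    rewrite <- (Cplus_0_r (CSeries _)) at 1. f_equal.
    + apply CSeries_ext. intros m. unfold dterm. rewrite oddc_odd. ring.
    + rewrite (CSeries_ext _ (fun _ => RtoC 0)).
      * rewrite (CSeries_RtoC (fun _ => 0)). now rewrite Series_zero.
      * intros m. unfold dterm. replace (S (S (2 * m))) with (2 * S m)%nat by lia.
        rewrite oddc_even. ring.
  - assert (E : forall m, dterm c s (S (2 * m)) =
       (two_pow_neg s * dterm (fun n => c (2 * n)%nat) s m)%C).
    { intros m. unfold dterm. rewrite zeta_term_double.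
      replace (S (S (2 * m))) with (2 * S m)%nat by lia. ring. }
    rewrite (CSeries_ext _ _ E). unfold Dseries. apply CSeries_scal.
    assert (K : abs_summable (fun m => dterm c s (S (2 * m)))).
    { pose proof (dterm_summable c s Hc Hs) as K.
      apply (nonneg_series_bounded _ (Series (fun n => Cmod (dterm c s n)))).
      - intros; apply Cmod_ge_0.
      - intros N.
        eapply Rle_trans; [|apply (sum_n_le_Series _ (S (2 * N)) (fun n => Cmod_ge_0 _) K)].
        induction N as [|N IH].
        + rewrite sum_Sn, !sum_O. unfold plus; simpl. pose proof (Cmod_ge_0 (dterm c s 0)). lra.
        + replace (S (2 * S N)) with (S (S (S (2 * N)))) by lia.
          rewrite !(sum_Sn _ N), !(sum_Sn _ (S _)).
          replace (S (2 * S N)) with (S (S (S (2 * N)))) by lia. unfold plus in *; simpl in *.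
          pose proof (Cmod_ge_0 (dterm c s (S (S (N + (N + 0)))))). lra. }
    apply abs_summable_ext with (fun m => / two_pow_neg s * dterm c s (S (2 * m)))%C.
    + intros m. rewrite E. field. apply Cexp_neq_0.
    + now apply abs_summable_scal.
Qed.

Lemma csum_multiples (a : nat -> C) (m N : nat) :
  (forall x y, a (x * y)%nat = (a x * a y)%C) -> (1 <= m)%nat ->
  csum (fun n => if Nat.eqb (Nat.modulo n m) 0 then a n else RtoC 0) N =
  (a m * csum a (N / m))%C.
Proof.
  intros Ha Hm. induction N as [|N IH].
  - rewrite Nat.Div0.div_0_l. simpl. ring.
  - simpl csum. rewrite IH.
    pose proof (Nat.div_mod_eq N m) as E. pose proof (Nat.div_mod_eq (S N) m) as E'.
    pose proof (Nat.mod_upper_bound N m ltac:(lia)). pose proof (Nat.mod_upper_bound (S N) m ltac:(lia)).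
    destruct (Nat.eqb_spec (Nat.modulo (S N) m) 0) as [Z|Z].
    + assert (D : (S N / m = S (N / m))%nat) by nia.
      rewrite D. simpl csum. replace (a (S N)) with (a m * a (S (N / m)))%C; [ring|].
      rewrite <- Ha. f_equal. rewrite <- D. lia.
    + assert (D : (S N / m = N / m)%nat) by nia. rewrite D. ring.
Qed.

(** Expand [ln n] over its divisors, exchange the sums, and write each multiple of [m] as [m d] with
    [a (m d) = a m * a d]. This stays finite, so no convergence is involved yet. *)
Lemma csum_log_multiplicative (Lam : nat -> R) (a : nat -> C) (N : nat) :
  (forall n N, (1 <= n <= N)%nat ->
    rsum (fun d => if Nat.eqb (Nat.modulo n d) 0 then Lam d else 0) N = ln (INR n)) ->
  (forall x y, a (x * y)%nat = (a x * a y)%C) ->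
  csum (fun n => clog n * a n)%C N =
  csum (fun m => RtoC (Lam m) * a m * csum a (N / m))%C N.
Proof.
  intros HL Ha.
  transitivity (csum (fun n => csum (fun m =>
    if Nat.eqb (Nat.modulo n m) 0 then RtoC (Lam m) * a n else RtoC 0)%C N) N).
  - apply csum_ext. intros n Hn. unfold clog. rewrite <- (HL n N Hn), <- csum_RtoC.
    rewrite Cmult_comm, <- csum_scal. apply csum_ext. intros m _.
    destruct (Nat.eqb _ _); ring.
  - rewrite csum_swap. apply csum_ext. intros m Hm.
    rewrite <- Cmult_assoc, <- csum_multiples by (auto; lia). rewrite <- csum_scal.
    apply csum_ext. intros n _. destruct (Nat.eqb _ _); ring.
Qed.

(** For [m <= M] the inner sum is close to its limit, with error [x]; for larger [m] only a crude
    bound [y] is available, but it is weighted by a tail of [g]. *)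
Lemma rsum_split_bound (g : nat -> R) (x y : R) (M N : nat) :
  (forall n, 0 <= g n) -> 0 <= x -> 0 <= y -> (M <= N)%nat ->
  rsum (fun m => g m * (if Nat.leb m M then x else y)) N <= x * rsum g N + y * (rsum g N - rsum g M).
Proof.
  intros Hg Hx Hy HMN. induction HMN as [|N HMN IH].
  - rewrite (rsum_ext _ (fun m => x * g m)), rsum_scal.
    + lra.
    + intros n Hn. destruct (Nat.leb_spec n M); [ring|lia].
  - change (rsum (fun m => g m * (if Nat.leb m M then x else y)) N +
      g (S N) * (if Nat.leb (S N) M then x else y) <=
      x * (rsum g N + g (S N)) + y * (rsum g N + g (S N) - rsum g M)).
    destruct (Nat.leb_spec (S N) M); [lia|]. pose proof (Hg (S N)). nra.
Qed.

(* Tannery's argument: the partial sums of [sum a(n) ln n] are regrouped as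
   [sum_m Lam(m) a(m) sum_(d <= N/m) a(d)], whose inner sums converge boundedly. *)
Lemma CSeries_log_multiplicative (Lam : nat -> R) (a : nat -> C) :
  (forall n, 0 <= Lam n) ->
  (forall n N, (1 <= n <= N)%nat ->
    rsum (fun d => if Nat.eqb (Nat.modulo n d) 0 then Lam d else 0) N = ln (INR n)) ->
  (forall x y, a (x * y)%nat = (a x * a y)%C) ->
  abs_summable (fun n => a (S n)) ->
  abs_summable (fun n => RtoC (Lam (S n)) * a (S n))%C ->
  abs_summable (fun n => clog (S n) * a (S n))%C ->
  CSeries (fun n => clog (S n) * a (S n))%C =
  (CSeries (fun n => a (S n)) * CSeries (fun n => RtoC (Lam (S n)) * a (S n)))%C.
Proof.
  intros L0 HL Ha Sa SL Sl.
  set (A := CSeries (fun n => a (S n))).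
  set (V := CSeries (fun n => RtoC (Lam (S n)) * a (S n))%C).
  set (U := CSeries (fun n => clog (S n) * a (S n))%C).
  set (g := fun n => Cmod (RtoC (Lam n) * a n)%C).
  assert (g0 : forall n, 0 <= g n) by (intros; apply Cmod_ge_0).
  set (G := Series (fun n => g (S n))).
  assert (HG : forall N, rsum g N <= G) by (intros; apply rsum_le_Series; auto).
  assert (G0 : 0 <= G) by (specialize (HG 0%nat); simpl in HG; lra).
  set (T := Series (fun n => Cmod (a (S n)))).
  assert (HT : forall N, Cmod (csum a N - A)%C <= T - rsum (fun n => Cmod (a n)) N).
  { intros N. replace (csum a N - A)%C with (- (A - csum a N))%C by ring. rewrite Cmod_opp.
    now apply (Cmod_csum_tail_le a N). }
  assert (R0 : forall N, 0 <= rsum (fun n => Cmod (a n)) N).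
  { induction N; simpl; [lra|]. pose proof (Cmod_ge_0 (a (S N))). lra. }
  assert (T0 : 0 <= T) by (specialize (HT 0%nat); simpl in HT; pose proof (Cmod_ge_0 (0 - A)); lra).
  enough (forall eps, 0 < eps -> Cmod (U - A * V)%C < eps).
  { assert (Cmod (U - A * V)%C = 0).
    { apply Rle_antisym; [|apply Cmod_ge_0]. apply Rnot_lt_le. intros Hp.
      specialize (H _ Hp). lra. }
    apply Cmod_eq_0 in H0. replace U with (U - A * V + A * V)%C by ring. rewrite H0. ring. }
  intros eps He.
  (* The error will be at most [e] for the truncation of [U], [|A| e] for that of [V], and
     [e G + T e] for the regrouped double sum. *)
  set (e := eps / (4 * (G + T + Cmod A + 1))).
  pose proof (Cmod_ge_0 A) as A0.
  assert (e0 : 0 < e) by (apply Rdiv_lt_0_compat; lra).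
  assert (eE : e * (G + T + Cmod A + 1) = eps / 4) by (unfold e; field; lra).
  destruct (csum_close (fun n => clog n * a n)%C e Sl e0) as [N1 H1].
  destruct (csum_close (fun n => RtoC (Lam n) * a n)%C e SL e0) as [N2 H2].
  destruct (rsum_close g e SL e0) as [N3 H3].
  destruct (rsum_close (fun n => Cmod (a n)) e Sa e0) as [N4 H4].
  (* The product term ensures [N / m >= N4] for every [m <= N3]. *)
  set (N := (N1 + N2 + N3 + S N3 * S N4)%nat).
  specialize (H1 N ltac:(lia)). specialize (H2 N ltac:(lia)). 
  assert (K : Cmod (csum (fun n => clog n * a n)%C N
    - A * csum (fun n => RtoC (Lam n) * a n)%C N)%C <= e * G + T * e).
  { rewrite (csum_log_multiplicative Lam a N HL Ha), <- csum_scal.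
    replace (csum (fun m => RtoC (Lam m) * a m * csum a (N / m))%C N -
      csum (fun n => A * (RtoC (Lam n) * a n))%C N)%C with
      (csum (fun m => RtoC (Lam m) * a m * csum a (N / m) + (- (1)) * (A * (RtoC (Lam m) * a m)))%C N)
      by (rewrite csum_plus, csum_scal; ring).
    eapply Rle_trans; [apply Cmod_csum_le with
      (b := fun m => g m * (if Nat.leb m N3 then e else T))|].
    - intros m Hm.
      replace (RtoC (Lam m) * a m * csum a (N / m) + - (1) * (A * (RtoC (Lam m) * a m)))%C
        with (RtoC (Lam m) * a m * (csum a (N / m) - A))%C by ring.
      rewrite Cmod_mult. apply Rmult_le_compat_l; [apply Cmod_ge_0|].
      eapply Rle_trans; [apply HT|]. destruct (Nat.leb_spec m N3) as [Hl|Hl].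
      + eapply Rle_trans; [apply Rle_abs|]. left. apply H4.
        apply Nat.div_le_lower_bound; [lia|]. unfold N. nia.
      + specialize (R0 (N / m)%nat). lra.
    - eapply Rle_trans; [apply rsum_split_bound; auto; [lra|unfold N; lia]|].
      specialize (H3 N3 ltac:(lia)). fold G in H3.
      pose proof (HG N). apply Rabs_def2 in H3.
      apply Rplus_le_compat; [apply Rmult_le_compat_l; lra|apply Rmult_le_compat_l; lra]. }
  match type of K with Cmod (?X - ?Y)%C <= _ =>
    replace (U - A * V)%C with ((U - X) + ((X - Y) + (- A) * (V - csum (fun n => RtoC (Lam n) * a n)%C N)))%C
     by ring end.
  eapply Rle_lt_trans; [apply Cmod_triangle|].
  eapply Rle_lt_trans; [apply Rplus_le_compat_l, Cmod_triangle|].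
  rewrite Cmod_mult, Cmod_opp.
  fold U in H1. fold V in H2.
  assert (Cmod A * Cmod (V - csum (fun n => RtoC (Lam n) * a n)%C N)%C <= Cmod A * e)
    by (apply Rmult_le_compat_l; lra).
  lra.
Qed.

(** * Simultaneous approximation of a character *)

Definition lsum {T : Type} (f : T -> R) (l : list T) : R :=
  fold_right (fun x acc => f x + acc) 0 l.

Lemma lsum_ext_in {T : Type} (f g : T -> R) (l : list T) :
  (forall x, In x l -> f x = g x) -> lsum f l = lsum g l.
Proof.
  induction l as [|x l IH]; intros H; simpl; auto.
  rewrite H, IH; auto using in_eq, in_cons.
Qed.

Lemma lsum_plus {T : Type} (f g : T -> R) (l : list T) :
  lsum (fun x => f x + g x) l = lsum f l + lsum g l.
Proof. induction l as [|x l IH]; simpl; [ring|]. rewrite IH. ring. Qed.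

Lemma lsum_scal {T : Type} (c : R) (f : T -> R) (l : list T) :
  lsum (fun x => c * f x) l = c * lsum f l.
Proof. induction l as [|x l IH]; simpl; [ring|]. rewrite IH. ring. Qed.

Lemma lsum_le {T : Type} (f g : T -> R) (l : list T) :
  (forall x, In x l -> f x <= g x) -> lsum f l <= lsum g l.
Proof.
  induction l as [|x l IH]; intros H; simpl; [lra|].
  apply Rplus_le_compat; auto using in_eq, in_cons.
Qed.

Lemma lsum_1 {T : Type} (l : list T) : lsum (fun _ => 1) l = INR (length l).
Proof.
  induction l as [|x l IH]; [reflexivity|]. simpl lsum. simpl length. rewrite IH, S_INR. ring.
Qed.

Lemma lsum_delta (y : nat) (l : list nat) : NoDup l ->
  lsum (fun x => if Nat.eqb x y then 1 else 0) l = if in_dec Nat.eq_dec y l then 1 else 0.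
Proof.
  induction 1 as [|x l Hx Hl IH]; simpl; auto. rewrite IH.
  destruct (Nat.eqb_spec x y) as [E|E], (Nat.eq_dec x y) as [E'|E']; try congruence.
  - subst x. destruct (in_dec Nat.eq_dec y l); [contradiction|lra].
  - destruct (in_dec Nat.eq_dec y l); lra.
Qed.

Lemma lsum_incl_le (A' A : list nat) : NoDup A' -> NoDup A -> incl A' A ->
  INR (length A') <= lsum (fun x => if in_dec Nat.eq_dec x A' then 1 else 0) A.
Proof.
  intros N' N H.
  assert (E : forall l l', NoDup l' -> lsum (fun x => if in_dec Nat.eq_dec x l' then 1 else 0) l =
     lsum (fun x => lsum (fun y => if Nat.eqb y x then 1 else 0) l') l).
  { intros l l' Hl'. apply lsum_ext_in. intros x _. now rewrite lsum_delta. }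
  assert (Sw : forall (f : nat -> nat -> R) l l',
     lsum (fun x => lsum (fun y => f x y) l') l = lsum (fun y => lsum (fun x => f x y) l) l').
  { intros f l l'. induction l as [|x l IH]; simpl.
    - induction l' as [|y l' IH']; simpl; [auto|]. rewrite <- IH'. ring.
    - rewrite IH, lsum_plus. reflexivity. }
  rewrite E, Sw by auto. rewrite <- lsum_1. right. apply lsum_ext_in. intros y Hy.
  rewrite (lsum_ext_in _ (fun x => if Nat.eqb x y then 1 else 0))
    by (intros; now rewrite Nat.eqb_sym).
  rewrite lsum_delta by auto. destruct (in_dec Nat.eq_dec y A); auto. exfalso; auto.
Qed.

(* [f] has mean value [c] over the real line, in the strong form that a
   primitive of [f] stays at bounded distance from [t |-> c t]. *)
Definition has_mean (f : R -> R) (c : R) : Prop :=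
  exists (F : R -> R) (B : R),
    (forall t, is_derive F t (f t)) /\ (forall t, Rabs (F t - c * t) <= B).

Lemma has_mean_ext (f g : R -> R) (c : R) : (forall t, f t = g t) -> has_mean f c -> has_mean g c.
Proof.
  intros H (F & B & D & HB). exists F, B. split; auto. intros t. rewrite <- H. auto.
Qed.

Lemma has_mean_plus (f g : R -> R) (c d : R) :
  has_mean f c -> has_mean g d -> has_mean (fun t => f t + g t) (c + d).
Proof.
  intros (F & B & D & HB) (G & B' & D' & HB'). exists (fun t => F t + G t), (B + B'). split.
  - intros t. apply (is_derive_plus F G t); auto.
  - intros t. replace (F t + G t - (c + d) * t) with ((F t - c * t) + (G t - d * t)) by ring.
    eapply Rle_trans; [apply Rabs_triang|]. specialize (HB t). specialize (HB' t). lra.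
Qed.

Lemma has_mean_scal (a : R) (f : R -> R) (c : R) :
  has_mean f c -> has_mean (fun t => a * f t) (a * c).
Proof.
  intros (F & B & D & HB). exists (fun t => a * F t), (Rabs a * B). split.
  - intros t. apply is_derive_scal; auto.
  - intros t. replace (a * F t - a * c * t) with (a * (F t - c * t)) by ring.
    rewrite Rabs_mult. apply Rmult_le_compat_l; auto using Rabs_pos.
Qed.

Lemma has_mean_0 : has_mean (fun _ => 0) 0.
Proof.
  exists (fun _ => 0), 0. split.
  - intros t. apply (is_derive_const (0 : R) t).
  - intros t. rewrite Rmult_0_l, Rminus_0_r, Rabs_R0. lra.
Qed.

Lemma has_mean_lsum {T : Type} (f : T -> R -> R) (c : T -> R) (l : list T) :
  (forall x, In x l -> has_mean (f x) (c x)) ->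
  has_mean (fun t => lsum (fun x => f x t) l) (lsum c l).
Proof.
  induction l as [|x l IH]; intros H; simpl; [apply has_mean_0|].
  apply has_mean_plus; auto using in_eq, in_cons.
Qed.

(** This is the orthogonality of frequencies: for [mu] nonzero the primitive [sin (t mu) / mu] is
    bounded. *)
Lemma has_mean_cos (mu : R) : has_mean (fun t => cos (t * mu)) (if Req_dec_T mu 0 then 1 else 0).
Proof.
  destruct (Req_dec_T mu 0) as [->|Hmu].
  - exists (fun t => t), 0. split.
    + intros t. rewrite Rmult_0_r, cos_0. apply (is_derive_id (t : R)).
    + intros t. replace (t - 1 * t) with 0 by ring. rewrite Rabs_R0. lra.
  - exists (fun t => sin (t * mu) / mu), (/ Rabs mu). split.
    + intros t. auto_derive; auto. field. auto.
    + intros t. rewrite Rmult_0_l, Rminus_0_r. unfold Rdiv. rewrite Rabs_mult, Rabs_inv.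
      rewrite <- (Rmult_1_l (/ Rabs mu)) at 2. apply Rmult_le_compat_r.
      * left. apply Rinv_0_lt_compat, Rabs_pos_lt; auto.
      * apply Rabs_le, SIN_bound.
Qed.

(** With a positive mean the primitive would have to rise over a long interval, which a nonpositive
    derivative forbids. The length is chosen so that [c t] exceeds the two error bounds together. *)
Lemma has_mean_nonpos (f : R -> R) (c : R) : has_mean f c -> (forall t, f t <= 0) -> c <= 0.
Proof.
  intros (F & B & D & HB) H. apply Rnot_lt_le. intros Hc.
  assert (B0 : 0 <= B) by (eapply Rle_trans; [apply Rabs_pos|apply (HB 0)]).
  set (t := (2 * B + 1) / c).
  assert (Ht : 0 < t) by (apply Rdiv_lt_0_compat; lra).
  destruct (MVT_gen F 0 t f) as (x & _ & E).
  - intros; apply D.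
  - intros x _. apply derivable_continuous_pt. exists (f x). apply is_derive_Reals, D.
  - pose proof (Rabs_le_between' (F t) (c * t) B) as [K1 _]. specialize (K1 (HB t)).
    pose proof (Rabs_le_between' (F 0) (c * 0) B) as [K2 _]. specialize (K2 (HB 0)).
    assert (c * t = 2 * B + 1) by (unfold t; field; lra).
    pose proof (H x). nra.
Qed.

Fixpoint box (N m : nat) : list nat :=
  match N with
  | O => 1%nat :: nil
  | S k => flat_map (fun e => map (Nat.mul (S k ^ e)) (box k m)) (seq 0 (S m))
  end.

Lemma in_box_S (k m x : nat) :
  In x (box (S k) m) <-> exists e y, (e <= m)%nat /\ In y (box k m) /\ x = (S k ^ e * y)%nat.
Proof.
  cbn [box]. rewrite in_flat_map. split.
  - intros (e & He & Hx). apply in_map_iff in Hx. destruct Hx as (y & E & Hy).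
    apply in_seq in He. exists e, y. repeat split; auto; lia.
  - intros (e & y & He & Hy & E). exists e. split; [apply in_seq; lia|].
    apply in_map_iff. exists y. auto.
Qed.

Lemma length_box (N m : nat) : length (box N m) = (S m ^ N)%nat.
Proof.
  induction N as [|N IH]; [reflexivity|].
  cbn [box]. rewrite (flat_map_constant_length (c := (S m ^ N)%nat)).
  - rewrite length_seq. simpl. lia.
  - intros e _. now rewrite length_map.
Qed.

Lemma box_incl (N m : nat) : incl (box N m) (box N (S m)).
Proof.
  induction N as [|N IH]; [apply incl_refl|]. intros x Hx. apply in_box_S in Hx.
  destruct Hx as (e & y & He & Hy & E). apply in_box_S. exists e, y. auto.
Qed.

Lemma box_mult (N m q x : nat) : (1 <= q <= N)%nat -> In x (box N m) -> In (q * x)%nat (box N (S m)).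
Proof.
  revert x. induction N as [|N IH]; intros x Hq Hx; [lia|].
  apply in_box_S in Hx. destruct Hx as (e & y & He & Hy & ->). apply in_box_S.
  destruct (Nat.eq_dec q (S N)) as [->|Hne].
  - exists (S e), y. repeat split; [lia|now apply box_incl|]. simpl. lia.
  - exists e, (q * y)%nat. repeat split; [lia|apply IH; auto; lia|]. lia.
Qed.

Lemma box_pos (N m x : nat) : In x (box N m) -> (1 <= x)%nat.
Proof.
  revert x. induction N as [|N IH]; intros x Hx.
  - simpl in Hx. lia.
  - apply in_box_S in Hx. destruct Hx as (e & y & He & Hy & ->). apply IH in Hy.
    pose proof (Nat.pow_nonzero (S N) e ltac:(lia)). nia.
Qed.

Lemma box_1 (N m : nat) : In 1%nat (box N m).
Proof.
  induction N as [|N IH]; [now left|]. apply in_box_S. exists 0%nat, 1%nat. repeat split; auto; lia.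
Qed.

Definition box_set (N m : nat) : list nat := nodup Nat.eq_dec (box N m).

(* Polynomial growth of [box_set N m] in [m] yields a Folner set: some step of
   the growth multiplies the cardinality by less than [1 + d]. *)
Lemma box_set_growth (N : nat) (d : R) : 0 < d ->
  exists m, INR (length (box_set N (S m))) < (1 + d) * INR (length (box_set N m)).
Proof.
  intros Hd. apply NNPP. intros Hn.
  assert (G : forall m, (1 + d) ^ m <= INR (length (box_set N m))).
  { induction m as [|m IH].
    - simpl pow. apply (le_INR 1).
      assert (In 1%nat (box_set N 0)) by (apply nodup_In, box_1).
      destruct (box_set N 0); [contradiction|simpl; lia].
    - simpl pow. apply Rle_trans with ((1 + d) * INR (length (box_set N m))).
      + apply Rmult_le_compat_l; lra.
      + apply Rnot_lt_le. intros H. apply Hn. now exists m. }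
  assert (Hup : forall m, INR (length (box_set N m)) <= (1 + INR m) ^ N).
  { intros m. rewrite Rplus_comm, <- S_INR, <- pow_INR, <- length_box. apply le_INR.
    apply NoDup_incl_length; [apply NoDup_nodup|]. intros x Hx. eapply nodup_In; eauto. }
  assert (Hl : 0 < ln (1 + d)) by (rewrite <- ln_1; apply ln_increasing; lra).
  (* Failure at every step would give growth [(1 + d) ^ m], the square of
     [exp (ln (1 + d) / 2 * m)]. The polynomial is below [K] times that exponential, so any [m] with
     [ln (1 + d) / 2 * m > K] is contradictory. *)
  destruct (pow_le_exp N (ln (1 + d) / 2) ltac:(lra)) as (K & HK & H).
  destruct (nfloor_ex (K / (ln (1 + d) / 2))) as [n Hn2].
  { apply Rlt_le, Rdiv_lt_0_compat; lra. }
  set (m := S n).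
  assert (E : (1 + d) ^ m = exp (ln (1 + d) / 2 * INR m) * exp (ln (1 + d) / 2 * INR m)).
  { rewrite <- exp_plus. replace (ln (1 + d) / 2 * INR m + ln (1 + d) / 2 * INR m)
      with (INR m * ln (1 + d)) by field.
    rewrite <- Rpower_pow by lra. reflexivity. }
  specialize (G m). specialize (Hup m). specialize (H (INR m) (pos_INR m)).
  pose proof (exp_ineq1_le (ln (1 + d) / 2 * INR m)) as P.
  assert (Q : K < ln (1 + d) / 2 * INR m).
  { unfold m. rewrite S_INR. destruct Hn2 as [_ Hn2].
    apply Rmult_lt_compat_l with (r := ln (1 + d) / 2) in Hn2; [|lra].
    replace (ln (1 + d) / 2 * (K / (ln (1 + d) / 2))) with K in Hn2 by (field; lra). lra. }
  set (X := exp (ln (1 + d) / 2 * INR m)) in *. nra.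
Qed.

Definition chi_cos (chi : nat -> R) (A : list nat) (t : R) : R :=
  lsum (fun m => chi m * cos (t * ln (INR m))) A.

Definition chi_sin (chi : nat -> R) (A : list nat) (t : R) : R :=
  lsum (fun m => chi m * sin (t * ln (INR m))) A.

(** The real part of [|F|^2 e^(i phi)], where [F] is the sum of [chi(m) m^(it)] over [A]: the double
    sum is the expansion of [F] times its conjugate. *)
Lemma double_cos_sum (chi : nat -> R) (A : list nat) (t phi : R) :
  lsum (fun m => lsum (fun n => chi m * chi n * cos (t * ln (INR m) - t * ln (INR n) + phi)) A) A
  = (chi_cos chi A t * chi_cos chi A t + chi_sin chi A t * chi_sin chi A t) * cos phi.
Proof.
  assert (E : forall m, lsum (fun n => chi m * chi n * cos (t * ln (INR m) - t * ln (INR n) + phi)) A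
    = (cos phi * chi_cos chi A t + sin phi * chi_sin chi A t) * (chi m * cos (t * ln (INR m))) +
      (cos phi * chi_sin chi A t - sin phi * chi_cos chi A t) * (chi m * sin (t * ln (INR m)))).
  { intros m. unfold chi_cos, chi_sin.
    transitivity (lsum (fun n =>
      chi m * (cos phi * cos (t * ln (INR m)) - sin phi * sin (t * ln (INR m))) * (chi n * cos (t * ln (INR n))) +
      chi m * (cos phi * sin (t * ln (INR m)) + sin phi * cos (t * ln (INR m))) * (chi n * sin (t * ln (INR n)))) A).
    - apply lsum_ext_in. intros n _. rewrite cos_plus, cos_minus, sin_minus. ring.
    - rewrite lsum_plus, !lsum_scal. ring. }
  rewrite (lsum_ext_in _ _ A (fun m _ => E m)), lsum_plus, !lsum_scal. fold (chi_cos chi A t) (chi_sin chi A t). ring.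
Qed.

(** The frequency [ln m - ln n + ln q] vanishes only for [n = m q], where the coefficient is
    [chi(m)^2 chi(q)^2 = 1]. What survives of the mean is a count. *)
Lemma double_cos_mean (chi : nat -> R) (A : list nat) (q : nat) :
  (forall m n, chi (m * n)%nat = chi m * chi n) ->
  (forall n, (1 <= n)%nat -> chi n * chi n = 1) ->
  NoDup A -> (forall n, In n A -> (1 <= n)%nat) -> (1 <= q)%nat ->
  has_mean (fun t => chi q * ((chi_cos chi A t * chi_cos chi A t + chi_sin chi A t * chi_sin chi A t) * cos (t * ln (INR q))))
    (lsum (fun m => if in_dec Nat.eq_dec (m * q)%nat A then 1 else 0) A).
Proof.
  intros chi_mult chi_sqr HA Hpos Hq.
  apply has_mean_ext with (fun t => lsum (fun m => lsum (fun n =>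
     chi m * chi n * chi q * cos (t * (ln (INR m) - ln (INR n) + ln (INR q)))) A) A).
  { intros t. rewrite <- double_cos_sum, <- lsum_scal. apply lsum_ext_in. intros m _.
    rewrite <- lsum_scal. apply lsum_ext_in. intros n _.
    replace (t * (ln (INR m) - ln (INR n) + ln (INR q)))
      with (t * ln (INR m) - t * ln (INR n) + t * ln (INR q)) by ring. ring. }
  rewrite (lsum_ext_in _ (fun m => lsum (fun n => chi m * chi n * chi q *
    (if Req_dec_T (ln (INR m) - ln (INR n) + ln (INR q)) 0 then 1 else 0)) A)).
  - apply has_mean_lsum. intros m _. apply has_mean_lsum. intros n _.
    apply has_mean_scal, has_mean_cos.
  - intros m Hm. rewrite <- lsum_delta by auto. apply lsum_ext_in. intros n Hn.
    apply Hpos in Hm. apply Hpos in Hn.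
    assert (Pm : 0 < INR m) by (apply lt_0_INR; lia).
    assert (Pn : 0 < INR n) by (apply lt_0_INR; lia).
    assert (Pq : 0 < INR q) by (apply lt_0_INR; lia).
    destruct (Req_dec_T (ln (INR m) - ln (INR n) + ln (INR q)) 0) as [E|E];
      destruct (Nat.eqb_spec n (m * q)) as [E'|E'].
    + subst n. rewrite chi_mult.
      replace (chi m * (chi m * chi q) * chi q * 1)
        with ((chi m * chi m) * (chi q * chi q)) by ring.
      rewrite !chi_sqr by auto. ring.
    + exfalso. apply E'. apply INR_eq. rewrite mult_INR. apply ln_inv; auto.
      * now apply Rmult_lt_0_compat.
      * rewrite ln_mult; auto. lra.
    + exfalso. apply E. subst n. rewrite mult_INR, ln_mult by auto. ring.
    + ring.
Qed.

(* The weight [chi_cos^2 + chi_sin^2 = |sum_(m in A) chi(m) m^(-it)|^2] concentrates where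
   [n^(-it)] is close to [chi(n)]: by unicity of frequencies its mean against
   [chi(q) cos (t ln q)] counts the [m] in [A] with [m q] in [A]. *)
Lemma Kronecker_character (chi : nat -> R) (N : nat) (eps : R) :
  (forall m n, chi (m * n)%nat = chi m * chi n) ->
  (forall n, (1 <= n)%nat -> chi n * chi n = 1) ->
  0 < eps ->
  exists t, rsum (fun q => 1 - chi q * cos (t * ln (INR q))) N < eps.
Proof.
  intros chi_mult chi_sqr He. apply NNPP. intros Hn.
  assert (HW : forall t, eps <= rsum (fun q => 1 - chi q * cos (t * ln (INR q))) N).
  { intros t. apply Rnot_lt_le. intros H. apply Hn. now exists t. }
  (* For each [q <= N], multiplication by [q] moves fewer than [d |A'|] elements of [A] out of [A].
     The [N] losses together stay below [eps |A'|], so the mean of the weighted function is positive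
     although the function is never positive. *)
  set (d := eps / (INR N + 1)). pose proof (pos_INR N) as N0.
  assert (Hd : 0 < d) by (apply Rdiv_lt_0_compat; lra).
  destruct (box_set_growth N d Hd) as [m Hm].
  set (A := box_set N (S m)) in *. set (A' := box_set N m) in *.
  assert (NA : NoDup A) by apply NoDup_nodup. assert (NA' : NoDup A') by apply NoDup_nodup.
  assert (PA : forall n, In n A -> (1 <= n)%nat).
  { intros n H. apply nodup_In in H. eapply box_pos; eauto. }
  assert (IA : incl A' A).
  { intros x H. apply nodup_In in H. apply nodup_In. now apply box_incl. }
  set (P := fun t => chi_cos chi A t * chi_cos chi A t + chi_sin chi A t * chi_sin chi A t).
  assert (M : forall k, has_mean
     (fun t => P t * (eps - rsum (fun q => 1 - chi q * cos (t * ln (INR q))) k))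
     (eps * INR (length A) - rsum (fun q => INR (length A) -
        lsum (fun m => if in_dec Nat.eq_dec (m * q)%nat A then 1 else 0) A) k)).
  { assert (M1 : has_mean P (INR (length A))).
    { pose proof (double_cos_mean chi A 1 chi_mult chi_sqr NA PA (le_n 1)) as M1.
      rewrite (lsum_ext_in _ (fun _ => 1)), lsum_1 in M1.
      - eapply has_mean_ext; [|exact M1]. intros t. change (INR 1) with 1.
        assert (H : chi 1%nat = 1).
        { pose proof (chi_mult 1%nat 1%nat) as E. rewrite (chi_sqr 1%nat (le_n 1)) in E. exact E. }
        rewrite H, ln_1, Rmult_0_r, cos_0. unfold P. ring.
      - intros x Hx. rewrite Nat.mul_1_r. destruct (in_dec Nat.eq_dec x A); auto; contradiction. }
    induction k as [|k IH].
    - simpl rsum. eapply has_mean_ext; [|rewrite Rminus_0_r; apply has_mean_scal, M1].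
      intros t. simpl. ring.
    - pose proof (double_cos_mean chi A (S k) chi_mult chi_sqr NA PA ltac:(lia)) as M2. fold (P) in M2.
      pose proof (has_mean_plus _ _ _ _ IH
        (has_mean_plus _ _ _ _ M2 (has_mean_scal (-1) _ _ M1))) as M3.
      simpl rsum.
      match type of M3 with has_mean _ ?u => match goal with |- has_mean _ ?v =>
        replace v with u by (simpl; ring) end end.
      eapply has_mean_ext; [|exact M3]. intros t. simpl. unfold P. ring. }
  specialize (M N). apply has_mean_nonpos in M.
  2:{ intros t. specialize (HW t). assert (0 <= P t) by (unfold P; nra). nra. }
  assert (K : forall k, (k <= N)%nat -> rsum (fun q => INR (length A) -
        lsum (fun m => if in_dec Nat.eq_dec (m * q)%nat A then 1 else 0) A) k
        <= INR k * (INR (length A) - INR (length A'))).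
  { induction k as [|k IH]; intros Hk; [simpl; lra|].
    change (rsum (fun q => INR (length A) -
        lsum (fun m => if in_dec Nat.eq_dec (m * q)%nat A then 1 else 0) A) k +
        (INR (length A) - lsum (fun m => if in_dec Nat.eq_dec (m * S k)%nat A then 1 else 0) A)
        <= INR (S k) * (INR (length A) - INR (length A'))).
    rewrite S_INR. specialize (IH ltac:(lia)).
    assert (INR (length A') <= lsum (fun m => if in_dec Nat.eq_dec (m * S k)%nat A then 1 else 0) A).
    { eapply Rle_trans; [apply (lsum_incl_le A' A NA' NA IA)|]. apply lsum_le. intros x Hx.
      destruct (in_dec Nat.eq_dec x A') as [i|i].
      - destruct (in_dec Nat.eq_dec (x * S k)%nat A) as [j|j]; [lra|]. exfalso. apply j.
        apply nodup_In. rewrite Nat.mul_comm. apply box_mult; [lia|]. now apply nodup_In in i.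
      - destruct (in_dec _ _ _); lra. }
    lra. }
  specialize (K N (le_n N)).
  assert (LA : INR (length A') <= INR (length A)) by (apply le_INR, NoDup_incl_length; auto).
  assert (L1 : 1 <= INR (length A')).
  { apply (le_INR 1). assert (In 1%nat A') by (apply nodup_In, box_1).
    destruct A'; [contradiction|simpl; lia]. }
  assert (D : d * (INR N + 1) = eps) by (unfold d; field; lra).
  nra.
Qed.

(** * The odd part of zeta and its twist *)

(* [chi n = (-1)^(v_2 n)] for [n >= 1], read off the trailing binary zeros of [n]; [chi 0 = 0]. *)
Fixpoint chi_pos (p : positive) : R :=
  match p with xO p => - chi_pos p | _ => 1 end.

Definition chi (n : nat) : R :=
  match N.of_nat n with N0 => 0 | Npos p => chi_pos p end.

Lemma chi_pos_mult (p q : positive) : chi_pos (p * q) = chi_pos p * chi_pos q.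
Proof.
  revert q. induction p as [p IH|p IH|]; intros q.
  - induction q as [q IHq|q IHq|].
    + simpl. ring.
    + rewrite Pos.mul_xO_r. cbn [chi_pos] in *. rewrite IHq. ring.
    + simpl. ring.
  - simpl. rewrite IH. ring.
  - simpl. ring.
Qed.

Lemma chi_mult (m n : nat) : chi (m * n) = chi m * chi n.
Proof.
  unfold chi. rewrite Nat2N.inj_mul.
  destruct (N.of_nat m) as [|p], (N.of_nat n) as [|q]; simpl; try ring. apply chi_pos_mult.
Qed.

Lemma chi_sqr (n : nat) : (1 <= n)%nat -> chi n * chi n = 1.
Proof.
  intros Hn. unfold chi. destruct n as [|n]; [lia|]. simpl.
  generalize (Pos.of_succ_nat n). induction p as [p IH|p IH|]; simpl; lra.
Qed.

Lemma chi_double (n : nat) : chi (2 * n) = - chi n.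
Proof. rewrite chi_mult. unfold chi at 1. simpl. ring. Qed.

Lemma chi_odd (n : nat) : Nat.odd n = true -> chi n = 1.
Proof.
  intros Hn. apply Nat.odd_spec in Hn. destruct Hn as [k ->]. unfold chi.
  replace (2 * k + 1)%nat with (S (2 * k)) by lia. rewrite Nat2N.inj_succ_double.
  destruct (N.of_nat k); reflexivity.
Qed.

Lemma Rabs_chi_le (n : nat) : Rabs (chi n) <= 1.
Proof.
  destruct n as [|n]; [unfold chi; simpl; rewrite Rabs_R0; lra|].
  pose proof (chi_sqr (S n) ltac:(lia)). apply Rabs_le. nra.
Qed.

Definition cchi (n : nat) : C := RtoC (chi n).

Lemma log_bounded_cchi : log_bounded cchi.
Proof.
  apply log_bounded_of_bounded with 1. intros n. unfold cchi. rewrite Cmod_R. apply Rabs_chi_le.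
Qed.

Definition cLam (n : nat) : C := RtoC (vonMangoldt n).

Lemma vonMangoldt_le_ln (n : nat) : vonMangoldt (S n) <= lnS n.
Proof.
  unfold lnS. rewrite <- (vonMangoldt_divisor_sum (S n) (S n)) by lia.
  cbn [rsum]. rewrite Nat.Div0.mod_same. cbn [Nat.eqb].
  enough (forall k, 0 <= rsum (fun d => if Nat.eqb (Nat.modulo (S n) d) 0 then vonMangoldt d else 0) k)
    by (specialize (H n); lra).
  induction k as [|k IH]; simpl rsum; [lra|].
  pose proof (Mangoldt.vonMangoldt_ge_0 (S k)).
  destruct (Nat.eqb _ _); lra.
Qed.

Lemma vonMangoldt_3 : vonMangoldt 3 = ln 3.
Proof.
  pose proof (vonMangoldt_divisor_sum 3 3 ltac:(lia)) as H. cbn in H.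
  rewrite Mangoldt.vonMangoldt_1 in H. replace (1 + 1 + 1) with 3 in H by ring. lra.
Qed.

Lemma log_bounded_cLam : log_bounded cLam.
Proof.
  exists 1, 1%nat. intros n. unfold cLam. rewrite Cmod_R, Rabs_pos_eq by apply Mangoldt.vonMangoldt_ge_0.
  pose proof (vonMangoldt_le_ln n). lra.
Qed.

#[local] Hint Resolve log_bounded_mult log_bounded_clog log_bounded_oddc log_bounded_cchi
  log_bounded_cLam log_bounded_1 : logb.

Lemma clog_double (n : nat) : clog (2 * S n) = (RtoC (ln 2) + clog (S n))%C.
Proof.
  unfold clog. rewrite mult_INR, ln_mult, RtoC_plus by (try apply INR_S_pos; simpl; lra).
  reflexivity.
Qed.

(** [Oser] is zeta without its Euler factor at 2, and [Qser] is minus the logarithmic derivative of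
    [Oser]. *)
Definition Oser (s : C) : C := Dseries oddc s.
Definition Qser (s : C) : C := Dseries (fun n => oddc n * cLam n)%C s.

Lemma zeta_odd_part (s : C) : 1 < Re s -> Oser s = (zeta s * (1 - two_pow_neg s))%C.
Proof.
  intros Hs. rewrite zeta_Dseries at 1.
  pose proof (Dseries_even_odd (fun _ => RtoC 1) s ltac:(auto with logb) Hs) as H.
  rewrite (Dseries_ext (fun n => oddc n * 1)%C oddc) in H by (intros; ring).
  fold (Oser s) in H.
  replace (Oser s) with (Oser s + two_pow_neg s * Dseries (fun _ => RtoC 1) s -
    two_pow_neg s * Dseries (fun _ => RtoC 1) s)%C by ring.
  rewrite <- H. ring.
Qed.

Lemma zeta_term_mult (s : C) (m n : nat) :
  zeta_term s (S m * S n - 1) = (zeta_term s m * zeta_term s n)%C.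
Proof.
  rewrite !zeta_term_exp, <- Cexp_plus. f_equal. unfold lnS.
  replace (S (S m * S n - 1)) with (S m * S n)%nat by lia.
  rewrite mult_INR, ln_mult, RtoC_plus by apply INR_S_pos. ring.
Qed.

Lemma odd_log_part (s : C) : 1 < Re s ->
  Dseries (fun n => oddc n * clog n)%C s = (Oser s * Qser s)%C.
Proof.
  intros Hs.
  (* The value 0 at [n = 0] makes [a] completely multiplicative on all of [nat], as the regrouping
     lemma requires. *)
  set (a := fun n => match n with O => RtoC 0 | S k => (oddc (S k) * zeta_term s k)%C end).
  assert (Ha : forall x y, a (x * y)%nat = (a x * a y)%C).
  { intros [|x] y; [simpl; ring|]. destruct y as [|y]; [rewrite Nat.mul_0_r; simpl; ring|].
    replace (a (S x * S y)%nat)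
      with (oddc (S x * S y) * zeta_term s (S x * S y - 1))%C.
    - rewrite oddc_mult, zeta_term_mult. unfold a. ring.
    - destruct (S x * S y)%nat eqn:E; [lia|]. unfold a. do 2 f_equal. lia. }
  pose proof (CSeries_log_multiplicative vonMangoldt a Mangoldt.vonMangoldt_ge_0
    vonMangoldt_divisor_sum Ha) as H.
  assert (E1 : forall n, a (S n) = dterm oddc s n) by reflexivity.
  assert (E2 : forall n, (RtoC (vonMangoldt (S n)) * a (S n))%C =
     dterm (fun n => oddc n * cLam n)%C s n) by (intros; unfold a, dterm, cLam; ring).
  assert (E3 : forall n, (clog (S n) * a (S n))%C =
     dterm (fun n => oddc n * clog n)%C s n) by (intros; unfold a, dterm; ring).
  unfold Oser, Qser, Dseries.
  rewrite <- (CSeries_ext _ _ E1), <- (CSeries_ext _ _ E2), <- (CSeries_ext _ _ E3).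
  apply H; (eapply abs_summable_ext; [intros n; symmetry; first [apply E1|apply E2|apply E3]|]);
    apply dterm_summable; auto with logb.
Qed.

(* [- zeta'/zeta = Q + ln 2 / (2^s - 1)] with denominators cleared. *)
Lemma zeta'_factor (s : C) : 1 < Re s ->
  (- zeta' s * (1 - two_pow_neg s) =
   zeta s * ((1 - two_pow_neg s) * Qser s + two_pow_neg s * RtoC (ln 2)))%C.
Proof.
  intros Hs. rewrite zeta'_Dseries by auto.
  pose proof (Dseries_even_odd clog s ltac:(auto with logb) Hs) as H.
  rewrite odd_log_part, zeta_odd_part in H by auto.
  rewrite (Dseries_ext (fun n => clog (2 * n)) (fun n => RtoC (ln 2) * 1 + clog n)%C) in H
    by (intros; rewrite clog_double; ring).
  rewrite Dseries_plus, Dseries_scal, <- zeta_Dseries in H; auto with logb.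
  2:{ apply log_bounded_of_bounded with (Cmod (RtoC (ln 2) * 1)%C). intros; lra. }
  set (D := Dseries clog s) in *. set (x := two_pow_neg s) in *.
  replace (- - D * (1 - x))%C with (D - x * D)%C by ring. rewrite H at 1. ring.
Qed.

(** Twisting by [chi] changes the Euler factor at 2 from [1 / (1 - x)] to [1 / (1 + x)], so the
    bracket is the one of [zeta'_factor] with [x] replaced by [- x]. At real [s] its vanishing is
    the equation for [E]. *)
Lemma twisted_factor (s : C) : 1 < Re s ->
  ((1 + two_pow_neg s) * (1 + two_pow_neg s) * Dseries (fun n => clog n * cchi n) s =
   Oser s * ((1 + two_pow_neg s) * Qser s - two_pow_neg s * RtoC (ln 2)))%C.
Proof.
  intros Hs.
  assert (Eo : forall n, (oddc n * cchi n)%C = oddc n).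
  { intros n. unfold oddc, cchi. destruct (Nat.odd n) eqn:E; [rewrite chi_odd by auto|]; ring. }
  pose proof (Dseries_even_odd cchi s ltac:(auto with logb) Hs) as H1.
  rewrite (Dseries_ext (fun n => oddc n * cchi n)%C oddc) in H1 by (intros; apply Eo).
  rewrite (Dseries_ext (fun n => cchi (2 * n)) (fun n => - (1) * cchi n)%C) in H1
    by (intros; unfold cchi; rewrite chi_double, RtoC_opp; ring).
  rewrite Dseries_scal in H1 by auto with logb.
  fold (Oser s) in H1.
  pose proof (Dseries_even_odd (fun n => clog n * cchi n)%C s ltac:(auto with logb) Hs) as H2.
  rewrite (Dseries_ext (fun n => oddc n * (clog n * cchi n))%C (fun n => oddc n * clog n)%C) in H2.
  2:{ intros n. rewrite <- (Eo (S n)) at 2. ring. }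
  rewrite (Dseries_ext (fun n => clog (2 * n) * cchi (2 * n))%C
    (fun n => - RtoC (ln 2) * cchi n + - (1) * (clog n * cchi n))%C) in H2.
  2:{ intros n. rewrite clog_double. unfold cchi. rewrite chi_double, RtoC_opp. ring. }
  assert (LB : forall a c, log_bounded c -> log_bounded (fun n => a * c n)%C).
  { intros a c Hc. apply (log_bounded_mult (fun _ => a) c); auto.
    apply log_bounded_of_bounded with (Cmod a). intros; lra. }
  rewrite Dseries_plus, !Dseries_scal, odd_log_part in H2; auto with logb.
  set (L := Dseries cchi s) in *. set (D := Dseries (fun n => clog n * cchi n)%C s) in *.
  set (x := two_pow_neg s) in *.
  replace ((1 + x) * (1 + x) * D)%C with ((1 + x) * (D + x * D))%C by ring. rewrite H2 at 1.
  replace (Oser s) with (L + x * L)%C by (rewrite H1 at 1; ring). ring.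
Qed.

(** * The alternating zeta series *)

Definition alt (n : nat) : C := if Nat.odd n then RtoC 1 else (- RtoC 1)%C.

Lemma log_bounded_alt : log_bounded alt.
Proof.
  apply log_bounded_of_bounded with 1. intros n. unfold alt.
  destruct (Nat.odd n); rewrite ?Cmod_opp, Cmod_1; lra.
Qed.

Lemma oddc_alt (n : nat) : (oddc n * alt n)%C = oddc n.
Proof. unfold oddc, alt. destruct (Nat.odd n); ring. Qed.

Lemma alt_double (n : nat) : alt (2 * n) = (- RtoC 1)%C.
Proof. unfold alt. now rewrite Nat.odd_mul. Qed.

Lemma eta_zeta (s : C) : 1 < Re s ->
  Dseries alt s = (zeta s * (1 - RtoC 2 * two_pow_neg s))%C.
Proof.
  intros Hs. rewrite (Dseries_even_odd alt s log_bounded_alt Hs).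
  rewrite (Dseries_ext (fun n => oddc n * alt n)%C oddc) by (intros; apply oddc_alt).
  rewrite (Dseries_ext (fun n => alt (2 * n)) (fun n => - RtoC 1 * 1)%C)
    by (intros; rewrite alt_double; ring).
  rewrite Dseries_scal, <- zeta_Dseries by auto with logb.
  fold (Oser s). rewrite zeta_odd_part by auto. change 2 with (1 + 1).
  rewrite RtoC_plus. ring.
Qed.

Lemma eta_log_zeta (s : C) : 1 < Re s ->
  (Dseries (fun n => clog n * alt n) s * (1 - two_pow_neg s) =
  zeta s * ((1 - RtoC 2 * two_pow_neg s) * ((1 - two_pow_neg s) * Qser s)
    - two_pow_neg s * RtoC (ln 2)))%C.
Proof.
  intros Hs.
  pose proof (zeta'_factor s Hs) as Hz.
  rewrite (Dseries_even_odd (fun n => clog n * alt n)%C s) by auto using log_bounded_mult, log_bounded_clog, log_bounded_alt.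
  rewrite (Dseries_ext (fun n => oddc n * (clog n * alt n))%C (fun n => oddc n * clog n)%C).
  2:{ intros n. rewrite <- (oddc_alt (S n)) at 2. ring. }
  rewrite (Dseries_ext (fun n => clog (2 * n) * alt (2 * n))%C
    (fun n => - RtoC (ln 2) * 1 + - (1) * clog n)%C).
  2:{ intros n. rewrite clog_double, alt_double. ring. }
  assert (LB : forall a c, log_bounded c -> log_bounded (fun n => a * c n)%C).
  { intros a c Hc. apply (log_bounded_mult (fun _ => a) c); auto.
    apply log_bounded_of_bounded with (Cmod a). intros; lra. }
  rewrite Dseries_plus, !Dseries_scal, odd_log_part, <- zeta_Dseries, zeta_odd_part; auto with logb.
  rewrite zeta'_Dseries in Hz by auto.
  set (D := Dseries clog s) in *. set (x := two_pow_neg s) in *.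
  replace ((zeta s * (1 - x) * Qser s + x * (- RtoC (ln 2) * zeta s + - (1) * D)) * (1 - x))%C
    with ((zeta s * (1 - x) * Qser s - x * RtoC (ln 2) * zeta s) * (1 - x)
          - x * (- - D * (1 - x)))%C by ring.
  rewrite Hz. change 2 with (1 + 1). rewrite RtoC_plus. ring.
Qed.

(** * The real equation and the zero-free half-plane *)

Lemma zeta_term_real (x : R) (n : nat) : zeta_term (RtoC x) n = RtoC (exp (- x * lnS n)).
Proof.
  rewrite zeta_term_exp, <- RtoC_opp, <- RtoC_mult. apply Cexp_RtoC.
Qed.

Definition rdirichlet (a : nat -> R) (x : R) : R :=
  Series (fun n => a (S n) * exp (- x * lnS n)).

Lemma Dseries_real (a : nat -> R) (x : R) :
  Dseries (fun n => RtoC (a n)) (RtoC x) = RtoC (rdirichlet a x).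
Proof.
  unfold rdirichlet. rewrite <- CSeries_RtoC. apply CSeries_ext. intros n. unfold dterm.
  rewrite zeta_term_real, RtoC_mult. reflexivity.
Qed.

Lemma rdirichlet_ex (a : nat -> R) (x : R) : log_bounded (fun n => RtoC (a n)) -> 1 < x ->
  ex_series (fun n => a (S n) * exp (- x * lnS n)).
Proof.
  intros Ha Hx. eapply ex_series_bound; [|apply (log_bounded_ex_series _ x Ha Hx)].
  intros n. rewrite Rabs_mult, Cmod_R, (Rabs_pos_eq (exp _)) by (left; apply exp_pos). lra.
Qed.

Definition oddLam (n : nat) : R := if Nat.odd n then vonMangoldt n else 0.

Lemma oddLam_ge_0 (n : nat) : 0 <= oddLam n.
Proof. unfold oddLam. pose proof (Mangoldt.vonMangoldt_ge_0 n). destruct (Nat.odd n); lra. Qed.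

Lemma cLam_odd (n : nat) : (oddc n * cLam n)%C = RtoC (oddLam n).
Proof. unfold oddc, cLam, oddLam. destruct (Nat.odd n); ring. Qed.

Lemma log_bounded_oddLam : log_bounded (fun n => RtoC (oddLam n)).
Proof.
  destruct (log_bounded_mult _ _ log_bounded_oddc log_bounded_cLam) as (K & j & H).
  exists K, j. intros n. rewrite <- cLam_odd. apply H.
Qed.

Definition Qr (x : R) : R := rdirichlet oddLam x.

Lemma Qser_oddLam (s : C) : Qser s = Dseries (fun n => RtoC (oddLam n)) s.
Proof. apply Dseries_ext. intros n. apply cLam_odd. Qed.

Lemma Qser_real (x : R) : Qser (RtoC x) = RtoC (Qr x).
Proof. rewrite Qser_oddLam. apply Dseries_real. Qed.

Lemma Cmod_Qser_le (s : C) : 1 < Re s -> Cmod (Qser s) <= Qr (Re s).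
Proof.
  intros Hs. rewrite Qser_oddLam. unfold Qr, rdirichlet.
  apply (Cmod_Dseries_le _ (fun n => oddLam (S n))).
  - intros n. rewrite Cmod_R, Rabs_pos_eq by apply oddLam_ge_0. lra.
  - lra.
  - apply rdirichlet_ex; auto using log_bounded_oddLam.
Qed.

Lemma zeta_real (x : R) : zeta (RtoC x) = RtoC (rdirichlet (fun _ => 1) x).
Proof. rewrite zeta_Dseries. apply Dseries_real. Qed.

Lemma rdirichlet_1_ge_1 (x : R) : 1 < x -> 1 <= rdirichlet (fun _ => 1) x.
Proof.
  intros Hx. unfold rdirichlet. rewrite Series_incr_1.
  - rewrite lnS_0, Rmult_0_r, exp_0.
    enough (0 <= Series (fun k => 1 * exp (- x * lnS (S k)))) by lra.
    rewrite <- (Series_zero (fun _ => 0)) by auto. apply Series_le.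
    + intros n. pose proof (exp_pos (- x * lnS (S n))). lra.
    + apply ex_series_Rmult_l. now apply ex_series_npow_tail.
  - apply ex_series_Rmult_l. now apply ex_series_npow.
Qed.

(** The terms after the first have total modulus at most [1 / (Re s - 1)], which is below 1 in this
    half-plane. *)
Lemma zeta_neq_0 (s : C) : 2 < Re s -> zeta s <> RtoC 0.
Proof.
  intros Hs Hz.
  destruct (ex_series_npow_tail (Re s) ltac:(lra)) as [E1 E2].
  assert (T : Cmod (zeta s - 1)%C <= / (Re s - 1)).
  { eapply Rle_trans; [|apply E2].
    change (zeta s) with (CSeries (zeta_term s)).
    pose proof (CSeries_csum_tail (fun n => zeta_term s (n - 1)) 1) as K.
    rewrite (CSeries_ext _ (zeta_term s)) in K by (intros; f_equal; lia).
    replace (csum (fun n => zeta_term s (n - 1)) 1) with (RtoC 1) in K.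
    - rewrite K.
      + apply Cmod_CSeries_le; auto. intros n. rewrite Cmod_zeta_term.
        replace (S (1 + n) - 1)%nat with (S n) by lia. lra.
      + eapply abs_summable_bound; [|apply (ex_series_npow (Re s)); lra].
        intros n. rewrite Cmod_zeta_term. replace (S n - 1)%nat with n by lia. lra.
    - simpl csum. rewrite zeta_term_exp, lnS_0.
      replace (- s * RtoC 0)%C with (RtoC 0) by ring. rewrite Cexp_0. ring. }
  rewrite Hz in T. replace (0 - 1)%C with (- RtoC 1)%C in T by ring.
  rewrite Cmod_opp, Cmod_1 in T.
  apply Rmult_le_compat_r with (r := Re s - 1) in T; [|lra]. rewrite Rinv_l in T by lra. lra.
Qed.

Definition qr (x : R) : R := exp (- x * ln 2).

Lemma ln2_pos : 0 < ln 2.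
Proof. rewrite <- ln_1. apply ln_increasing; lra. Qed.

Lemma qr_bounds (x : R) : 1 < x -> 0 < qr x < / 2.
Proof.
  intros Hx. split; [apply exp_pos|]. unfold qr.
  replace (/ 2) with (exp (- ln 2)) by (rewrite exp_Ropp, exp_ln; lra).
  apply exp_increasing. pose proof ln2_pos. nra.
Qed.

Lemma two_pow_neg_real (x : R) : two_pow_neg (RtoC x) = RtoC (qr x).
Proof. unfold two_pow_neg. rewrite <- RtoC_opp, <- RtoC_mult. apply Cexp_RtoC. Qed.

Lemma Cmod_two_pow_neg (s : C) : Cmod (two_pow_neg s) = qr (Re s).
Proof. unfold two_pow_neg, qr. rewrite Cmod_Cexp. f_equal. destruct s; simpl; ring. Qed.

Lemma E_equation_iff (x : R) : 1 < x ->
  (E_equation x <-> (1 + qr x) * Qr x = qr x * ln 2).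
Proof.
  intros Hx. unfold E_equation.
  pose proof (qr_bounds x Hx) as Hq. pose proof (rdirichlet_1_ge_1 x Hx) as HZ.
  assert (E1 : Rpower 2 (x + 1) = 2 / qr x).
  { rewrite Rpower_plus, Rpower_1 by lra. unfold qr, Rpower.
    replace (- x * ln 2) with (- (x * ln 2)) by ring. rewrite exp_Ropp. field.
    apply Rgt_not_eq, exp_pos. }
  assert (E2 : Rpower 4 x = 1 / (qr x * qr x)).
  { unfold qr, Rpower. rewrite <- exp_plus. replace 4 with (2 * 2) by ring.
    rewrite ln_mult by lra. replace (- x * ln 2 + - x * ln 2) with (- (x * (ln 2 + ln 2))) by ring.
    rewrite exp_Ropp. field. apply Rgt_not_eq, exp_pos. }
  pose proof (zeta'_factor (RtoC x) Hx) as F.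
  rewrite two_pow_neg_real, Qser_real, zeta_real in F.
  rewrite E1, E2, zeta_real. set (q := qr x) in *. set (Z := rdirichlet (fun _ => 1) x) in *.
  assert (Zn : RtoC Z <> RtoC 0) by (intros K; apply RtoC_inj in K; lra).
  assert (qn : (1 - RtoC q)%C <> RtoC 0).
  { rewrite <- RtoC_minus. intros K; apply RtoC_inj in K; lra. }
  assert (F' : (- (zeta' (RtoC x) / RtoC Z))%C = RtoC (Qr x + q * ln 2 / (1 - q))).
  { replace (- (zeta' (RtoC x) / RtoC Z))%C
      with (- zeta' (RtoC x) * (1 - RtoC q) / (RtoC Z * (1 - RtoC q)))%C by (field; auto).
    rewrite F, RtoC_plus, RtoC_div, RtoC_mult, RtoC_minus by lra.
    field. auto. }
  rewrite F'.
  (* Partial fractions in [q]: the first summand is the contribution of the prime 2 to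
     [- zeta'/zeta], and it cancels. *)
  assert (K : 2 / q / (1 / (q * q) - 1) * ln 2 = q * ln 2 / (1 - q) + q * ln 2 / (1 + q)).
  { field. repeat split; try lra. nra. }
  split; intros H.
  - apply RtoC_inj in H. rewrite K in H.
    assert (Qr x = q * ln 2 / (1 + q)) by lra. rewrite H0. field. lra.
  - f_equal. rewrite K. assert (Qr x = q * ln 2 / (1 + q)); [|lra].
    rewrite <- H. field. lra.
Qed.

(* The factor [2^x + 1] leaves every term of [Q] nonincreasing, as [ln m >= ln 2]. *)
Definition Hr (x : R) : R := (exp (x * ln 2) + 1) * Qr x.

Lemma qr_Hr (x : R) : (1 + qr x) * Qr x = qr x * Hr x.
Proof.
  unfold Hr, qr. replace (- x * ln 2) with (- (x * ln 2)) by ring. rewrite exp_Ropp. field.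
  apply Rgt_not_eq, exp_pos.
Qed.

(** The product [2^x exp (- x l) = exp (x (ln 2 - l))] is nonincreasing once [l >= ln 2], so only
    the decrease of the summand [exp (- x l)] is kept. *)
Lemma Hr_term_decreasing (x y l : R) : x <= y -> ln 2 <= l ->
  exp (- x * l) - exp (- y * l) <=
  (exp (x * ln 2) + 1) * exp (- x * l) - (exp (y * ln 2) + 1) * exp (- y * l).
Proof.
  intros Hxy Hl. rewrite !Rmult_plus_distr_r, <- !exp_plus.
  enough (exp (y * ln 2 + - y * l) <= exp (x * ln 2 + - x * l)) by lra.
  apply exp_le_compat. nra.
Qed.

(** All terms decrease, and the one at [m = 3] alone supplies an explicit rate. Beyond monotonicity,
    this rate is what makes the zero of the twisted series simple. *)
Lemma Hr_decreasing (x y : R) : 1 < x -> x <= y ->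
  ln 3 * (exp (- x * ln 3) - exp (- y * ln 3)) <= Hr x - Hr y.
Proof.
  intros Hx Hxy. unfold Hr, Qr, rdirichlet. rewrite <- !Series_scal_l.
  assert (Ex : forall z, 1 < z -> ex_series (fun n => (exp (z * ln 2) + 1) * (oddLam (S n) * exp (- z * lnS n)))).
  { intros z Hz. apply ex_series_Rmult_l, rdirichlet_ex; auto using log_bounded_oddLam. }
  rewrite <- Series_minus by (apply Ex; lra).
  set (d := fun n => (exp (x * ln 2) + 1) * (oddLam (S n) * exp (- x * lnS n)) -
                     (exp (y * ln 2) + 1) * (oddLam (S n) * exp (- y * lnS n))).
  assert (d_eq : forall n, d n = oddLam (S n) * ((exp (x * ln 2) + 1) * exp (- x * lnS n) -
         (exp (y * ln 2) + 1) * exp (- y * lnS n))) by (intros; unfold d; ring).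
  assert (l2 : forall n, ln 2 <= lnS (S n)).
  { intros n. unfold lnS. apply ln_le; [lra|]. rewrite !S_INR. pose proof (pos_INR n). lra. }
  assert (d0 : forall n, 0 <= d n).
  { intros n. rewrite d_eq. destruct n as [|n].
    (* The integer 1 has logarithm below [ln 2] and escapes the monotonicity lemma, but its
       coefficient vanishes. *)
    - replace (oddLam 1) with 0 by (unfold oddLam; simpl; now rewrite Mangoldt.vonMangoldt_1). lra.
    - apply Rmult_le_pos; [apply oddLam_ge_0|].
      eapply Rle_trans; [|apply Hr_term_decreasing; auto].
      enough (exp (- y * lnS (S n)) <= exp (- x * lnS (S n))) by lra.
      apply exp_le_compat. pose proof (lnS_ge_0 (S n)). nra. }
  assert (Ed : ex_series d).
  { apply (ex_series_minus (V := R_NormedModule)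
      (fun n => (exp (x * ln 2) + 1) * (oddLam (S n) * exp (- x * lnS n)))
      (fun n => (exp (y * ln 2) + 1) * (oddLam (S n) * exp (- y * lnS n)))); apply Ex; lra. }
  (* Index 2 is the integer 3. *)
  eapply Rle_trans; [|apply (sum_n_le_Series d 2 d0 Ed)].
  rewrite !sum_Sn, sum_O. unfold plus; simpl.
  apply Rle_trans with (d 2%nat); [|pose proof (d0 0%nat); pose proof (d0 1%nat); lra].
  rewrite d_eq. replace (oddLam 3) with (ln 3) by (unfold oddLam; simpl; now rewrite vonMangoldt_3).
  assert (E3 : lnS 2 = ln 3) by (unfold lnS; f_equal; simpl; ring). 
  pose proof (l2 1%nat) as L3. rewrite E3 in *.
  apply Rmult_le_compat_l.
  - pose proof ln2_pos. lra.
  - now apply Hr_term_decreasing.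
Qed.

Lemma ln3_pos : 0 < ln 3.
Proof. rewrite <- ln_1. apply ln_increasing; lra. Qed.

Lemma Hr_strictly_decreasing (x y : R) : 1 < x -> x < y -> Hr y < Hr x.
Proof.
  intros Hx Hxy. pose proof (Hr_decreasing x y Hx ltac:(lra)).
  assert (exp (- y * ln 3) < exp (- x * ln 3)).
  { apply exp_increasing. pose proof ln3_pos. nra. }
  pose proof ln3_pos. nra.
Qed.

Lemma zeta'_neq_0 (E : R) (s : C) : 2 < E -> Hr E = ln 2 -> E < Re s -> zeta' s <> RtoC 0.
Proof.
  intros HE HH Hs Hz. pose proof (zeta'_factor s ltac:(lra)) as F. rewrite Hz in F.
  pose proof (zeta_neq_0 s ltac:(lra)) as Zn.
  assert (K : ((1 - two_pow_neg s) * Qser s = - two_pow_neg s * RtoC (ln 2))%C).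
  { replace (- two_pow_neg s * RtoC (ln 2))%C with
      ((1 - two_pow_neg s) * Qser s - ((zeta s * ((1 - two_pow_neg s) * Qser s
         + two_pow_neg s * RtoC (ln 2))) / zeta s))%C by (field; auto).
    rewrite <- F. field. auto. }
  apply (f_equal Cmod) in K. rewrite !Cmod_mult, Cmod_opp, Cmod_R, Cmod_two_pow_neg in K.
  rewrite Rabs_pos_eq in K by (left; apply ln2_pos).
  pose proof (Cmod_Qser_le s ltac:(lra)) as B.
  assert (T : Cmod (1 - two_pow_neg s)%C <= 1 + qr (Re s)).
  { unfold Cminus. eapply Rle_trans; [apply Cmod_triangle|].
    rewrite Cmod_1, Cmod_opp, Cmod_two_pow_neg. lra. }
  pose proof (qr_Hr (Re s)) as HQ. pose proof (Hr_strictly_decreasing E (Re s) ltac:(lra) Hs) as D.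
  pose proof (qr_bounds (Re s) ltac:(lra)) as [q0 _].
  pose proof (Cmod_ge_0 (Qser s)). pose proof (Cmod_ge_0 (1 - two_pow_neg s)%C).
  assert (qr (Re s) * ln 2 <= (1 + qr (Re s)) * Qr (Re s)).
  { rewrite <- K. apply Rmult_le_compat; auto. }
  rewrite HQ in H1. nra.
Qed.

(** * A zero by contraction *)

Lemma Newton_zero (f : C -> C) (z0 : C) (d r : R) : 0 < d -> 0 < r ->
  (forall z w, Cmod (z - z0)%C <= r -> Cmod (w - z0)%C <= r ->
     Cmod (f z - f w + (z - w) * RtoC d)%C <= d / 2 * Cmod (z - w)%C) ->
  Cmod (f z0) <= r * d / 2 ->
  exists z, Cmod (z - z0)%C <= r /\ f z = RtoC 0.
Proof.
  intros Hd Hr Hf H0.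
  assert (dn : RtoC d <> RtoC 0) by (intros K; apply RtoC_inj in K; lra).
  (* Newton's map with the derivative frozen at [- d]. By hypothesis it contracts by 1/2, and the
     first step is at most [r / 2], so the iterates never leave the disc. *)
  set (Phi := fun z => (z + f z / RtoC d)%C).
  assert (Step : forall z, Cmod (Phi z - z)%C = Cmod (f z) / d).
  { intros z. unfold Phi. replace (z + f z / RtoC d - z)%C with (f z / RtoC d)%C by ring.
    rewrite Cmod_div, Cmod_R, Rabs_pos_eq by (auto; lra). reflexivity. }
  assert (Contr : forall z w, Cmod (z - z0)%C <= r -> Cmod (w - z0)%C <= r ->
     Cmod (Phi z - Phi w)%C <= / 2 * Cmod (z - w)%C).
  { intros z w Hz Hw. unfold Phi.
    replace (z + f z / RtoC d - (w + f w / RtoC d))%C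
      with ((f z - f w + (z - w) * RtoC d) / RtoC d)%C by (field; auto).
    rewrite Cmod_div, Cmod_R, (Rabs_pos_eq d) by (auto; lra).
    apply Rmult_le_reg_r with d; auto. unfold Rdiv. rewrite Rmult_assoc, Rinv_l, Rmult_1_r by lra.
    specialize (Hf z w Hz Hw). lra. }
  set (zs := fun k => Nat.iter k Phi z0).
  assert (Inv : forall k, Cmod (zs k - z0)%C <= r * (1 - (/ 2) ^ k) /\
     Cmod (zs (S k) - zs k)%C <= r * (/ 2) ^ S k).
  { assert (P : forall k, 0 < (/ 2) ^ k) by (intros; apply pow_lt; lra).
    induction k as [|k [I1 I2]].
    - split.
      + simpl. replace (z0 - z0)%C with (RtoC 0) by ring. rewrite Cmod_0. lra.
      + change (Cmod (Phi z0 - z0)%C <= r * (/ 2) ^ 1). rewrite Step. simpl.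
        apply Rmult_le_reg_r with d; auto. unfold Rdiv. rewrite Rmult_assoc, Rinv_l by lra. lra.
    - assert (I3 : Cmod (zs (S k) - z0)%C <= r * (1 - (/ 2) ^ S k)).
      { replace (zs (S k) - z0)%C with ((zs (S k) - zs k) + (zs k - z0))%C by ring.
        eapply Rle_trans; [apply Cmod_triangle|]. simpl in *. lra. }
      split; auto.
      change (zs (S (S k))) with (Phi (zs (S k))). change (zs (S k)) with (Phi (zs k)) at 2.
      eapply Rle_trans; [apply Contr|].
      + eapply Rle_trans; [apply I3|]. pose proof (P (S k)). nra.
      + eapply Rle_trans; [apply I1|]. pose proof (P k). nra.
      + simpl in *. lra. }
  (* The limit of the iterates is built as [z0] plus the absolutely convergent series of increments;
     its tails bound the distance to the limit. *)
  set (u := fun n => (zs n - zs (n - 1)%nat)%C).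
  assert (Su : ex_series (fun n => r / 2 * (/ 2) ^ n)).
  { apply ex_series_Rmult_l, ex_series_geom. rewrite Rabs_pos_eq; lra. }
  assert (ub : forall n, Cmod (u (S n)) <= r / 2 * (/ 2) ^ n).
  { intros n. unfold u. replace (S n - 1)%nat with n by lia.
    destruct (Inv n) as [_ I]. simpl in I. simpl. lra. }
  pose proof (abs_summable_bound _ _ ub Su) as Sb.
  set (z := (z0 + CSeries (fun n => u (S n)))%C).
  assert (tele : forall k, csum u k = (zs k - z0)%C).
  { induction k as [|k IH]; simpl csum.
    - simpl. ring.
    - rewrite IH. unfold u. replace (S k - 1)%nat with k by lia. ring. }
  assert (tail : forall k, Cmod (z - zs k)%C <= r * (/ 2) ^ k).
  { intros k. replace (z - zs k)%C with (CSeries (fun n => u (S n)) - csum u k)%C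
      by (rewrite tele; unfold z; ring).
    rewrite CSeries_csum_tail by auto.
    eapply Rle_trans.
    - apply Cmod_CSeries_le with (b := fun n => r / 2 * (/ 2) ^ k * (/ 2) ^ n).
      + intros n. eapply Rle_trans; [apply ub|]. rewrite pow_add. lra.
      + apply ex_series_Rmult_l, ex_series_geom. rewrite Rabs_pos_eq; lra.
    - rewrite Series_scal_l, Series_geom by (rewrite Rabs_pos_eq; lra). 
      right. field. }
  assert (Hz : Cmod (z - z0)%C <= r).
  { specialize (tail 0%nat). simpl in tail. rewrite Rmult_1_r in tail. exact tail. }
  exists z. split; auto. apply Cmod_eq_0. apply Rle_antisym; [|apply Cmod_ge_0].
  assert (Bk : forall k, Cmod (f z) <= 3 * d * r * (/ 2) ^ k).
  { intros k. destruct (Inv k) as [I1 I2].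
    assert (P : 0 < (/ 2) ^ k) by (apply pow_lt; lra).
    assert (Fk : Cmod (f (zs k)) <= d * (r * (/ 2) ^ S k)).
    { change (zs (S k)) with (Phi (zs k)) in I2. rewrite Step in I2.
      apply Rmult_le_compat_r with (r := d) in I2; [|lra].
      unfold Rdiv in I2. rewrite Rmult_assoc, Rinv_l in I2 by lra. lra. }
    specialize (Hf z (zs k) Hz ltac:(nra)). specialize (tail k).
    replace (f z) with ((f z - f (zs k) + (z - zs k) * RtoC d) + (f (zs k) + - (RtoC d * (z - zs k))))%C by ring.
    eapply Rle_trans; [apply Cmod_triangle|].
    eapply Rle_trans; [apply Rplus_le_compat_l, Cmod_triangle|].
    rewrite Cmod_opp, Cmod_mult, Cmod_R, (Rabs_pos_eq d) by lra.
    simpl in Fk. pose proof (Cmod_ge_0 (z - zs k)). nra. }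
  apply (is_lim_seq_le (fun _ => Cmod (f z)) (fun k => 3 * d * r * (/ 2) ^ k) (Cmod (f z)) 0 Bk).
  - apply is_lim_seq_const.
  - replace (Finite 0) with (Rbar_mult (3 * d * r) 0) by (simpl; f_equal; ring).
    apply is_lim_seq_scal_l, is_lim_seq_geom. rewrite Rabs_pos_eq; lra.
Qed.

(** * Zeros of the derivative near the critical abscissa *)

Definition twist (t : R) (n : nat) : C := Cexp (0, - t * ln (INR n)).

Lemma Cmod_twist (t : R) (n : nat) : Cmod (twist t n) = 1.
Proof. unfold twist. rewrite Cmod_Cexp. apply exp_0. Qed.

Lemma Dseries_shift (c : nat -> C) (z : C) (t : R) :
  Dseries c (z + (0, t))%C = Dseries (fun n => c n * twist t n)%C z.
Proof.
  apply CSeries_ext. intros n. unfold dterm, twist. rewrite !zeta_term_exp.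
  rewrite <- Cmult_assoc, <- Cexp_plus. do 2 f_equal. destruct z as [a b].
  unfold Cmult, Cplus, Copp, RtoC, lnS; simpl. f_equal; ring.
Qed.

(** Squared chord between two points of the unit circle. It turns the real-part estimate of
    [Kronecker_character] into an estimate of moduli. *)
Lemma twist_chi_dist (t : R) (n : nat) : (1 <= n)%nat ->
  Cmod (twist t n - cchi n)%C ^ 2 = 2 * (1 - chi n * cos (t * ln (INR n))).
Proof.
  intros Hn. rewrite Cmod2_alt. unfold twist, Cexp, cchi, RtoC; simpl.
  replace (- t * ln (INR n)) with (- (t * ln (INR n))) by ring.
  rewrite exp_0, cos_neg, sin_neg. pose proof (chi_sqr n Hn).
  pose proof (sin2_cos2 (t * ln (INR n))) as P. unfold Rsqr in P. nra.
Qed.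

(** The single weight [(1 + ln n)^2 n^(-2)] dominates, on [Re s >= 2], both the error between the
    translated and twisted logarithmic series and the Lipschitz constant of that error. *)
Lemma twist_approximates_chi (eta : R) : 0 < eta ->
  exists t, Series (fun n => ((1 + lnS n) ^ 2 * Cmod (twist t (S n) - cchi (S n))%C)
                              * exp (- (2) * lnS n)) <= eta.
Proof.
  intros He.
  set (w := fun n => (1 + ln (INR n)) ^ 2 * exp (- (2) * ln (INR n))).
  assert (Ew : ex_series (fun n => w (S n))) by exact (ex_series_log_npow 2 2 ltac:(lra)).
  assert (w0 : forall n, 0 <= w n).
  { intros n. apply Rmult_le_pos; [apply pow2_ge_0|left; apply exp_pos]. }
  set (B := Series (fun n => w (S n))).
  assert (B0 : 0 <= B) by exact (rsum_le_Series w 0 w0 Ew).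
  destruct (rsum_close w (eta / 4) Ew ltac:(lra)) as [N HN]. specialize (HN N (le_n N)).
  set (d := eta / (2 * (B + 1))). assert (d0 : 0 < d) by (apply Rdiv_lt_0_compat; lra).
  (* The squared distance is twice the deficit, so a total deficit below [d ^ 2 / 2] brings each of
     the first [N] twists within [d]. Beyond [N] the trivial distance 2 is used. *)
  destruct (Kronecker_character chi N (d ^ 2 / 2) chi_mult chi_sqr) as [t Ht].
  { assert (0 < d ^ 2) by (apply pow_lt; auto). lra. }
  exists t.
  assert (pos : forall q, (1 <= q)%nat -> 0 <= 1 - chi q * cos (t * ln (INR q))).
  { intros q Hq. pose proof (twist_chi_dist t q Hq). pose proof (pow2_ge_0 (Cmod (twist t q - cchi q)%C)).
    lra. }
  assert (small : forall q, (1 <= q <= N)%nat -> Cmod (twist t q - cchi q)%C <= d).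
  { assert (S0 : forall k, 0 <= rsum (fun q => 1 - chi q * cos (t * ln (INR q))) k).
    { induction k as [|k IH]; simpl rsum; [lra|]. pose proof (pos (S k) ltac:(lia)). simpl in *. lra. }
    assert (S1 : forall k q, (1 <= q <= k)%nat -> 1 - chi q * cos (t * ln (INR q)) <=
       rsum (fun q => 1 - chi q * cos (t * ln (INR q))) k).
    { induction k as [|k IH]; intros q Hq; [lia|].
      change (1 - chi q * cos (t * ln (INR q)) <= rsum (fun q => 1 - chi q * cos (t * ln (INR q))) k
        + (1 - chi (S k) * cos (t * ln (INR (S k))))).
      destruct (Nat.eq_dec q (S k)) as [->|Hne].
      - pose proof (S0 k). lra.
      - pose proof (IH q ltac:(lia)). pose proof (pos (S k) ltac:(lia)). lra. }
    intros q Hq. pose proof (S1 N q Hq). pose proof (twist_chi_dist t q ltac:(lia)) as P.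
    pose proof (Cmod_ge_0 (twist t q - cchi q)%C). nra. }
  assert (two : forall n, Cmod (twist t n - cchi n)%C <= 2).
  { intros n. unfold Cminus. eapply Rle_trans; [apply Cmod_triangle|].
    rewrite Cmod_opp, Cmod_twist. unfold cchi. rewrite Cmod_R. pose proof (Rabs_chi_le n). lra. }
  set (f := fun n => w n * Cmod (twist t n - cchi n)%C).
  assert (Ef : ex_series (fun n => f (S n))).
  { apply ex_series_bound with (fun n => 2 * w (S n)).
    - intros n. unfold f. rewrite Rabs_pos_eq by (apply Rmult_le_pos; auto using Cmod_ge_0).
      pose proof (two (S n)). pose proof (w0 (S n)). nra.
    - now apply ex_series_Rmult_l. }
  rewrite (Series_ext _ (fun n => f (S n))) by (intros n; unfold f, w, lnS; ring).
  rewrite (Series_rsum_tail f N Ef).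
  assert (T1 : rsum f N <= d * B).
  { eapply Rle_trans; [|apply Rmult_le_compat_l; [lra|exact (rsum_le_Series w N w0 Ew)]].
    rewrite <- rsum_scal. 
    assert (K : forall k, (k <= N)%nat -> rsum f k <= rsum (fun n => d * w n) k).
    { induction k as [|k IH]; intros Hk; simpl rsum; [lra|]. apply Rplus_le_compat; [apply IH; lia|].
      unfold f. pose proof (small (S k) ltac:(lia)). pose proof (w0 (S k)). nra. }
    now apply K. }
  assert (T2 : Series (fun n => f (S (N + n))) <= 2 * (eta / 4)).
  { apply Rle_trans with (Series (fun n => 2 * w (S (N + n)))).
    - apply Series_le.
      + intros n. unfold f. split; [apply Rmult_le_pos; auto using Cmod_ge_0|].
        pose proof (two (S (N + n))). pose proof (w0 (S (N + n))). nra.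
      + now apply ex_series_Rmult_l, (ex_series_tail w).
    - rewrite Series_scal_l. apply Rmult_le_compat_l; [lra|].
      rewrite (Series_rsum_tail w N Ew) in HN.
      replace (_ + _ - _) with (Series (fun n => w (S (N + n)))) in HN by ring.
      apply Rabs_def2 in HN. lra. }
  assert (d * B <= eta / 2).
  { apply Rle_trans with (d * (B + 1)); [nra|]. right. unfold d. field. lra. }
  lra.
Qed.

Definition chi_log2 (n : nat) : C := (clog n * (clog n * cchi n))%C.

Lemma twisted_log_real (x : R) :
  Dseries (fun n => clog n * cchi n)%C (RtoC x) = RtoC (rdirichlet (fun n => ln (INR n) * chi n) x).
Proof.
  rewrite <- Dseries_real. apply Dseries_ext. intros n. unfold clog, cchi. now rewrite RtoC_mult.
Qed.

Lemma twisted_log_Hr (x : R) : 1 < x ->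
  (1 + qr x) * (1 + qr x) * rdirichlet (fun n => ln (INR n) * chi n) x =
  rdirichlet (fun _ => 1) x * (1 - qr x) * (qr x * (Hr x - ln 2)).
Proof.
  intros Hx. apply RtoC_inj.
  pose proof (twisted_factor (RtoC x) Hx) as T.
  rewrite zeta_odd_part, zeta_real, twisted_log_real, two_pow_neg_real, Qser_real in T by auto.
  replace (qr x * (Hr x - ln 2)) with ((1 + qr x) * Qr x - qr x * ln 2) by (rewrite qr_Hr; ring).
  rewrite !RtoC_mult, !RtoC_minus, !RtoC_mult, !RtoC_plus. exact T.
Qed.

(* So the zero of [sum chi(n) ln n n^(-s)] at [E] is simple. *)
Lemma twisted_derivative_pos (E : R) : 2 < E <= 3 -> Hr E = ln 2 ->
  exists d, 0 < d /\ Dseries chi_log2 (RtoC E) = RtoC d.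
Proof.
  intros HE HH.
  set (d := rdirichlet (fun n => ln (INR n) * (ln (INR n) * chi n)) E).
  assert (Ed : Dseries chi_log2 (RtoC E) = RtoC d).
  { unfold d. rewrite <- Dseries_real. apply Dseries_ext. intros n. unfold chi_log2, clog, cchi.
    now rewrite !RtoC_mult. }
  exists d. split; auto.
  set (l := rdirichlet (fun n => ln (INR n) * chi n)).
  assert (lE : l E = 0).
  { pose proof (twisted_log_Hr E ltac:(lra)) as T. rewrite HH in T. fold (l E) in T.
    pose proof (qr_bounds E ltac:(lra)).
    assert (0 < (1 + qr E) * (1 + qr E)) by nra.
    apply Rmult_eq_reg_l with ((1 + qr E) * (1 + qr E)); [|lra]. rewrite T. ring. }
  pose proof ln3_pos as L3.
  (* A lower bound for the downward slope: one [ln 3] is the coefficient at 3, the other comes from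
     the increment of [3^(-x)]. The abscissa 4 bounds [E + h] from above, and the 8 combines
     [zeta (1 - q) >= 1/2] with [(1 + q)^2 <= 4]. *)
  set (c := ln 3 * ln 3 * exp (- 4 * ln 3) * exp (- 4 * ln 2) / 8).
  assert (c0 : 0 < c).
  { unfold c. pose proof (exp_pos (- 4 * ln 3)). pose proof (exp_pos (- 4 * ln 2)).
    apply Rdiv_lt_0_compat; [|lra]. repeat apply Rmult_lt_0_compat; auto. }
  assert (slope : forall h, 0 < h <= 1 -> l (E + h) <= - c * h).
  { intros h Hh. set (x := E + h).
    pose proof (twisted_log_Hr x ltac:(unfold x; lra)) as T. fold (l x) in T.
    pose proof (qr_bounds x ltac:(unfold x; lra)) as Q.
    pose proof (rdirichlet_1_ge_1 x ltac:(unfold x; lra)) as Z1.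
    pose proof (Hr_decreasing E x ltac:(lra) ltac:(unfold x; lra)) as D. rewrite HH in D.
    assert (D2 : exp (- 4 * ln 3) * (ln 3 * h) <= exp (- E * ln 3) - exp (- x * ln 3)).
    { replace (- E * ln 3) with (- x * ln 3 + ln 3 * h) by (unfold x; ring).
      rewrite exp_plus. pose proof (exp_ineq1_le (ln 3 * h)).
      assert (exp (- 4 * ln 3) <= exp (- x * ln 3)) by (apply exp_le_compat; unfold x; nra).
      pose proof (exp_pos (- 4 * ln 3)). assert (0 < ln 3 * h) by nra. nra. }
    assert (D3 : ln 3 * (exp (- 4 * ln 3) * (ln 3 * h)) <= ln 2 - Hr x).
    { eapply Rle_trans; [|apply D]. apply Rmult_le_compat_l; lra. }
    assert (q4 : exp (- 4 * ln 2) <= qr x).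
    { apply exp_le_compat. pose proof ln2_pos. unfold x. nra. }
    set (e := ln 3 * (exp (- 4 * ln 3) * (ln 3 * h))) in *.
    assert (e0 : 0 < e).
    { unfold e. pose proof (exp_pos (- 4 * ln 3)). repeat apply Rmult_lt_0_compat; lra. }
    replace (- c * h) with (- (exp (- 4 * ln 2) * e / 8)) by (unfold c, e; field).
    set (p := exp (- 4 * ln 2)) in *. assert (p0 : 0 < p) by apply exp_pos.
    set (q := qr x) in *. set (Z := rdirichlet (fun _ => 1) x) in *. set (y := l x) in *.
    assert (G1 : p * e <= q * (ln 2 - Hr x)) by (apply Rmult_le_compat; lra).
    assert (G2 : / 2 * (p * e) <= (Z * (1 - q)) * (q * (ln 2 - Hr x))).
    { apply Rmult_le_compat; try nra. }
    assert (G3 : (1 + q) * (1 + q) * y <= - (/ 2 * (p * e))) by nra.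
    assert (pe : 0 < p * e) by nra.
    assert (k4 : 0 < (1 + q) * (1 + q) <= 4) by nra.
    apply Rnot_lt_le. intros Hy. set (k := (1 + q) * (1 + q)) in *.
    destruct (Rle_lt_dec 0 y); nra. }
  assert (H4 : log_bounded (fun n => clog n * cchi n)%C)
    by auto using log_bounded_mult, log_bounded_clog, log_bounded_cchi.
  set (K := Series (fun n => Cmod (clog (S n) * (clog (S n) * (clog (S n) * cchi (S n))))%C * exp (- (2) * lnS n))).
  assert (tay : forall h, 0 < h <= 1 -> Rabs (l (E + h) + h * d) <= h * (h * K)).
  { intros h Hh.
    pose proof (Dseries_taylor1 (fun n => clog n * cchi n)%C (RtoC (E + h)) (RtoC E) (RtoC E) 2 h H4
      ltac:(lra) ltac:(simpl; lra) ltac:(simpl; lra) ltac:(simpl; lra)) as T.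
    cbv beta in T. fold K in T. change (fun n => clog n * (clog n * cchi n))%C with chi_log2 in T.
    rewrite Ed, !twisted_log_real in T. fold (l (E + h)) (l E) in T. rewrite lE in T.
    rewrite <- !RtoC_minus, <- RtoC_mult, <- RtoC_plus, !Cmod_R in T.
    replace (E + h - E) with h in T by ring. replace (E - E) with 0 in T by ring.
    rewrite Rabs_R0, (Rabs_pos_eq h) in T by lra.
    replace (l (E + h) - 0 + h * d) with (l (E + h) + h * d) in T by ring.
    apply T; lra. }
  assert (key : forall h, 0 < h <= 1 -> c <= d + h * K).
  { intros h Hh. pose proof (slope h Hh). pose proof (tay h Hh) as T. apply Rabs_le_between in T.
    apply Rmult_le_reg_l with h; [lra|]. lra. }
  apply Rnot_le_lt. intros Hd.
  pose proof (key 1 ltac:(lra)) as K1.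
  assert (K0 : c <= K) by lra.
  (* If [d <= 0], taking [h = 1] gives [c <= K], so this [h] is admissible; there the quadratic
     error is only [c / 2], which contradicts [key]. *)
  pose proof (key (c / (2 * K)) ) as K2.
  assert (R1 : 0 < c / (2 * K) <= 1).
  { split; [apply Rdiv_lt_0_compat; lra|].
    apply Rmult_le_reg_r with (2 * K); [lra|]. unfold Rdiv. rewrite Rmult_assoc, Rinv_l by lra. lra. }
  specialize (K2 R1). replace (c / (2 * K) * K) with (c / 2) in K2 by (field; lra). lra.
Qed.

Lemma zeta'_zero_near (E : R) (eps : R) : 5 / 2 < E <= 3 -> Hr E = ln 2 -> 0 < eps ->
  exists s, 1 < Re s /\ zeta' s = RtoC 0 /\ Rabs (Re s - E) <= eps.
Proof.
  intros HE HH He.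
  destruct (twisted_derivative_pos E ltac:(lra) HH) as (d & d0 & Ed).
  assert (H4 : log_bounded (fun n => clog n * cchi n)%C)
    by auto using log_bounded_mult, log_bounded_clog, log_bounded_cchi.
  set (K := Series (fun n => Cmod (clog (S n) * (clog (S n) * (clog (S n) * cchi (S n))))%C * exp (- (2) * lnS n))).
  assert (K0 : 0 <= K).
  { unfold K. rewrite <- (Series_zero (fun _ => 0)) by auto. apply Series_le.
    - intros n. split; [lra|]. apply Rmult_le_pos; [apply Cmod_ge_0|left; apply exp_pos].
    - apply (log_bounded_ex_series (fun n => clog n * (clog n * (clog n * cchi n)))%C 2); [|lra].
      auto using log_bounded_mult, log_bounded_clog, log_bounded_cchi. }
  (* The three bounds place the zero within [eps], keep the disc in [Re s >= 2] since [E > 5/2], and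
     limit the variation of the derivative of the twisted series to [d / 4]. *)
  set (r := Rmin (Rmin eps (/ 2)) (d / (4 * (K + 1)))).
  assert (r0 : 0 < r).
  { unfold r. apply Rmin_pos; [apply Rmin_pos; lra|apply Rdiv_lt_0_compat; lra]. }
  assert (r1 : r <= eps) by (unfold r; eapply Rle_trans; [apply Rmin_l|apply Rmin_l]).
  assert (r2 : r <= / 2) by (unfold r; eapply Rle_trans; [apply Rmin_l|apply Rmin_r]).
  assert (r3 : r * K <= d / 4).
  { apply Rle_trans with (d / (4 * (K + 1)) * (K + 1)).
    - apply Rmult_le_compat; try lra. apply Rmin_r.
    - right. field. lra. }
  (* The same tolerance bounds the initial value, where [r d / 2] is allowed, and, since [r <= 1/2],
     the Lipschitz constant of the error, where [d / 4] is allowed. *)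
  destruct (twist_approximates_chi (r * d / 4)) as [t Ht].
  { apply Rdiv_lt_0_compat; [|lra]. now apply Rmult_lt_0_compat. }
  set (g := fun n => (clog n * (twist t n - cchi n))%C).
  assert (LBt : log_bounded (fun n => twist t n - cchi n)%C).
  { apply log_bounded_of_bounded with 2. intros n. unfold Cminus.
    eapply Rle_trans; [apply Cmod_triangle|].
    rewrite Cmod_opp, Cmod_twist. unfold cchi. rewrite Cmod_R. pose proof (Rabs_chi_le n). lra. }
  assert (Hg : log_bounded g) by (apply log_bounded_mult; auto using log_bounded_clog).
  assert (wex : ex_series (fun n => ((1 + lnS n) ^ 2 * Cmod (twist t (S n) - cchi (S n))%C)
                              * exp (- (2) * lnS n))).
  { destruct LBt as (K' & j & HK). 
    apply ex_series_bound with (fun n => K' * ((1 + lnS n) ^ (2 + j) * exp (- (2) * lnS n))).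
    - intros n. pose proof (lnS_ge_0 n).
      assert (0 <= (1 + lnS n) ^ 2) by apply pow2_ge_0.
      pose proof (Cmod_ge_0 (twist t (S n) - cchi (S n))%C). pose proof (exp_pos (- (2) * lnS n)).
      rewrite Rabs_pos_eq by (apply Rmult_le_pos; [apply Rmult_le_pos; auto|lra]).
      rewrite pow_add. specialize (HK n).
      replace (K' * ((1 + lnS n) ^ 2 * (1 + lnS n) ^ j * exp (- (2) * lnS n)))
        with ((1 + lnS n) ^ 2 * (K' * (1 + lnS n) ^ j) * exp (- (2) * lnS n)) by ring.
      apply Rmult_le_compat_r; [lra|]. apply Rmult_le_compat_l; auto.
    - apply ex_series_Rmult_l. exact (ex_series_log_npow (2 + j) 2 ltac:(lra)). }
  (* This is [- zeta'] translated by [t] along the imaginary axis. Below it is split into the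
     twisted series and the error with coefficients [g]. *)
  set (f := fun z => Dseries clog (z + (0, t))%C).
  assert (fE : forall z, 2 <= Re z ->
    f z = (Dseries (fun n => clog n * cchi n) z + Dseries g z)%C).
  { intros z Hz. unfold f. rewrite Dseries_shift, <- Dseries_plus by (auto; lra).
    apply Dseries_ext. intros n. unfold g. ring. }
  assert (ball : forall z, Cmod (z - RtoC E)%C <= r -> 2 <= Re z).
  { intros z Hz. pose proof (re_le_Cmod (z - RtoC E)%C) as P.
    assert (P2 : Rabs (Re (z - RtoC E)%C) <= / 2) by lra. apply Rabs_le_between in P2.
    destruct z; simpl in *. lra. }
  destruct (Newton_zero f (RtoC E) d r d0 r0) as (z & Hz & fz).
  - intros z w Hz Hw.
    pose proof (ball z Hz) as Bz. pose proof (ball w Hw) as Bw.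
    rewrite !fE by auto.
    pose proof (Dseries_taylor1 (fun n => clog n * cchi n)%C z w (RtoC E) 2 r H4
      ltac:(lra) Bz Bw ltac:(simpl; lra) Hz Hw) as T.
    cbv beta in T. fold K in T. change (fun n => clog n * (clog n * cchi n))%C with chi_log2 in T. rewrite Ed in T.
    pose proof (Dseries_lipschitz g z w 2 Hg ltac:(lra) Bz Bw) as L.
    assert (L2 : Series (fun n => Cmod (clog (S n) * g (S n))%C * exp (- (2) * lnS n)) <= d / 4).
    { apply Rle_trans with (r * d / 4); [|nra].
      eapply Rle_trans; [|apply Ht]. apply Series_le; auto.
      intros n. split; [apply Rmult_le_pos; [apply Cmod_ge_0|left; apply exp_pos]|].
      apply Rmult_le_compat_r; [left; apply exp_pos|].
      unfold g. rewrite !Cmod_mult, Cmod_clog. pose proof (lnS_ge_0 n).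
      pose proof (Cmod_ge_0 (twist t (S n) - cchi (S n))%C).
      rewrite <- Rmult_assoc. apply Rmult_le_compat_r; auto. nra. }
    replace (Dseries (fun n => clog n * cchi n) z + Dseries g z
      - (Dseries (fun n => clog n * cchi n) w + Dseries g w) + (z - w) * RtoC d)%C with
      ((Dseries (fun n => clog n * cchi n) z - Dseries (fun n => clog n * cchi n) w + (z - w) * RtoC d)
       + (Dseries g z - Dseries g w))%C by ring.
    eapply Rle_trans; [apply Cmod_triangle|].
    pose proof (Cmod_ge_0 (z - w)%C).
    assert (Cmod (z - w)%C * (r * K) <= Cmod (z - w)%C * (d / 4)) by (apply Rmult_le_compat_l; auto).
    assert (Cmod (z - w)%C * Series (fun n => Cmod (clog (S n) * g (S n))%C * exp (- (2) * lnS n))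
       <= Cmod (z - w)%C * (d / 4)) by (apply Rmult_le_compat_l; auto).
    lra.
  - rewrite fE by (simpl; lra).
    assert (Z0 : Dseries (fun n => clog n * cchi n)%C (RtoC E) = RtoC 0).
    { rewrite twisted_log_real. f_equal.
      pose proof (twisted_log_Hr E ltac:(lra)) as T. rewrite HH in T.
      pose proof (qr_bounds E ltac:(lra)).
      assert (0 < (1 + qr E) * (1 + qr E)) by nra.
      apply Rmult_eq_reg_l with ((1 + qr E) * (1 + qr E)); [|lra]. rewrite T. ring. }
    rewrite Z0, Cplus_0_l.
    apply Rle_trans with (r * d / 4); [|nra].
    eapply Rle_trans; [|apply Ht].
    apply (Cmod_Dseries_le g); auto.
    + intros n. unfold g. rewrite Cmod_mult, Cmod_clog. pose proof (lnS_ge_0 n).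
      apply Rmult_le_compat_r; [apply Cmod_ge_0|]. nra.
    + simpl. lra.
  - exists (z + (0, t))%C.
    assert (Rz : Re (z + (0, t))%C = Re z) by (destruct z; simpl; ring).
    pose proof (ball z Hz). rewrite Rz. repeat split; [lra| |].
    + rewrite zeta'_Dseries by (rewrite Rz; lra). fold (f z). rewrite fz. ring.
    + apply Rle_trans with r; auto. eapply Rle_trans; [|apply Hz].
      eapply Rle_trans; [|apply re_le_Cmod]. right. destruct z; reflexivity.
Qed.

(** * Locating the root of the real equation *)

Lemma Qr_continuous (x : R) : 1 < x -> continuity_pt Qr x.
Proof.
  intros Hx. apply continuity_pt_filterlim'.
  set (s0 := (1 + x) / 2).
  apply (is_lim_of_Lipschitz Qr x (Qr x)
    (Series (fun n => Cmod (clog (S n) * RtoC (oddLam (S n)))%C * exp (- s0 * lnS n))) ((x - 1) / 2));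
    [lra|].
  intros y Hy _. apply Rabs_def2 in Hy.
  pose proof (Dseries_lipschitz (fun n => RtoC (oddLam n)) (RtoC y) (RtoC x) s0
    log_bounded_oddLam) as L.
  rewrite !Dseries_real, <- !RtoC_minus, !Cmod_R in L. unfold s0 in *.
  apply L; simpl; lra.
Qed.

Lemma Hr_continuous (x : R) : 1 < x -> continuity_pt Hr x.
Proof.
  intros Hx. apply (continuity_pt_mult (fun x => exp (x * ln 2) + 1) Qr); [|now apply Qr_continuous].
  apply derivable_continuous_pt. exists (ln 2 * exp (x * ln 2)). apply is_derive_Reals.
  auto_derive; auto. ring.
Qed.

(* Obtained by writing [zeta] and [zeta'] through the alternating series
   [sum (-1)^(n-1) n^(-x) = (1 - 2q) zeta(x)] and clearing denominators. *)
Definition eta_test (x : R) : R :=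
  rdirichlet (fun n => ln (INR n) * (if Nat.odd n then 1 else -1)) x
    * ((1 - 2 * qr x) * (1 - qr x * qr x))
  + 2 * (qr x * qr x) * (2 - qr x) * ln 2 * rdirichlet (fun n => if Nat.odd n then 1 else -1) x.

(** The sum over prime powers hidden in [Hr] is traded for alternating series, which Euler's
    transformation evaluates. The multiplier [Z (1 - 2q)^2 (1 - q) q] is positive because [q < 1/2],
    so signs agree. *)
Lemma eta_test_Hr (x : R) : 1 < x ->
  exists k, 0 < k /\ eta_test x = k * (Hr x - ln 2).
Proof.
  intros Hx.
  pose proof (eta_zeta (RtoC x) Hx) as H1. pose proof (eta_log_zeta (RtoC x) Hx) as H2.
  rewrite (Dseries_ext alt (fun n => RtoC (if Nat.odd n then 1 else -1))) in H1.
  2:{ intros n. unfold alt. destruct (Nat.odd (S n)); auto. now rewrite <- RtoC_opp. }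
  rewrite (Dseries_ext (fun n => clog n * alt n)%C
    (fun n => RtoC (ln (INR n) * (if Nat.odd n then 1 else -1)))) in H2.
  2:{ intros n. unfold clog, alt. rewrite RtoC_mult.
      destruct (Nat.odd (S n)); auto. now rewrite <- RtoC_opp. }
  rewrite Dseries_real, zeta_real, two_pow_neg_real in H1.
  rewrite Dseries_real, zeta_real, two_pow_neg_real, Qser_real in H2.
  unfold eta_test.
  set (e := rdirichlet (fun n => if Nat.odd n then 1 else -1) x) in *.
  set (e1 := rdirichlet (fun n => ln (INR n) * (if Nat.odd n then 1 else -1)) x) in *.
  pose proof (rdirichlet_1_ge_1 x Hx) as HZ. set (Z := rdirichlet (fun _ => 1) x) in *.
  pose proof (qr_bounds x Hx) as Hq. pose proof (qr_Hr x) as HQ. set (q := qr x) in *.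
  assert (H1' : e = Z * (1 - 2 * q)).
  { apply RtoC_inj. rewrite H1, RtoC_mult, RtoC_minus, RtoC_mult. reflexivity. }
  assert (H2' : e1 * (1 - q) = Z * ((1 - 2 * q) * ((1 - q) * Qr x) - q * ln 2)).
  { apply RtoC_inj. rewrite !RtoC_mult, !RtoC_minus, !RtoC_mult, !RtoC_minus, !RtoC_mult. exact H2. }
  exists (Z * (1 - 2 * q) * (1 - 2 * q) * (1 - q) * q). split.
  { repeat apply Rmult_lt_0_compat; lra. }
  transitivity ((e1 * (1 - q)) * ((1 - 2 * q) * (1 + q)) + 2 * (q * q) * (2 - q) * ln 2 * e); [ring|].
  rewrite H1', H2'.
  replace (Z * (1 - 2 * q) * (1 - 2 * q) * (1 - q) * q * (Hr x - ln 2)) with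
    (Z * (1 - 2 * q) * (1 - 2 * q) * (1 - q) * (q * Hr x - q * ln 2)) by ring.
  rewrite <- HQ. ring.
Qed.

Lemma Hr_root_between (a b : R) : 5 / 2 < a -> a < b -> b <= 3 ->
  0 < eta_test a -> eta_test b < 0 ->
  exists E : R, a <= E < b /\ Hr E = ln 2.
Proof.
  intros Ha Hab Hb Ta Tb.
  destruct (eta_test_Hr a ltac:(lra)) as (k & Hk & Ea).
  destruct (eta_test_Hr b ltac:(lra)) as (k' & Hk' & Eb).
  assert (Ha' : 0 < Hr a - ln 2) by nra. assert (Hb' : Hr b - ln 2 < 0) by nra.
  destruct (IVT_interv (fun x => ln 2 - Hr x) a b) as (E & HE & Z); try lra.
  - intros x Hx. apply (continuity_pt_minus (fun _ => ln 2) Hr).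
    + apply continuity_pt_const. intros ? ?; reflexivity.
    + apply Hr_continuous. lra.
  (* The strict sign at [b] excludes the right end. *)
  - exists E. split; [|lra]. split; [lra|]. destruct (Req_dec E b) as [->|]; lra.
Qed.

(** * Ball arithmetic *)

(** About 51 decimals; the excess over the 45 wanted absorbs the accumulated rounding radii. *)
Definition prec : Z := 172.
(* [(m, e)] stands for the reals within [e / 2^prec] of [m / 2^prec]. *)
Definition zball : Set := (Z * Z)%type.

Definition bint (n : Z) : zball := (Z.shiftl n prec, 0%Z).
Definition badd (x y : zball) : zball := (fst x + fst y, snd x + snd y)%Z.
Definition bsub (x y : zball) : zball := (fst x - fst y, snd x + snd y)%Z.
(** The added 2 pays for the two floors, one in the midpoint and one in the radius; the same holds
    in [bdivz]. *)
Definition bmul (x y : zball) : zball :=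
  (Z.shiftr (fst x * fst y) prec,
   Z.shiftr (Z.abs (fst x) * snd y + Z.abs (fst y) * snd x + snd x * snd y) prec + 2)%Z.
Definition bdivz (x : zball) (k : Z) : zball := (fst x / k, snd x / k + 2)%Z.

(** Tail of the series of [ln ((1 + 1/k) / (1 - 1/k))]: [t] encloses [2 k^(-j)], with [j] odd. On
    stopping, the whole remaining tail is enclosed in a ball around 0 of twice the size of [t]. *)
Fixpoint batanh (fuel : nat) (k j : Z) (t : zball) : zball :=
  match fuel with
  | O => (0, 2 * (Z.abs (fst t) + snd t))%Z
  | S f => if (fst t =? 0)%Z then (0, 2 * (Z.abs (fst t) + snd t))%Z
           else badd (bdivz t j) (batanh f k (j + 2)%Z (bdivz t (k * k)))
  end.

(** For [k = 2n - 1] this encloses [ln (n / (n - 1))]. *)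
Definition bln_ratio (k : Z) : zball := batanh 70 k 1 (bdivz (bint 2) k).

Fixpoint bexp_horner (n : nat) (k : Z) (y : zball) : zball :=
  match n with
  | O => bint 0
  | S n => badd (bint 1) (bdivz (bmul y (bexp_horner n (k + 1)%Z y)) (k + 1))
  end.

(** The argument is divided by [512 = 2 ^ 9] and the result squared nine times. For [y] in
    [[-32, 0]] the 24 Taylor terms leave at most [(1/16)^24 / 24!], less than one unit. *)
Definition bexp (y : zball) : zball :=
  let p := bexp_horner 24 0 (bdivz y 512) in
  Nat.iter 9 (fun z => bmul z z) (badd p (0, 1)%Z).

(** Position [n - 1] of the table holds enclosures of [ln n] and [n^(-x)]. A composite entry is
    obtained from two earlier ones, so exponentials are computed for primes only: up to 165 every
    composite number has a factor among 2, 3, 5, 7, 11. *)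
Definition bentry (nsigma : zball) (acc : list (zball * zball)) (n : nat) : zball * zball :=
  match find (fun d => andb (Nat.eqb (Nat.modulo n d) 0) (Nat.ltb d n)) (2 :: 3 :: 5 :: 7 :: 11 :: nil)%nat with
  | Some d =>
      let a := nth (d - 1) acc (bint 0, bint 0) in
      let b := nth (n / d - 1) acc (bint 0, bint 0) in
      (badd (fst a) (fst b), bmul (snd a) (snd b))
  | None =>
      let l := badd (fst (nth (n - 2) acc (bint 0, bint 0))) (bln_ratio (2 * Z.of_nat n - 1)%Z) in
      (l, bexp (bmul nsigma l))
  end.

Fixpoint btable (nsigma : zball) (n : nat) : list (zball * zball) :=
  match n with
  | O => (bint 0, bint 1) :: nil
  | S n => let t := btable nsigma n in (t ++ bentry nsigma t (S (S n)) :: nil)%list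
  end.

Fixpoint bdiffs (l : list zball) : list zball :=
  match l with
  | x :: (y :: _) as t => bsub y x :: bdiffs t
  | _ => nil
  end.

Fixpoint beuler (n : nat) (l : list zball) : zball :=
  match n, l with
  | S n, x :: _ => bdivz (bsub x (beuler n (bdiffs l))) 2
  | _, _ => (0, 0)%Z
  end.

Fixpoint balternating (M n : nat) (l : list zball) : zball :=
  match M, l with
  | S M, x :: t => bsub x (balternating M n t)
  | _, _ => badd (beuler n l) (0, 1)%Z
  end.

(* With 100 terms summed directly and 65 entering Euler's transformation, the
   truncation error is below one unit [2^(-prec)]. *)
Definition btest (nsigma : zball) : zball :=
  let t := btable nsigma 164 in
  let e0 := balternating 100 65 (map snd t) in
  let e1 := balternating 100 65 (map (fun p => bmul (fst p) (snd p)) t) in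
  let two := nth 1 t (bint 0, bint 0) in
  let q := snd two in
  badd (bmul e1 (bmul (bsub (bint 1) (badd q q)) (bsub (bint 1) (bmul q q))))
       (bmul (bmul (bmul (badd (bmul q q) (bmul q q)) (bsub (bint 2) q)) (fst two)) e0).

Definition sigma_ball (a : Z) : zball := bdivz (bint a) (10 ^ 45)%Z.

Definition scale : R := IZR (2 ^ prec).

Lemma scale_pos : 0 < scale.
Proof. apply IZR_lt. reflexivity. Qed.

Definition contains (x : R) (b : zball) : Prop :=
  Rabs (x * scale - IZR (fst b)) <= IZR (snd b).

Lemma contains_eq (x y : R) (b : zball) : x = y -> contains x b -> contains y b.
Proof. now intros ->. Qed.

Lemma contains_radius_ge_0 (x : R) (b : zball) : contains x b -> 0 <= IZR (snd b).
Proof. intros H. eapply Rle_trans; [apply Rabs_pos|exact H]. Qed.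

Lemma bint_contains (n : Z) : contains (IZR n) (bint n).
Proof.
  unfold contains, bint. cbn [fst snd]. rewrite Z.shiftl_mul_pow2 by (unfold prec; lia).
  rewrite mult_IZR. fold scale. rewrite Rminus_diag, Rabs_R0. lra.
Qed.

Lemma badd_contains (x y : R) (a b : zball) :
  contains x a -> contains y b -> contains (x + y) (badd a b).
Proof.
  unfold contains, badd. cbn [fst snd]. intros Ha Hb. rewrite !plus_IZR.
  replace ((x + y) * scale - (IZR (fst a) + IZR (fst b)))
    with ((x * scale - IZR (fst a)) + (y * scale - IZR (fst b))) by ring.
  eapply Rle_trans; [apply Rabs_triang|lra].
Qed.

Lemma bsub_contains (x y : R) (a b : zball) :
  contains x a -> contains y b -> contains (x - y) (bsub a b).
Proof.
  unfold contains, bsub. cbn [fst snd]. intros Ha Hb. rewrite minus_IZR, plus_IZR.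
  replace ((x - y) * scale - (IZR (fst a) - IZR (fst b)))
    with ((x * scale - IZR (fst a)) - (y * scale - IZR (fst b))) by ring.
  eapply Rle_trans; [apply Rabs_triang|]. rewrite Rabs_Ropp. lra.
Qed.

Lemma contains_widen (x y : R) (b : zball) (e : Z) :
  contains x b -> Rabs (y - x) * scale <= IZR e -> contains y (badd b (0, e)%Z).
Proof.
  intros H He. apply (contains_eq (x + (y - x))); [ring|]. apply badd_contains; auto.
  unfold contains. cbn [fst snd]. rewrite Rminus_0_r, Rabs_mult, (Rabs_pos_eq scale); auto.
  left; apply scale_pos.
Qed.

Lemma Zdiv_bounds (a k : Z) : (0 < k)%Z ->
  IZR (a / k) <= IZR a / IZR k < IZR (a / k) + 1.
Proof.
  intros Hk. pose proof (IZR_lt _ _ Hk) as Hk'.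
  pose proof (Z.div_mod a k ltac:(lia)) as E. pose proof (Z.mod_pos_bound a k Hk) as [B1 B2].
  apply (f_equal IZR) in E. rewrite plus_IZR, mult_IZR in E.
  apply IZR_le in B1. apply IZR_lt in B2.
  split.
  - apply Rmult_le_reg_r with (IZR k); auto. unfold Rdiv. rewrite Rmult_assoc, Rinv_l by lra. lra.
  - apply Rmult_lt_reg_r with (IZR k); auto. unfold Rdiv. rewrite Rmult_assoc, Rinv_l by lra. lra.
Qed.

Lemma bdivz_contains (x : R) (b : zball) (k : Z) :
  (0 < k)%Z -> contains x b -> contains (x / IZR k) (bdivz b k).
Proof.
  intros Hk H. unfold contains, bdivz in *. cbn [fst snd].
  pose proof (IZR_lt _ _ Hk) as Hk'. rewrite plus_IZR.
  pose proof (Zdiv_bounds (fst b) k Hk). pose proof (Zdiv_bounds (snd b) k Hk).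
  assert (K : Rabs (x / IZR k * scale - IZR (fst b) / IZR k) <= IZR (snd b) / IZR k).
  { replace (x / IZR k * scale - IZR (fst b) / IZR k)
      with ((x * scale - IZR (fst b)) / IZR k) by (field; lra).
    unfold Rdiv. rewrite Rabs_mult, (Rabs_pos_eq (/ IZR k)) by (left; now apply Rinv_0_lt_compat).
    apply Rmult_le_compat_r; auto. left; now apply Rinv_0_lt_compat. }
  apply Rabs_le_between in K. apply Rabs_le_between. lra.
Qed.

Lemma bmul_contains (x y : R) (a b : zball) :
  contains x a -> contains y b -> contains (x * y) (bmul a b).
Proof.
  intros Ha Hb. pose proof (contains_radius_ge_0 _ _ Ha) as Ra.
  pose proof (contains_radius_ge_0 _ _ Hb) as Rb.
  unfold contains, bmul in *. cbn [fst snd].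
  rewrite !Z.shiftr_div_pow2 by (unfold prec; lia). rewrite plus_IZR.
  pose proof scale_pos as Sp.
  pose proof (Zdiv_bounds (fst a * fst b) (2 ^ prec) ltac:(reflexivity)) as H1.
  pose proof (Zdiv_bounds (Z.abs (fst a) * snd b + Z.abs (fst b) * snd a + snd a * snd b)
    (2 ^ prec) ltac:(reflexivity)) as H2.
  fold scale in H1, H2. rewrite mult_IZR in H1. rewrite !plus_IZR, !mult_IZR, !abs_IZR in H2.
  set (m := IZR (fst a)) in *. set (n := IZR (fst b)) in *.
  set (d := IZR (snd a)) in *. set (e := IZR (snd b)) in *.
  assert (K : Rabs (x * y * scale - m * n / scale) <= (Rabs m * e + Rabs n * d + d * e) / scale).
  { replace (x * y * scale - m * n / scale)
      with ((m * (y * scale - n) + n * (x * scale - m) + (x * scale - m) * (y * scale - n)) / scale)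
      by (field; lra).
    unfold Rdiv. rewrite Rabs_mult, (Rabs_pos_eq (/ scale)) by (left; now apply Rinv_0_lt_compat).
    apply Rmult_le_compat_r; [left; now apply Rinv_0_lt_compat|].
    eapply Rle_trans; [apply Rabs_triang|]. rewrite Rabs_mult.
    apply Rplus_le_compat.
    - eapply Rle_trans; [apply Rabs_triang|]. rewrite !Rabs_mult.
      apply Rplus_le_compat; apply Rmult_le_compat_l; auto using Rabs_pos.
    - apply Rmult_le_compat; auto using Rabs_pos. }
  apply Rabs_le_between in K. apply Rabs_le_between. lra.
Qed.

(** * Enclosures of logarithms and exponentials *)

Lemma nonneg_of_derive (f f' : R -> R) (h : R) : 0 <= h ->
  (forall x, 0 <= x <= h -> is_derive f x (f' x)) -> (forall x, 0 <= x <= h -> 0 <= f' x) ->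
  0 <= f 0 -> 0 <= f h.
Proof.
  intros Hh D P H0.
  destruct (MVT_gen f 0 h f') as (c & Hc & E); rewrite ?Rmin_left, ?Rmax_right in * by lra.
  - intros x Hx. apply D. lra.
  - intros x Hx. apply derivable_continuous_pt. exists (f' x). apply is_derive_Reals, D. lra.
  - specialize (P c Hc). rewrite Rminus_0_r in E. nra.
Qed.

Fixpoint atanh_sum (j : nat) (x : R) : R :=
  match j with O => 0 | S i => atanh_sum i x + 2 * x ^ (2 * i + 1) / INR (2 * i + 1) end.

Definition atanh_tail (j : nat) (x : R) : R := ln (1 + x) - ln (1 - x) - atanh_sum j x.

Lemma atanh_tail_derive (j : nat) (x : R) : -1 < x < 1 ->
  is_derive (atanh_tail j) x (2 * x ^ (2 * j) / (1 - x * x)).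
Proof.
  intros Hx. unfold atanh_tail. induction j as [|j IH].
  - simpl. auto_derive; [lra|]. field. split; nra.
  - apply is_derive_ext with (fun y => (ln (1 + y) - ln (1 - y) - atanh_sum j y)
        - 2 * y ^ (2 * j + 1) / INR (2 * j + 1)).
    { intros y. cbn [atanh_sum].
      match goal with |- @eq _ ?a ?b => change (@eq R a b) end. ring. }
    replace (2 * x ^ (2 * S j) / (1 - x * x))
      with (2 * x ^ (2 * j) / (1 - x * x) - 2 * x ^ (2 * j)).
    2:{ replace (2 * S j)%nat with (S (S (2 * j))) by lia. simpl pow. field. nra. }
    apply (is_derive_minus (fun y => ln (1 + y) - ln (1 - y) - atanh_sum j y)
      (fun y => 2 * y ^ (2 * j + 1) / INR (2 * j + 1))); auto.
    assert (Hn : INR (2 * j + 1) <> 0) by (apply not_0_INR; lia).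
    auto_derive; auto.
    change (j + (j + 0))%nat with (2 * j)%nat.
    replace (Init.Nat.pred (2 * j + 1)) with (2 * j)%nat by lia. field. auto.
Qed.

(** The derivative of the remainder is the closed geometric tail [2 x^(2j) / (1 - x^2)]. The mean
    value theorem from 0 and [1 / (1 - c^2) <= 2] then bound it by twice the undivided next term. *)
Lemma atanh_tail_bounds (j : nat) (x : R) : 0 < x <= / 3 ->
  0 <= atanh_tail j x <= 2 * (2 * x ^ (2 * j + 1)).
Proof.
  intros Hx.
  assert (T0 : atanh_tail j 0 = 0).
  { unfold atanh_tail. rewrite Rplus_0_r, Rminus_0_r.
    assert (atanh_sum j 0 = 0).
    { induction j as [|j IH]; simpl atanh_sum; [auto|]. rewrite IH, pow_i by lia. lra. }
    rewrite H. ring. }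
  destruct (MVT_gen (atanh_tail j) 0 x (fun x => 2 * x ^ (2 * j) / (1 - x * x))) as (c & Hc & E);
    rewrite ?Rmin_left, ?Rmax_right in * by lra.
  - intros y Hy. apply atanh_tail_derive. lra.
  - intros y Hy. apply derivable_continuous_pt. exists (2 * y ^ (2 * j) / (1 - y * y)).
    apply is_derive_Reals, atanh_tail_derive. lra.
  - rewrite T0, !Rminus_0_r in E. rewrite E.
    assert (P : 0 <= c ^ (2 * j) <= x ^ (2 * j)).
    { split; [apply pow_le; lra|apply pow_incr; lra]. }
    assert (I : 0 < / (1 - c * c) <= 2).
    { split; [apply Rinv_0_lt_compat; nra|]. replace 2 with (/ / 2) by lra.
      apply Rinv_le_contravar; nra. }
    assert (B : 0 <= c ^ (2 * j) * / (1 - c * c) <= x ^ (2 * j) * 2).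
    { split; [apply Rmult_le_pos; lra|apply Rmult_le_compat; lra]. }
    replace (2 * j + 1)%nat with (S (2 * j)) by lia. simpl pow. unfold Rdiv.
    set (u := c ^ (j + (j + 0)) * / (1 - c * c)) in *.
    replace (2 * c ^ (j + (j + 0)) * / (1 - c * c)) with (2 * u) by (unfold u; ring).
    change (c ^ (2 * j)) with (c ^ (j + (j + 0))) in B. fold u in B.
    change (x ^ (2 * j)) with (x ^ (j + (j + 0))) in B. split; nra.
Qed.

Lemma batanh_contains (k : Z) (fuel : nat) : (3 <= k)%Z -> forall (j : nat) (t : zball),
  contains (2 * (/ IZR k) ^ (2 * j + 1)) t ->
  contains (atanh_tail j (/ IZR k)) (batanh fuel k (2 * Z.of_nat j + 1) t).
Proof.
  intros Hk.
  assert (Hk' : 3 <= IZR k) by (apply IZR_le in Hk; lra).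
  assert (Hx : 0 < / IZR k <= / 3).
  { split; [apply Rinv_0_lt_compat; lra|apply Rinv_le_contravar; lra]. }
  assert (stop : forall j t, contains (2 * (/ IZR k) ^ (2 * j + 1)) t ->
    contains (atanh_tail j (/ IZR k)) (0, 2 * (Z.abs (fst t) + snd t))%Z).
  { intros j t H. unfold contains in *. cbn [fst snd].
    rewrite mult_IZR, plus_IZR, abs_IZR, Rminus_0_r.
    pose proof (atanh_tail_bounds j _ Hx) as [B1 B2]. pose proof scale_pos.
    rewrite Rabs_pos_eq by (apply Rmult_le_pos; lra).
    apply Rle_trans with (2 * (2 * (/ IZR k) ^ (2 * j + 1)) * scale).
    - apply Rmult_le_compat_r; lra.
    - rewrite Rmult_assoc. apply Rmult_le_compat_l; [lra|].
      apply Rabs_le_between in H. pose proof (Rle_abs (IZR (fst t))). lra. }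
  induction fuel as [|fuel IH]; intros j t H; cbn [batanh]; [now apply stop|].
  destruct (Z.eqb_spec (fst t) 0); [now apply stop|].
  apply (contains_eq (2 * (/ IZR k) ^ (2 * j + 1) / IZR (2 * Z.of_nat j + 1)
     + atanh_tail (S j) (/ IZR k))).
  { unfold atanh_tail. simpl atanh_sum.
    replace (IZR (2 * Z.of_nat j + 1)) with (INR (2 * j + 1)); [simpl; ring|].
    rewrite INR_IZR_INZ. f_equal. lia. }
  apply badd_contains.
  - apply bdivz_contains; auto. lia.
  - replace (2 * Z.of_nat j + 1 + 2)%Z with (2 * Z.of_nat (S j) + 1)%Z by lia. apply IH.
    apply (contains_eq (2 * (/ IZR k) ^ (2 * j + 1) / IZR (k * k))).
    + replace (2 * S j + 1)%nat with (S (S (2 * j + 1))) by lia. cbn [pow]. rewrite mult_IZR. field. lra.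
    + apply bdivz_contains; auto. lia.
Qed.

Lemma bln_ratio_contains (n : nat) :
  contains (lnS (S n) - lnS n) (bln_ratio (2 * Z.of_nat (S (S n)) - 1)).
Proof.
  set (k := (2 * Z.of_nat (S (S n)) - 1)%Z).
  assert (Ek : IZR k = 2 * INR (S n) + 1).
  { unfold k. rewrite minus_IZR, mult_IZR, <- INR_IZR_INZ, (S_INR (S n)). ring. }
  pose proof (INR_S_pos n) as P.
  assert (P1 : 1 <= INR (S n)) by (rewrite S_INR; pose proof (pos_INR n); lra).
  apply (contains_eq (atanh_tail 0 (/ IZR k))).
  - unfold atanh_tail, lnS. simpl atanh_sum. rewrite Rminus_0_r.
    replace (1 + / IZR k) with (2 * INR (S (S n)) * / IZR k)
      by (rewrite Ek, (S_INR (S n)); field; lra).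
    replace (1 - / IZR k) with (2 * INR (S n) * / IZR k) by (rewrite Ek; field; lra).
    assert (0 < / IZR k) by (apply Rinv_0_lt_compat; lra).
    pose proof (INR_S_pos (S n)).
    rewrite !ln_mult by lra. ring.
  - unfold bln_ratio. apply (batanh_contains k 70 ltac:(lia) 0).
    apply (contains_eq (2 / IZR k)); [simpl; field; lra|]. apply bdivz_contains; [lia|apply bint_contains].
Qed.

Fixpoint exp_sum (n : nat) (y : R) : R :=
  match n with O => 0 | S k => exp_sum k y + y ^ k / INR (fact k) end.

Lemma is_derive_pow_fact (n : nat) (x : R) :
  is_derive (fun t => t ^ S n / INR (fact (S n))) x (x ^ n / INR (fact n)).
Proof.
  replace (x ^ n / INR (fact n)) with (INR (S n) * x ^ n / INR (fact (S n))).
  - generalize (INR (fact (S n))) (INR_fact_neq_0 (S n)). intros c Hc.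
    auto_derive; auto. simpl Init.Nat.pred. change (match n with O => 1 | S _ => INR n + 1 end) with (INR (S n)).
    field. auto.
  - rewrite fact_simpl, mult_INR. field. split; [apply INR_fact_neq_0|apply not_0_INR; lia].
Qed.

Lemma exp_sum_derive (n : nat) (y : R) : is_derive (exp_sum (S n)) y (exp_sum n y).
Proof.
  induction n as [|n IH].
  - simpl. auto_derive; auto. 
  - change (is_derive (fun y => exp_sum (S n) y + y ^ S n / INR (fact (S n))) y
      (exp_sum n y + y ^ n / INR (fact n))).
    apply (is_derive_plus (exp_sum (S n)) (fun y => y ^ S n / INR (fact (S n)))); auto.
    apply is_derive_pow_fact.
Qed.

(** As a function of [h], the remainder of order [n + 1] has as derivative minus the remainder of
    order [n], and the bounds are related in the same way. Adding and subtracting therefore gives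
    two functions that increase from 0. *)
Lemma exp_remainder (n : nat) : forall h : R, 0 <= h ->
  Rabs (exp (- h) - exp_sum n (- h)) <= h ^ n / INR (fact n).
Proof.
  induction n as [|n IH]; intros h Hh.
  - simpl. rewrite Rminus_0_r, Rabs_pos_eq by (left; apply exp_pos).
    unfold Rdiv. rewrite Rinv_1, Rmult_1_l, <- exp_0. apply exp_le_compat. lra.
  - assert (Dg : forall x, is_derive (fun t => exp (- t) - exp_sum (S n) (- t)) x
        (- (exp (- x) - exp_sum n (- x)))).
    { intros x. apply is_derive_ext with (fun t => (fun y => exp y - exp_sum (S n) y) (- t)); [auto|].
      replace (- (exp (- x) - exp_sum n (- x))) with (scal (-1) (exp (- x) - exp_sum n (- x)))
        by (unfold scal; simpl; unfold mult; simpl; ring).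
      apply (is_derive_comp (fun y => exp y - exp_sum (S n) y) (fun t => - t)).
      - apply (is_derive_minus exp (exp_sum (S n))); [apply is_derive_exp|apply exp_sum_derive].
      - auto_derive; auto. }
    pose proof (is_derive_pow_fact n) as Dp.
    assert (E0 : exp_sum (S n) (- 0) = 1).
    { rewrite Ropp_0. clear. induction n as [|n IH]; simpl; [lra|]. simpl in IH. rewrite IH.
      field. apply (not_0_INR (fact n + n * fact n)). pose proof (lt_O_fact n). lia. }
    assert (P0 : 0 ^ S n / INR (fact (S n)) = 0) by (rewrite pow_i by lia; field; apply INR_fact_neq_0).
    assert (G0 : exp (- 0) - exp_sum (S n) (- 0) = 0) by (rewrite E0, Ropp_0, exp_0; ring).
    apply Rabs_le. split.
    + enough (0 <= h ^ S n / INR (fact (S n)) + (exp (- h) - exp_sum (S n) (- h))) by lra.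
      apply (nonneg_of_derive
        (fun t => t ^ S n / INR (fact (S n)) + (exp (- t) - exp_sum (S n) (- t)))
        (fun x => x ^ n / INR (fact n) + - (exp (- x) - exp_sum n (- x))) h Hh).
      * intros x _. exact (is_derive_plus _ _ x _ _ (Dp x) (Dg x)).
      * intros x Hx. pose proof (IH x ltac:(lra)) as I. apply Rabs_le_between in I. lra.
      * rewrite P0, G0. lra.
    + enough (0 <= h ^ S n / INR (fact (S n)) - (exp (- h) - exp_sum (S n) (- h))) by lra.
      apply (nonneg_of_derive
        (fun t => t ^ S n / INR (fact (S n)) - (exp (- t) - exp_sum (S n) (- t)))
        (fun x => x ^ n / INR (fact n) - - (exp (- x) - exp_sum n (- x))) h Hh).
      * intros x _. exact (is_derive_minus _ _ x _ _ (Dp x) (Dg x)).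
      * intros x Hx. pose proof (IH x ltac:(lra)) as I. apply Rabs_le_between in I. lra.
      * rewrite P0, G0. lra.
Qed.

Fixpoint exp_horner (n k : nat) (y : R) : R :=
  match n with O => 0 | S n => 1 + y * exp_horner n (S k) y / INR (S k) end.

Lemma exp_horner_sum (n : nat) : forall (k : nat) (y : R),
  exp_sum (k + n) y = exp_sum k y + y ^ k / INR (fact k) * exp_horner n k y.
Proof.
  induction n as [|n IH]; intros k y.
  - rewrite Nat.add_0_r. cbn [exp_horner]. ring.
  - replace (k + S n)%nat with (S k + n)%nat by lia. rewrite IH. cbn [exp_horner exp_sum].
    rewrite fact_simpl, mult_INR. cbn [pow]. field.
    split; [apply not_0_INR; lia|apply INR_fact_neq_0].
Qed.

Lemma bexp_horner_contains (y : R) (b : zball) (n : nat) : contains y b ->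
  forall k, contains (exp_horner n k y) (bexp_horner n (Z.of_nat k) b).
Proof.
  intros Hy. induction n as [|n IH]; intros k; cbn [exp_horner bexp_horner].
  - apply bint_contains.
  - replace (Z.of_nat k + 1)%Z with (Z.of_nat (S k)) by lia.
    apply badd_contains; [apply bint_contains|]. rewrite INR_IZR_INZ.
    apply bdivz_contains; [lia|]. now apply bmul_contains.
Qed.

(** The factorial in binary, so that the remainder bound with [24!] is settled by computation. *)
Fixpoint Zfact (n : nat) : Z :=
  match n with O => 1%Z | S k => (Z.of_nat (S k) * Zfact k)%Z end.

Lemma INR_fact (n : nat) : INR (fact n) = IZR (Zfact n).
Proof.
  induction n as [|n IH]; [reflexivity|].
  rewrite fact_simpl, mult_INR, IH. cbn [Zfact]. now rewrite mult_IZR, <- INR_IZR_INZ.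
Qed.

Lemma iter_square_contains (t : R) (b : zball) (n : nat) : contains (exp t) b ->
  contains (exp (2 ^ n * t)) (Nat.iter n (fun z => bmul z z) b).
Proof.
  intros H. induction n as [|n IH].
  - simpl. now rewrite Rmult_1_l.
  - change (Nat.iter (S n) (fun z => bmul z z) b)
      with (bmul (Nat.iter n (fun z => bmul z z) b) (Nat.iter n (fun z => bmul z z) b)).
    apply (contains_eq (exp (2 ^ n * t) * exp (2 ^ n * t))).
    + rewrite <- exp_plus. f_equal. simpl. ring.
    + now apply bmul_contains.
Qed.

Lemma bexp_contains (y : R) (b : zball) : -32 <= y <= 0 -> contains y b -> contains (exp y) (bexp b).
Proof.
  intros Hy Hb. unfold bexp.
  set (h := - (y / 512)). assert (Hh : 0 <= h <= / 16) by (unfold h; lra).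
  assert (H0 : contains (exp (y / 512)) (badd (bexp_horner 24 0 (bdivz b 512)) (0, 1)%Z)).
  { apply contains_widen with (exp_horner 24 0 (y / 512)).
    - apply (bexp_horner_contains _ _ 24); apply (bdivz_contains y b 512); auto; lia.
    - pose proof (exp_horner_sum 24 0 (y / 512)) as E. 
      change (0 + 24)%nat with 24%nat in E.
      replace (exp_horner 24 0 (y / 512)) with (exp_sum 24 (y / 512))
        by (rewrite E; change (exp_sum 0 (y / 512)) with 0;
            change (INR (fact 0)) with 1; rewrite pow_O; field).
      pose proof (exp_remainder 24 h ltac:(lra)) as R.
      replace (- h) with (y / 512) in R by (unfold h; lra).
      apply Rle_trans with ((/ 16) ^ 24 / INR (fact 24) * scale).
      + apply Rmult_le_compat_r; [left; apply scale_pos|]. eapply Rle_trans; [apply R|].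
        apply Rmult_le_compat_r.
        * left. apply Rinv_0_lt_compat. apply INR_fact_lt_0.
        * apply pow_incr. lra.
      + rewrite INR_fact, pow_inv, (pow_IZR 16 24). unfold scale, Rdiv.
        rewrite <- Rinv_mult, <- mult_IZR.
        apply Rmult_le_reg_l with (IZR (16 ^ Z.of_nat 24 * Zfact 24)).
        * apply IZR_lt. reflexivity.
        * rewrite <- Rmult_assoc, Rinv_r, Rmult_1_l, Rmult_1_r.
          -- apply IZR_le. intros C. vm_compute in C. discriminate.
          -- apply eq_IZR_contrapositive. intros C. vm_compute in C. discriminate. }
  apply (contains_eq (exp (2 ^ 9 * (y / 512)))); [f_equal; simpl; field|].
  now apply (iter_square_contains _ _ 9).
Qed.

(** * Euler's transformation *)

Definition dentry : zball * zball := (bint 0, bint 0).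

Definition entry_ok (x : R) (k : nat) (p : zball * zball) : Prop :=
  contains (lnS k) (fst p) /\ contains (exp (- x * lnS k)) (snd p).

(** From [1024 = 2 ^ 10] and [2 <= exp 1]. With [x <= 3] this keeps the exponents [- x ln n] in the
    range [[-32, 0]] of [bexp_contains]. *)
Lemma lnS_le_10 (k : nat) : (k < 1024)%nat -> lnS k <= 10.
Proof.
  intros Hk. unfold lnS. rewrite <- (ln_exp 10). apply ln_le; [apply INR_S_pos|].
  apply Rle_trans with 1024.
  - replace 1024 with (INR 1024) by (rewrite INR_IZR_INZ; reflexivity). apply le_INR. lia.
  - replace 1024 with (2 ^ 10) by (simpl; ring).
    replace (exp 10) with (exp 1 ^ 10).
    + apply pow_incr. pose proof (exp_ineq1_le 1). lra.
    + simpl. rewrite Rmult_1_r, <- !exp_plus. f_equal. ring.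
Qed.

Lemma bentry_ok (x : R) (ns : zball) (n : nat) (t : list (zball * zball)) :
  0 <= x <= 3 -> contains (- x) ns -> (S n < 1024)%nat ->
  (forall k, (k <= n)%nat -> entry_ok x k (nth k t dentry)) ->
  entry_ok x (S n) (bentry ns t (S (S n))).
Proof.
  intros Hx Hns Hn Ht. unfold bentry.
  destruct (find _ _) as [d|] eqn:F.
  - apply find_some in F. destruct F as [Fin F].
    apply andb_prop in F. destruct F as [F1 F2].
    apply Nat.eqb_eq in F1. apply Nat.ltb_lt in F2.
    assert (d2 : (2 <= d)%nat) by (simpl in Fin; lia).
    set (m := (S (S n) / d)%nat).
    assert (E : (S (S n) = d * m)%nat).
    { pose proof (Nat.div_mod_eq (S (S n)) d). unfold m. lia. }
    assert (m1 : (1 <= m)%nat) by (destruct m; lia).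
    destruct (Ht (d - 1)%nat ltac:(nia)) as [A1 A2].
    destruct (Ht (m - 1)%nat ltac:(nia)) as [B1 B2].
    change (bint 0, bint 0) with dentry.
    assert (L : lnS (S n) = lnS (d - 1) + lnS (m - 1)).
    { unfold lnS. rewrite E, mult_INR.
      replace (S (d - 1)) with d by lia. replace (S (m - 1)) with m by lia.
      apply ln_mult; apply lt_0_INR; lia. }
    split; cbn [fst snd].
    + rewrite L. now apply badd_contains.
    + apply (contains_eq (exp (- x * lnS (d - 1)) * exp (- x * lnS (m - 1)))).
      * rewrite <- exp_plus. f_equal. rewrite L. ring.
      * now apply bmul_contains.
  - replace (S (S n) - 2)%nat with n by lia. change (bint 0, bint 0) with dentry.
    assert (L : contains (lnS (S n)) (badd (fst (nth n t dentry))
      (bln_ratio (2 * Z.of_nat (S (S n)) - 1)))).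
    { apply (contains_eq (lnS n + (lnS (S n) - lnS n))); [ring|].
      apply badd_contains; [now apply Ht|apply bln_ratio_contains]. }
    split; cbn [fst snd]; auto.
    apply bexp_contains.
    + pose proof (lnS_ge_0 (S n)). pose proof (lnS_le_10 (S n) Hn). nra.
    + now apply bmul_contains.
Qed.

Lemma btable_ok (x : R) (ns : zball) (n : nat) :
  0 <= x <= 3 -> contains (- x) ns -> (n < 1024)%nat ->
  length (btable ns n) = S n /\
  forall k, (k <= n)%nat -> entry_ok x k (nth k (btable ns n) dentry).
Proof.
  intros Hx Hns. induction n as [|n IH]; intros Hn.
  - split; [reflexivity|]. intros k Hk. replace k with 0%nat by lia. simpl.
    split; cbn [fst snd]; rewrite lnS_0.
    + apply bint_contains.
    + rewrite Rmult_0_r, exp_0. apply bint_contains.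
  - destruct (IH ltac:(lia)) as [L T]. cbn [btable]. split.
    + rewrite length_app, L. simpl. lia.
    + intros k Hk. destruct (Nat.eq_dec k (S n)) as [->|Hne].
      * rewrite app_nth2 by lia. rewrite L, Nat.sub_diag. cbn [nth].
        apply bentry_ok; auto.
      * rewrite app_nth1 by lia. apply T. lia.
Qed.

(** * Finite differences and the truncation error *)

Definition sdiff (u : nat -> R) (k : nat) : R := u (S k) - u k.

Fixpoint euler_sum (n : nat) (u : nat -> R) : R :=
  match n with O => 0 | S n => (u 0%nat - euler_sum n (sdiff u)) / 2 end.

Definition alt_series (u : nat -> R) : R := Series (fun k => (-1) ^ k * u k).

Definition rsummable (u : nat -> R) : Prop := ex_series (fun k => Rabs (u k)).

Lemma alt_summable (u : nat -> R) : rsummable u -> ex_series (fun k => (-1) ^ k * u k).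
Proof.
  apply ex_series_bound. intros k. rewrite Rabs_mult, pow_1_abs. lra.
Qed.

Lemma rsummable_shift (u : nat -> R) : rsummable u -> rsummable (fun k => u (S k)).
Proof. intros H. apply (ex_series_incr_1 (fun k => Rabs (u k))). exact H. Qed.

Lemma rsummable_sdiff (u : nat -> R) : rsummable u -> rsummable (sdiff u).
Proof.
  intros H. apply ex_series_bound with (fun k => Rabs (u (S k)) + Rabs (u k)).
  - intros k. rewrite Rabs_Rabsolu. unfold sdiff, Rminus.
    eapply Rle_trans; [apply Rabs_triang|]. rewrite Rabs_Ropp. lra.
  - apply ex_series_Rplus; auto. now apply rsummable_shift.
Qed.

Lemma alt_series_shift (u : nat -> R) : rsummable u ->
  alt_series u = u 0%nat - alt_series (fun k => u (S k)).
Proof.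
  intros H. unfold alt_series. rewrite Series_incr_1 by now apply alt_summable.
  rewrite (Series_ext _ (fun k => -1 * ((-1) ^ k * u (S k)))) by (intros; simpl; ring).
  rewrite Series_scal_l. simpl. ring.
Qed.

Lemma alt_series_euler (u : nat -> R) : rsummable u ->
  alt_series u = (u 0%nat - alt_series (sdiff u)) / 2.
Proof.
  intros H. pose proof (alt_series_shift u H) as E.
  assert (D : alt_series (sdiff u) = alt_series (fun k => u (S k)) - alt_series u).
  { unfold alt_series. rewrite <- Series_minus.
    - apply Series_ext. intros k. unfold sdiff. ring.
    - now apply (alt_summable (fun k => u (S k))), rsummable_shift.
    - now apply alt_summable. }
  rewrite D. lra.
Qed.

(** The remainder is exact: [n] applications of [S(u) = (u 0 - S(sdiff u)) / 2] leave the
    alternating series of the [n]-th differences. *)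
Lemma euler_remainder (n : nat) : forall u : nat -> R, rsummable u ->
  alt_series u - euler_sum n u = (- / 2) ^ n * alt_series (Nat.iter n sdiff u).
Proof.
  induction n as [|n IH]; intros u H.
  - simpl. ring.
  - pose proof (IH (sdiff u) (rsummable_sdiff u H)) as I.
    rewrite (alt_series_euler u H). cbn [euler_sum pow].
    replace ((u 0%nat - alt_series (sdiff u)) / 2 - (u 0%nat - euler_sum n (sdiff u)) / 2)
      with (- / 2 * (alt_series (sdiff u) - euler_sum n (sdiff u))) by field.
    rewrite I, <- Nat.iter_succ_r. ring.
Qed.

(* [g] is a tower of successive derivatives on [(0, +oo)]; the [n]-th finite
   difference is a value of the [n]-th derivative up to the mean value theorem. *)
Lemma finite_difference_bound (n : nat) : forall (g : nat -> R -> R) (x0 B : R), 0 < x0 ->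
  (forall i x, 0 < x -> is_derive (g i) x (g (S i) x)) ->
  (forall y, x0 <= y -> Rabs (g n y) <= B) ->
  Rabs (Nat.iter n sdiff (fun k => g 0%nat (x0 + INR k)) 0%nat) <= B.
Proof.
  induction n as [|n IH]; intros g x0 B Hx0 Hg HB.
  - simpl. rewrite Rplus_0_r. apply HB. lra.
  - rewrite Nat.iter_succ_r.
    set (g' := fun i y => g i (y + 1) - g i y).
    replace (Nat.iter n sdiff (sdiff (fun k => g 0%nat (x0 + INR k))) 0%nat)
      with (Nat.iter n sdiff (fun k => g' 0%nat (x0 + INR k)) 0%nat).
    + apply (IH g'); auto.
      * intros i x Hx. unfold g'.
        apply (is_derive_minus (fun y => g i (y + 1)) (g i)); auto.
        replace (g (S i) (x + 1)) with (scal 1 (g (S i) (x + 1)))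
          by (unfold scal; simpl; unfold mult; simpl; ring).
        apply (is_derive_comp (g i) (fun y => y + 1)); [apply Hg; lra|].
        auto_derive; auto.
      * intros y Hy. unfold g'.
        destruct (MVT_gen (g n) y (y + 1) (g (S n))) as (c & Hc & E);
          rewrite ?Rmin_left, ?Rmax_right in * by lra.
        -- intros z Hz. apply Hg. lra.
        -- intros z Hz. apply derivable_continuous_pt. exists (g (S n) z).
           apply is_derive_Reals, Hg. lra.
        -- rewrite E. replace (y + 1 - y) with 1 by ring. rewrite Rmult_1_r. apply HB. lra.
    + assert (X : forall m (v w : nat -> R), (forall k, v k = w k) ->
        forall k, Nat.iter m sdiff v k = Nat.iter m sdiff w k).
      { induction m as [|m IHm]; intros v w E k; simpl; auto. unfold sdiff. now rewrite !(IHm v w E). }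
      apply X. intros k. unfold g', sdiff. rewrite S_INR. f_equal. f_equal. ring.
Qed.

Lemma iter_sdiff_shift (n : nat) (u : nat -> R) (j k : nat) :
  Nat.iter n sdiff u (j + k)%nat = Nat.iter n sdiff (fun i => u (j + i)%nat) k.
Proof.
  revert k. induction n as [|n IH]; intros k; simpl; auto.
  unfold sdiff. rewrite <- !IH. now rewrite Nat.add_succ_r.
Qed.

(** The [i]-th derivative of [(a + b ln y) y^(-x)] is again of this shape, with exponent [- x - i];
    these are its coefficients. The pairs [(1, 0)] and [(0, 1)] cover both alternating series. *)
Fixpoint powlog_coef (x a b : R) (i : nat) : R * R :=
  match i with
  | O => (a, b)
  | S i => let (a', b') := powlog_coef x a b i in
           (- (x + INR i) * a' + b', - (x + INR i) * b')
  end.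

Definition powlog (x a b : R) (i : nat) (y : R) : R :=
  exp (- (x + INR i) * ln y) *
  (fst (powlog_coef x a b i) + snd (powlog_coef x a b i) * ln y).

Lemma powlog_derive (x a b : R) (i : nat) (y : R) : 0 < y ->
  is_derive (powlog x a b i) y (powlog x a b (S i) y).
Proof.
  intros Hy. unfold powlog. cbn [powlog_coef].
  destruct (powlog_coef x a b i) as [a' b']. cbn [fst snd].
  replace (exp (- (x + INR (S i)) * ln y)) with (exp (- (x + INR i) * ln y) * / y).
  - generalize (INR i). intros r. auto_derive; auto. field. lra.
  - rewrite <- (exp_ln y Hy) at 2. rewrite <- exp_Ropp, <- exp_plus. f_equal.
    rewrite S_INR. ring.
Qed.

(** Integer majorants for [x <= 3], computable in closed form. *)
Fixpoint powlog_bound (a b : Z) (i : nat) : Z * Z :=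
  match i with
  | O => (a, b)
  | S i => let (a', b') := powlog_bound a b i in
           ((3 + Z.of_nat i) * a' + b', (3 + Z.of_nat i) * b')%Z
  end.

Lemma powlog_coef_bound (x : R) (a b : Z) (i : nat) : 0 <= x <= 3 -> (0 <= a)%Z -> (0 <= b)%Z ->
  Rabs (fst (powlog_coef x (IZR a) (IZR b) i)) <= IZR (fst (powlog_bound a b i)) /\
  Rabs (snd (powlog_coef x (IZR a) (IZR b) i)) <= IZR (snd (powlog_bound a b i)).
Proof.
  intros Hx Ha Hb. induction i as [|i [I1 I2]].
  - cbn [powlog_coef powlog_bound fst snd]. rewrite !Rabs_pos_eq; [lra| |]; now apply IZR_le.
  - cbn [powlog_coef powlog_bound].
    destruct (powlog_coef x (IZR a) (IZR b) i) as [p q]. destruct (powlog_bound a b i) as [P Q].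
    cbn [fst snd] in *. pose proof (pos_INR i).
    rewrite plus_IZR, !mult_IZR, plus_IZR, <- INR_IZR_INZ.
    assert (K : forall u U, Rabs u <= U -> Rabs (- (x + INR i) * u) <= (3 + INR i) * U).
    { intros u U H'. rewrite Rabs_mult, Rabs_Ropp, (Rabs_pos_eq (x + INR i)) by lra.
      apply Rmult_le_compat; auto using Rabs_pos; lra. }
    split; [|now apply K].
    eapply Rle_trans; [apply Rabs_triang|]. apply Rplus_le_compat; auto.
Qed.

Lemma powlog_decay (x : R) (a b : Z) (i : nat) (y : R) :
  2 <= x <= 3 -> (0 <= a)%Z -> (0 <= b)%Z -> 1 <= y ->
  Rabs (powlog x (IZR a) (IZR b) i y) <=
  (IZR (fst (powlog_bound a b i)) + IZR (snd (powlog_bound a b i))) * exp (- (1 + INR i) * ln y).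
Proof.
  intros Hx Ha Hb Hy. destruct (powlog_coef_bound x a b i ltac:(lra) Ha Hb) as [I1 I2].
  unfold powlog. set (p := fst (powlog_coef _ _ _ _)) in *. set (q := snd (powlog_coef _ _ _ _)) in *.
  set (P := IZR (fst _)) in *. set (Q := IZR (snd _)) in *.
  assert (L0 : 0 <= ln y) by (rewrite <- ln_1; apply ln_le; lra).
  assert (L1 : ln y <= y).
  { pose proof (exp_ineq1_le (ln y)) as E. rewrite exp_ln in E by lra. lra. }
  pose proof (pos_INR i) as Hi.
  rewrite Rabs_mult, (Rabs_pos_eq (exp _)) by (left; apply exp_pos).
  assert (B : Rabs (p + q * ln y) <= (P + Q) * y).
  { eapply Rle_trans; [apply Rabs_triang|]. rewrite Rabs_mult, (Rabs_pos_eq (ln y)) by auto.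
    pose proof (Rabs_pos p). pose proof (Rabs_pos q). nra. }
  (* Replacing [x] by 2 and absorbing the logarithm through [ln y <= y] costs one power of [y],
     which leaves the exponent [1 + i]. *)
  apply Rle_trans with (exp (- (2 + INR i) * ln y) * ((P + Q) * y)).
  - apply Rmult_le_compat; auto using Rabs_pos.
    + left; apply exp_pos.
    + apply exp_le_compat. nra.
  - right. rewrite <- (exp_ln y) at 2 by lra.
    replace (- (1 + INR i) * ln y) with (- (2 + INR i) * ln y + ln y) by ring.
    rewrite exp_plus. ring.
Qed.

(** The decay exponent [1 + n] of the [n]-th derivative is split: [n - 1] is spent at [M + 1] for a
    uniform small factor, and 2 is kept so that the differences are summable, with sum of
    [(k + 2)^(-2)] at most 1. *)
Lemma euler_error (x : R) (a b : Z) (M n : nat) (u : nat -> R) :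
  2 <= x <= 3 -> (0 <= a)%Z -> (0 <= b)%Z -> (1 <= M)%nat -> (1 <= n)%nat ->
  (forall k, u k = powlog x (IZR a) (IZR b) 0 (INR (S M + k))) -> rsummable u ->
  Rabs (alt_series u - euler_sum n u) <=
  (/ 2) ^ n * ((IZR (fst (powlog_bound a b n)) + IZR (snd (powlog_bound a b n)))
     * (/ INR (S M)) ^ (n - 1)).
Proof.
  intros Hx Ha Hb HM Hn Hu Su. rewrite euler_remainder by auto.
  set (P := IZR (fst (powlog_bound a b n)) + IZR (snd (powlog_bound a b n))).
  rewrite Rabs_mult, <- RPow_abs, Rabs_Ropp, (Rabs_pos_eq (/ 2)) by lra.
  apply Rmult_le_compat_l; [apply pow_le; lra|].
  assert (P0 : 0 <= P).
  { destruct (powlog_coef_bound x a b n ltac:(lra) Ha Hb) as [I1 I2]. unfold P.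
    pose proof (Rabs_pos (fst (powlog_coef x (IZR a) (IZR b) n))).
    pose proof (Rabs_pos (snd (powlog_coef x (IZR a) (IZR b) n))). lra. }
  pose proof (INR_S_pos M) as MP.
  destruct (ex_series_npow_tail 2 ltac:(lra)) as [E1 E2].
  replace (/ (2 - 1)) with 1 in E2 by field.
  assert (T : forall k, Rabs (Nat.iter n sdiff u k) <=
     P * (/ INR (S M)) ^ (n - 1) * exp (- (2) * lnS (S k))).
  { intros k.
    replace k with (k + 0)%nat at 1 by lia. rewrite iter_sdiff_shift.
    set (x0 := INR (S M + k)).
    assert (x01 : INR (S M) <= x0) by (apply le_INR; lia).
    assert (M1 : 2 <= INR (S M)) by (apply (le_INR 2); lia).
    assert (X : forall m (v w : nat -> R), (forall k, v k = w k) ->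
        forall k, Nat.iter m sdiff v k = Nat.iter m sdiff w k).
    { induction m as [|m IHm]; intros v w E j; simpl; auto. unfold sdiff. now rewrite !(IHm v w E). }
    rewrite (X n _ (fun i => powlog x (IZR a) (IZR b) 0 (x0 + INR i))).
    2:{ intros i. rewrite Hu. f_equal. unfold x0. rewrite <- plus_INR. f_equal. lia. }
    eapply Rle_trans; [apply (finite_difference_bound n (powlog x (IZR a) (IZR b)) x0
      (P * exp (- (1 + INR n) * ln x0)))|].
    - lra.
    - intros; now apply powlog_derive.
    - intros y Hy. eapply Rle_trans; [apply powlog_decay; auto; lra|]. fold P.
      apply Rmult_le_compat_l; auto. apply exp_le_compat.
      pose proof (pos_INR n). assert (ln x0 <= ln y) by (apply ln_le; lra). nra.
    - rewrite Rmult_assoc. apply Rmult_le_compat_l; auto.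
      replace (- (1 + INR n) * ln x0) with (- INR (n - 1) * ln x0 + - (2) * ln x0)
        by (rewrite minus_INR by lia; change (INR 1) with 1; ring).
      rewrite exp_plus. apply Rmult_le_compat; try (left; apply exp_pos).
      + replace ((/ INR (S M)) ^ (n - 1)) with (exp (- INR (n - 1) * ln (INR (S M)))).
        * apply exp_le_compat. pose proof (pos_INR (n - 1)).
          assert (ln (INR (S M)) <= ln x0) by (apply ln_le; lra). nra.
        * rewrite pow_inv, <- Rpower_pow, <- Rpower_Ropp by auto. reflexivity.
      + apply exp_le_compat. unfold lnS.
        assert (ln (INR (S (S k))) <= ln x0); [|lra].
        apply ln_le; [apply INR_S_pos|]. apply le_INR. lia. }
  assert (ET : ex_series (fun k => P * (/ INR (S M)) ^ (n - 1) * exp (- (2) * lnS (S k))))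
    by now apply ex_series_Rmult_l.
  unfold alt_series. eapply Rle_trans.
  - apply Series_Rabs. eapply ex_series_bound; [|apply ET]. intros k.
    rewrite Rabs_Rabsolu, Rabs_mult, pow_1_abs, Rmult_1_l. apply T.
  - eapply Rle_trans.
    + apply Series_le; [|apply ET]. intros k. split; [apply Rabs_pos|].
      rewrite Rabs_mult, pow_1_abs, Rmult_1_l. apply T.
    + rewrite Series_scal_l. rewrite <- (Rmult_1_r (P * _)) at 2.
      apply Rmult_le_compat_l; auto. apply Rmult_le_pos; auto. apply pow_le.
      left. now apply Rinv_0_lt_compat.
Qed.

Lemma length_bdiffs (l : list zball) : length (bdiffs l) = (length l - 1)%nat.
Proof.
  induction l as [|x [|y l] IH]; auto. cbn [bdiffs length] in *. rewrite IH. lia.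
Qed.

Lemma nth_bdiffs (l : list zball) (k : nat) (d : zball) : (S k < length l)%nat ->
  nth k (bdiffs l) d = bsub (nth (S k) l d) (nth k l d).
Proof.
  revert k. induction l as [|x [|y l] IH]; intros k Hk; try (simpl in Hk; lia).
  change (bdiffs (x :: y :: l)) with (bsub y x :: bdiffs (y :: l)).
  destruct k as [|k]; [reflexivity|]. cbn [nth]. rewrite IH by (simpl in *; lia). reflexivity.
Qed.

Lemma beuler_contains (n : nat) : forall (l : list zball) (u : nat -> R) (d : zball),
  (n <= length l)%nat -> (forall k, (k < length l)%nat -> contains (u k) (nth k l d)) ->
  contains (euler_sum n u) (beuler n l).
Proof.
  induction n as [|n IH]; intros l u d Hl H.
  - cbn [beuler euler_sum]. unfold contains. cbn [fst snd]. rewrite Rmult_0_l, Rminus_0_r, Rabs_R0. lra.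
  - destruct l as [|x l]; [simpl in Hl; lia|]. cbn [beuler euler_sum].
    apply (bdivz_contains _ _ 2 ltac:(lia)). apply bsub_contains.
    + apply (H 0%nat). simpl. lia.
    + apply (IH _ _ d).
      * rewrite length_bdiffs. simpl in *. lia.
      * intros k Hk. rewrite length_bdiffs in Hk. rewrite nth_bdiffs by lia.
        apply bsub_contains; apply H; lia.
Qed.

Lemma balternating_contains (M : nat) : forall (n : nat) (l : list zball) (u : nat -> R) (d : zball),
  (M + n <= length l)%nat -> (forall k, (k < length l)%nat -> contains (u k) (nth k l d)) ->
  rsummable u ->
  Rabs (alt_series (fun k => u (M + k)%nat) - euler_sum n (fun k => u (M + k)%nat)) * scale <= 1 ->
  contains (alt_series u) (balternating M n l).
Proof.
  induction M as [|M IH]; intros n l u d Hl H Su He.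
  - assert (E : balternating 0 n l = badd (beuler n l) (0, 1)%Z) by (destruct l; reflexivity).
    rewrite E. apply contains_widen with (euler_sum n u); auto.
    now apply (beuler_contains n l u d).
  - destruct l as [|x l]; [simpl in Hl; lia|]. cbn [balternating].
    rewrite alt_series_shift by auto. apply bsub_contains.
    + apply (H 0%nat). simpl. lia.
    + apply (IH n l (fun k => u (S k)) d).
      * simpl in Hl. lia.
      * intros k Hk. apply (H (S k)). simpl. lia.
      * now apply rsummable_shift.
      * exact He.
Qed.

(** With 100 terms skipped and 65 differences, the bound gains [2 ^ 65] from the halvings and
    [101 ^ 64] from the decay, against the growth of the derivative coefficients. What remains is an
    inequality between integers. *)
Lemma euler_error_scaled (x : R) (a b : Z) (u : nat -> R) : 2 <= x <= 3 ->
  (0 <= a)%Z -> (0 <= b)%Z ->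
  (forall k, u k = powlog x (IZR a) (IZR b) 0 (INR (S k))) -> rsummable u ->
  (let (A, B) := powlog_bound a b 65 in 2 ^ prec * (A + B) <= 2 ^ 65 * 101 ^ 64)%Z ->
  Rabs (alt_series (fun k => u (100 + k)%nat) - euler_sum 65 (fun k => u (100 + k)%nat)) * scale <= 1.
Proof.
  intros Hx Ha Hb Hu Su HZ.
  pose proof (euler_error x a b 100 65 (fun k => u (100 + k)%nat) Hx Ha Hb ltac:(lia) ltac:(lia)) as T.
  destruct (powlog_bound a b 65) as [P Q]. cbn [fst snd] in T.
  eapply Rle_trans.
  - apply Rmult_le_compat_r; [left; apply scale_pos|]. apply T.
    + intros k. rewrite Hu. do 2 f_equal.
    + apply (ex_series_incr_n (fun k => Rabs (u k)) 100). exact Su.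
  - change (65 - 1)%nat with 64%nat. rewrite !pow_inv, INR_IZR_INZ, !pow_IZR.
    change (Z.of_nat 101) with 101%Z. change (Z.of_nat 65) with 65%Z. change (Z.of_nat 64) with 64%Z.
    unfold scale. apply IZR_le in HZ. rewrite !mult_IZR, plus_IZR in HZ.
    assert (K1 : 0 < IZR (2 ^ 65)) by (apply IZR_lt; reflexivity).
    assert (K2 : 0 < IZR (101 ^ 64)) by (apply IZR_lt; reflexivity).
    revert HZ K1 K2. generalize (IZR (2 ^ 65)) (IZR (101 ^ 64)) (IZR (2 ^ prec)) (IZR P + IZR Q).
    intros c d s p HZ K1 K2.
    apply Rmult_le_reg_l with (c * d); [now apply Rmult_lt_0_compat|].
    rewrite Rmult_1_r. eapply Rle_trans; [|apply HZ]. right. field. lra.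
Qed.

(** * Certified signs and the final assembly *)

Lemma alt_rdirichlet (a : nat -> R) (x : R) :
  rdirichlet (fun n => a n * (if Nat.odd n then 1 else -1)) x =
  alt_series (fun k => a (S k) * exp (- x * lnS k)).
Proof.
  apply Series_ext. intros k.
  assert (E : (-1) ^ k = if Nat.odd (S k) then 1 else -1).
  { induction k as [|k IH]; [reflexivity|]. rewrite Nat.odd_succ, <- Nat.negb_odd.
    cbn [pow]. rewrite IH. destruct (Nat.odd (S k)); simpl; ring. }
  rewrite <- E. ring.
Qed.

Lemma btest_contains (x : R) (ns : zball) : 2 <= x <= 3 -> contains (- x) ns ->
  contains (eta_test x) (btest ns).
Proof.
  intros Hx Hns.
  destruct (btable_ok x ns 164 ltac:(lra) Hns ltac:(lia)) as [L T].
  unfold btest. set (t := btable ns 164) in *. cbv zeta.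
  assert (EX : forall k, exp (- x * lnS k) = powlog x 1 0 0 (INR (S k))).
  { intros k. unfold powlog. cbn [powlog_coef fst snd]. change (INR 0) with 0.
    change (ln (INR (S k))) with (lnS k).
    rewrite Rplus_0_r, Rmult_0_l, Rplus_0_r, Rmult_1_r. reflexivity. }
  assert (EL : forall k, lnS k * exp (- x * lnS k) = powlog x 0 1 0 (INR (S k))).
  { intros k. unfold powlog. cbn [powlog_coef fst snd]. change (INR 0) with 0.
    change (ln (INR (S k))) with (lnS k).
    rewrite Rplus_0_r, Rmult_1_l, Rplus_0_l. ring. }
  assert (S0 : rsummable (fun k => exp (- x * lnS k))).
  { apply ex_series_bound with (fun k => exp (- x * lnS k)); [|apply ex_series_npow; lra].
    intros k. rewrite Rabs_Rabsolu, Rabs_pos_eq; [lra|left; apply exp_pos]. }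
  assert (S1 : rsummable (fun k => lnS k * exp (- x * lnS k))).
  { apply ex_series_bound with (fun k => (1 + lnS k) ^ 1 * exp (- x * lnS k));
      [|apply ex_series_log_npow; lra].
    intros k. rewrite Rabs_Rabsolu. pose proof (lnS_ge_0 k). pose proof (exp_pos (- x * lnS k)).
    rewrite Rabs_pos_eq by (apply Rmult_le_pos; lra). simpl. nra. }
  assert (C0 : contains (alt_series (fun k => exp (- x * lnS k))) (balternating 100 65 (map snd t))).
  { apply (balternating_contains 100 65 _ _ (snd dentry)); [| |exact S0|].
    - rewrite length_map, L. lia.
    - intros k Hk. rewrite length_map, L in Hk. rewrite map_nth. apply T. lia.
    - apply (euler_error_scaled x 1 0 (fun k => exp (- x * lnS k)) Hx);
        [lia|lia|exact EX|exact S0|]. intros C. vm_compute in C. discriminate. }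
  assert (C1 : contains (alt_series (fun k => lnS k * exp (- x * lnS k)))
    (balternating 100 65 (map (fun p => bmul (fst p) (snd p)) t))).
  { apply (balternating_contains 100 65 _ _ (bmul (fst dentry) (snd dentry))); [| |exact S1|].
    - rewrite length_map, L. lia.
    - intros k Hk. rewrite length_map, L in Hk.
      rewrite (map_nth (fun p => bmul (fst p) (snd p))). destruct (T k ltac:(lia)) as [T1 T2].
      now apply bmul_contains.
    - apply (euler_error_scaled x 0 1 (fun k => lnS k * exp (- x * lnS k)) Hx);
        [lia|lia|exact EL|exact S1|]. intros C. vm_compute in C. discriminate. }
  (* Entry 1 belongs to the integer 2: it encloses [ln 2] and [qr x]. *)
  destruct (T 1%nat ltac:(lia)) as [T1 T2].
  change (bint 0, bint 0) with dentry.
  set (e0 := balternating 100 65 (map snd t)) in *.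
  set (e1 := balternating 100 65 (map (fun p => bmul (fst p) (snd p)) t)) in *.
  set (q := snd (nth 1 t dentry)) in *. set (l2 := fst (nth 1 t dentry)) in *.
  assert (El2 : lnS 1 = ln 2) by reflexivity.
  rewrite El2 in T1, T2. fold (qr x) in T2.
  unfold eta_test. rewrite (alt_rdirichlet (fun n => ln (INR n))).
  replace (rdirichlet (fun n => if Nat.odd n then 1 else -1) x)
    with (alt_series (fun k => exp (- x * lnS k))).
  2:{ transitivity (rdirichlet (fun n => 1 * (if Nat.odd n then 1 else -1)) x).
      - rewrite (alt_rdirichlet (fun _ => 1)). apply Series_ext. intros k. ring.
      - apply Series_ext. intros k. ring. }
  apply badd_contains.
  - apply bmul_contains; [exact C1|]. apply bmul_contains.
    + apply bsub_contains; [apply bint_contains|].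
      apply (contains_eq (qr x + qr x)); [ring|]. now apply badd_contains.
    + apply bsub_contains; [apply bint_contains|]. now apply bmul_contains.
  - apply bmul_contains; [|exact C0]. apply bmul_contains; [|exact T1].
    apply bmul_contains.
    + apply (contains_eq (qr x * qr x + qr x * qr x)); [ring|].
      apply badd_contains; now apply bmul_contains.
    + apply bsub_contains; [apply bint_contains|exact T2].
Qed.

Lemma sigma_ball_contains (a : Z) : contains (IZR a / 10 ^ 45) (sigma_ball a).
Proof.
  unfold sigma_ball. apply (contains_eq (IZR a / IZR (10 ^ 45))).
  - rewrite (pow_IZR 10 45). reflexivity.
  - apply bdivz_contains; [reflexivity|apply bint_contains].
Qed.

Lemma contains_pos (x : R) (b : zball) : contains x b -> (snd b < fst b)%Z -> 0 < x.
Proof.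
  unfold contains. intros H Hb. apply IZR_lt in Hb. apply Rabs_le_between in H.
  pose proof scale_pos. nra.
Qed.

Lemma contains_neg (x : R) (b : zball) : contains x b -> (fst b + snd b < 0)%Z -> x < 0.
Proof.
  unfold contains. intros H Hb. apply IZR_lt in Hb. rewrite plus_IZR in Hb.
  apply Rabs_le_between in H. pose proof scale_pos. nra.
Qed.

Lemma eta_test_lower : 0 < eta_test (2813014020252898367527255401216686963846140560 / 10 ^ 45).
Proof.
  eapply contains_pos.
  - apply btest_contains.
    + simpl pow. lra.
    + eapply contains_eq; [|apply (sigma_ball_contains (-2813014020252898367527255401216686963846140560))].
      unfold Rdiv. generalize (/ 10 ^ 45). intros c. lra.
  (* The goal is a closed integer comparison; checking it evaluates the entire table and both Euler
     sums. *)
  - vm_cast_no_check (eq_refl Lt).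
Qed.

Lemma eta_test_upper : eta_test (2813014020252898367527255401216686963846140561 / 10 ^ 45) < 0.
Proof.
  eapply contains_neg.
  - apply btest_contains.
    + simpl pow. lra.
    + eapply contains_eq; [|apply (sigma_ball_contains (-2813014020252898367527255401216686963846140561))].
      unfold Rdiv. generalize (/ 10 ^ 45). intros c. lra.
  - vm_cast_no_check (eq_refl Lt).
Qed.

Theorem theorem5p1 :
  exists E : R,
    unique (fun sigma : R => 1 < sigma /\ E_equation sigma) E /\
    (forall s : C, E < Re s -> zeta' s <> RtoC 0) /\
    (exists s_ : nat -> C,
       (forall k : nat, 1 < Re (s_ k) /\ zeta' (s_ k) = RtoC 0) /\
       is_lim_seq (fun k : nat => Re (s_ k)) (Finite E)) /\
    2.813014020252898367527255401216686963846140560 <= E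
      < 2.813014020252898367527255401216686963846140561.
Proof.
  set (a := 2813014020252898367527255401216686963846140560 / 10 ^ 45).
  set (b := 2813014020252898367527255401216686963846140561 / 10 ^ 45).
  assert (Ea : 2.813014020252898367527255401216686963846140560 = a)
    by (unfold a; rewrite (pow_IZR 10 45); reflexivity).
  assert (Eb : 2.813014020252898367527255401216686963846140561 = b)
    by (unfold b; rewrite (pow_IZR 10 45); reflexivity).
  rewrite Ea, Eb.
  assert (Hab : 5 / 2 < a /\ a < b /\ b <= 3) by (rewrite <- Ea, <- Eb; lra).
  destruct (Hr_root_between a b) as (E & HE & HH);
    [lra|lra|lra|apply eta_test_lower|apply eta_test_upper|].
  assert (root_iff : forall x, 1 < x -> (E_equation x <-> Hr x = ln 2)).
  { intros x Hx. rewrite E_equation_iff, qr_Hr by auto.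
    destruct (qr_bounds x Hx) as [q0 _]. split; intros H.
    - apply Rmult_eq_reg_l with (qr x); lra.
    - now rewrite H. }
  exists E. split; [|split; [|split; [|exact HE]]].
  - split.
    + split; [lra|]. apply root_iff; auto; lra.
    + intros x [Hx Ex]. apply root_iff in Ex; auto.
      destruct (Rtotal_order E x) as [L|[L|L]]; auto.
      * pose proof (Hr_strictly_decreasing E x ltac:(lra) L). lra.
      * pose proof (Hr_strictly_decreasing x E ltac:(lra) L). lra.
  - intros s Hs. apply (zeta'_neq_0 E); auto; lra.
  (* The [k]-th zero is taken within [1 / (k + 1)] of the line, and choice assembles the
     sequence. *)
  - destruct (choice (fun (k : nat) (s : C) =>
      1 < Re s /\ zeta' s = RtoC 0 /\ Rabs (Re s - E) <= / INR (S k))) as [s_ Hs].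
    { intros k. apply zeta'_zero_near; auto; [lra|]. apply Rinv_0_lt_compat, INR_S_pos. }
    exists s_. split; [intros k; now destruct (Hs k)|].
    assert (L : is_lim_seq (fun k => / INR (S k)) 0).
    { apply (is_lim_seq_incr_1 (fun k => / INR k)).
      replace (Finite 0) with (Rbar_inv p_infty) by reflexivity.
      apply is_lim_seq_inv; [apply is_lim_seq_INR|discriminate]. }
    apply is_lim_seq_le_le with (fun k => E - / INR (S k)) (fun k => E + / INR (S k)).
    + intros k. destruct (Hs k) as (_ & _ & H). apply Rabs_le_between in H. lra.
    + replace (Finite E) with (Finite (E - 0)) by (f_equal; ring).
      apply is_lim_seq_minus'; [apply is_lim_seq_const|exact L].
    + replace (Finite E) with (Finite (E + 0)) by (f_equal; ring).
      apply is_lim_seq_plus'; [apply is_lim_seq_const|exact L].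
Qed.
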